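(* Let $\mu$ be a locally finite positive Borel measure on $\mathbb{R}^d$, let $\mathcal{S}\subset\mathcal{D}$ be a sparse collection (with respect to $\mu$) of cubes of a dyadic grid $\mathcal{D}$, let $\mathcal{H}$ be a separable Hilbert space, and let $W:\mathbb{R}^d\to\mathcal{B}(\mathcal{H})$ be an operator-valued weight. The sparse Lerner operators $T^{\mathcal{S}}_{\psi,\varphi}\otimes\mathbf{1}$, for all admissible sequences $\psi=\{\psi_Q\}_{Q\in\mathcal{S}}$ and $\varphi=\{\varphi_Q\}_{Q\in\mathcal{S}}$, extend to bounded linear operators on $L^2_W(\mu,\mathcal{H})$ if and only if $W$ belongs to $\mathcal{A}^{\mathcal{S}}_2(\mu)$. Moreover, there exists an absolute constant $C>0$ such that $$\frac1C\,[W]^{1/2}_{\mathcal{A}^{\mathcal{S}}_2(\mu)}\ \le\ \sup_{\psi,\varphi}\big\|T^{\mathcal{S}}_{\psi,\varphi}\otimes\mathbf{1}\big\|_{L^2_W\to L^2_W}\ \le\ C\,[W]^{3/2}_{\mathcal{A}^{\mathcal{S}}_2(\mu)},$$ where the supremum is taken over all admissible sequences $\psi,\varphi$.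
   Context: Dyadic grid: a countable collection $\mathcal{D}$ of cubes in $\mathbb{R}^d$ such that every $Q\in\mathcal{D}$ has sidelength $2^k$ for some $k\in\mathbb{Z}$; for each $k$ the cubes of sidelength $2^k$ in $\mathcal{D}$ form a partition of $\mathbb{R}^d$; and $Q\cap Q'\in\{\emptyset,Q,Q'\}$ for all $Q,Q'\in\mathcal{D}$. Sparse: $\mathcal{S}\subset\mathcal{D}$ is sparse (with respect to $\mu$) if for any $Q\in\mathcal{D}$, $\sum_{Q'\in \mathbf{Ch}_{\mathcal{S}}(Q)}\mu(Q')\le\frac12\mu(Q)$, where $\mathbf{Ch}_{\mathcal{S}}(Q)$ is the set of maximal (with respect to inclusion) cubes of $\mathcal{S}$ strictly contained in $Q$. Averages: $\langle f\rangle_{\mu,Q}=\frac{1}{\mu(Q)}\int_Q f\,d\mu$. Operator-valued weight: $W:\mathbb{R}^d\to\mathcal{B}(\mathcal{H})$, with values positive, invertible operators ($\mu$-a.e.), such that for every $e\in\mathcal{H}$, $w_e(x)=(W(x)e\,|\,e)_{\mathcal{H}}$ is a usual scalar weight, and such that both $W$ and $W^{-1}$ are weakly locally $\mu$-integrable: for all $u,v\in\mathcal{H}$, $x\mapsto (W^{\pm1}(x)u\,|\,v)_{\mathcal{H}}$ is $\mu$-integrable on compact sets and $\big|\int_Q (W^{\pm1}(x)u\,|\,v)_{\mathcal{H}}\,d\mu(x)\big|\le C_{\mu,Q}\|u\|_{\mathcal{H}}\|v\|_{\mathcal{H}}$ for every dyadic cube $Q$. Thus $\langle W^{\pm1}\rangle_{\mu,Q}$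 are bounded positive operators on $\mathcal{H}$ (defined weakly). $W$ belongs to $\mathcal{A}^{\mathcal{S}}_2(\mu)$ if $[W]_{\mathcal{A}^{\mathcal{S}}_2(\mu)}:=\sup_{Q\in\mathcal{S}}\big\|\langle W\rangle^{1/2}_{\mu,Q}\langle W^{-1}\rangle^{1/2}_{\mu,Q}\big\|^2_{\mathcal{B}(\mathcal{H})}<\infty$. $L^2_W=L^2_W(\mu,\mathcal{H})$ is the space of weakly locally $\mu$-integrable $\mathcal{H}$-valued functions on $\mathbb{R}^d$ with $\|f\|^2_{L^2_W}=\int_{\mathbb{R}^d}\|W^{1/2}f\|^2_{\mathcal{H}}\,d\mu<\infty$. $L^\infty_0(\mu)$ denotes complex-valued $\mu$-essentially bounded functions with compact support; $L^\infty_0(\mu)\otimes\mathcal{H}$ is the space of finite sums $\sum f\otimes e$ with $f\in L^\infty_0(\mu)$, $e\in\mathcal{H}$, which is dense in $L^2_W$. For a linear operator $T$ on scalar functions, $T\otimes\mathbf{1}$ is defined on $L^\infty_0(\mu)\otimes\mathcal{H}$ by $(T\otimes\mathbf{1})(\sum f\otimes e)=\sum T(f)\otimes e$, and, when bounded, also denotes its unique continuous extension to $L^2_W$. Sparse Lerner operators: sequences $\psi=\{\psi_Q\}_{Q\in\mathcal{S}}$, $\varphi=\{\varphi_Q\}_{Q\in\mathcal{S}}$ are admissible if $\psi_Q,\varphi_Q$ are complex-valued functions supported on $Q$ with $\|\psi_Q\|_{L^\infty(\mu)}\le1$ and $\|\varphi_Q\|_{L^\infty(\mu)}\le1$. Then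 $$T^{\mathcal{S}}_{\psi,\varphi}f(x)=\sum_{Q\in\mathcal{S}}\psi_Q(x)\,\langle\varphi_Q f\rangle_{\mu,Q}.$$ *)

(* Defs.v *)
(* R : realType is the real line and R[i] its field of complex numbers. *)
From HB Require Import structures.
From mathcomp Require Import all_boot all_order all_algebra.
From mathcomp Require Import all_classical all_reals all_analysis.
From mathcomp Require Import sesquilinear complex.
From mathcomp Require summability.

Set Implicit Arguments.
Unset Strict Implicit.
Unset Printing Implicit Defensive.

Import Order.TTheory GRing.Theory Num.Theory.
Import numFieldNormedType.Exports.

Local Open Scope classical_set_scope.
Local Open Scope ring_scope.
Local Open Scope complex_scope.

(* 'rV[R]_d carries its usual topology; this alias also carries the Borel
   sigma-algebra. *)
Notation Rd R d := (g_sigma_algebraType (@open 'rV[R]_d)).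

Section dyadic.
Context {R : realType} {d : nat}.
Implicit Types (mu : {measure set (Rd R d) -> \bar R}).
Implicit Types (Q : set (Rd R d)) (D S : set (set (Rd R d))).

(* Each of the 2 * d faces may be included or not. *)
Definition cube (l : R) Q :=
  exists (a : 'rV[R]_d) (lo hi : 'I_d -> bool),
    Q = [set x : Rd R d | forall i : 'I_d, (x : 'rV[R]_d) ord0 i \in
           Interval (BSide (lo i) (a ord0 i)) (BSide (hi i) (a ord0 i + l))].

Definition dyadic_grid D :=
  [/\ countable D,
      forall Q, D Q -> exists k : int, cube (2 ^ k) Q,
      forall k : int, partition (D `&` cube (2 ^ k)) id setT
    & forall Q Q', D Q -> D Q' -> [\/ Q `&` Q' = set0, Q `&` Q' = Q
                                     | Q `&` Q' = Q']].

Definition locally_finite_measure mu :=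
  forall x : 'rV[R]_d, exists U : set 'rV[R]_d,
    [/\ open U, U x & (mu U < +oo)%E].

Definition children S Q : set (set (Rd R d)) :=
  [set Q' | [/\ S Q', Q' `<` Q &
     forall Q'', S Q'' -> Q'' `<` Q -> Q' `<=` Q'' -> Q'' = Q']].

Definition sparse mu D S :=
  forall Q, D Q ->
    (\esum_(Q' in children S Q) mu Q' <= (2^-1)%:E * mu Q)%E.

End dyadic.

Section complex_integration.
Context {R : realType} {d : nat}.
Implicit Types (mu : {measure set (Rd R d) -> \bar R}).
Implicit Types (A Q : set (Rd R d)) (f g : Rd R d -> R[i]).

Definition cmeasurable f :=
  measurable_fun setT (fun x => complex.Re (f x)) /\
  measurable_fun setT (fun x => complex.Im (f x)).

Definition cintegrable mu A f :=
  mu.-integrable A (fun x => (complex.Re (f x))%:E) /\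
  mu.-integrable A (fun x => (complex.Im (f x))%:E).

Definition cintegral mu A f : R[i] :=
  (\int[mu]_(x in A) complex.Re (f x)) +i* (\int[mu]_(x in A) complex.Im (f x)).

Definition loc_integrable mu f :=
  forall K : set 'rV[R]_d, compact K -> cintegrable mu K f.

(* Equal to 0 when mu Q = 0. *)
Definition average mu Q f : R[i] := (fine (mu Q))^-1%:C * cintegral mu Q f.

(* Measurable, mu-essentially bounded, with compact support. *)
Definition Linf0 mu f :=
  [/\ cmeasurable f,
      exists M : R, {ae mu, forall x, `|f x| <= M%:C}
    & exists K : set 'rV[R]_d, compact K /\ forall x, ~ K x -> f x = 0].

End complex_integration.

Section operators.
Context {R : realType} {H : completeNormedModType R[i]}.
Variable ip : {dot H for Num.conj}.
Implicit Types A B : H -> H.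

(* norms are valued in R[i]; this is the underlying real number *)
Definition rnorm (u : H) : R := complex.Re `|u|.

Definition separable_space := exists X : set H, countable X /\ dense X.

Definition bounded_op A := linear A /\ continuous A.

Definition positive_op A := bounded_op A /\ forall u, 0 <= ip (A u) u.

Definition is_opinv A B := [/\ bounded_op B, A \o B = id & B \o A = id].

Definition invertible_op A := exists B, is_opinv A B.

Definition opinv A : H -> H := xget (cst 0) (is_opinv A).

Definition opsqrt A : H -> H :=
  xget (cst 0) [set B | positive_op B /\ B \o B = A].

Definition opnorm A : \bar R :=
  ereal_sup [set (rnorm (A u))%:E | u in [set u | rnorm u <= 1]].

End operators.

Section weights.
Context {R : realType} {d : nat} {H : completeNormedModType R[i]}.
Variables (mu : {measure set (Rd R d) -> \bar R}) (ip : {dot H for Num.conj}).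
Implicit Types (D S : set (set (Rd R d))) (Q : set (Rd R d)).
Implicit Types (W V : Rd R d -> H -> H) (f : Rd R d -> H).

Definition scalar_weight (w : Rd R d -> R[i]) :=
  loc_integrable mu w /\ {ae mu, forall x, 0 <= w x}.

Definition weakly_loc_integrable_op D V :=
  (forall u v, loc_integrable mu (fun x => ip (V x u) v)) /\
  (forall Q, D Q -> exists C : R, forall u v,
     `|cintegral mu Q (fun x => ip (V x u) v)| <= C%:C * `|u| * `|v|).

Definition operator_weight D W :=
  [/\ forall x, bounded_op (W x),
      {ae mu, forall x, positive_op ip (W x) /\ invertible_op (W x)},
      forall e, scalar_weight (fun x => ip (W x e) e),
      weakly_loc_integrable_op D W
    & weakly_loc_integrable_op D (fun x => opinv (W x))].

Definition opaverage V Q : H -> H :=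
  xget (cst 0) [set A | bounded_op A /\
    forall u v, ip (A u) v = average mu Q (fun x => ip (V x u) v)].

(* The value is in [0, +oo]; adjoining 0 only matters when S is empty. *)
Definition A2_char S W : \bar R :=
  ereal_sup ([set 0%E] `|`
    [set (opnorm (opsqrt ip (opaverage W Q) \o
                  opsqrt ip (opaverage (fun x => opinv (W x)) Q)) `^ 2)%E
       | Q in S]).

Definition A2_class S W := (A2_char S W < +oo)%E.

Definition weakly_loc_integrable f :=
  forall v, loc_integrable mu (fun x => ip (f x) v).

Definition sqnormL2 W f : \bar R :=
  (\int[mu]_x (rnorm (opsqrt ip (W x) (f x)) ^+ 2)%:E)%E.

Definition normL2 W f : \bar R := (sqnormL2 W f `^ 2^-1)%E.

Definition L2 W f := weakly_loc_integrable f /\ (sqnormL2 W f < +oo)%E.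

(* Elements of L2 W are represented by functions, and are identified when they
   are equal mu-a.e.; operators are only required to be linear modulo this
   identification (boundedness then makes them compatible with it). *)
Definition boundedL2 W (E : (Rd R d -> H) -> (Rd R d -> H)) :=
  [/\ forall f, L2 W f -> L2 W (E f),
      forall (a : R[i]) f g, L2 W f -> L2 W g ->
        {ae mu, forall x, E (fun y => a *: f y + g y) x = a *: E f x + E g x}
    & exists M : R, forall f, L2 W f -> (normL2 W (E f) <= M%:E * normL2 W f)%E].

Definition opnormL2 W (E : (Rd R d -> H) -> (Rd R d -> H)) : \bar R :=
  ereal_sup [set normL2 W (E f) | f in [set f | L2 W f /\ (normL2 W f <= 1)%E]].

(* E coincides with T (x) 1 on the finite sums of simple tensors. *)
Definition extends_tensor (T : (Rd R d -> R[i]) -> (Rd R d -> R[i]))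
    (E : (Rd R d -> H) -> (Rd R d -> H)) :=
  forall (n : nat) (f : 'I_n -> Rd R d -> R[i]) (e : 'I_n -> H),
    (forall i, Linf0 mu (f i)) ->
    {ae mu, forall x,
       E (fun y => \sum_(i < n) f i y *: e i) x = \sum_(i < n) T (f i) x *: e i}.

Definition tensor_bounded W T :=
  exists E, boundedL2 W E /\ extends_tensor T E.

(* The infimum is over a family of operators that are all equal on L2 W, by
   density of the sums of simple tensors; it is +oo if there is no bounded
   extension. *)
Definition tensor_norm W T : \bar R :=
  ereal_inf [set opnormL2 W E | E in [set E | boundedL2 W E /\
                                              extends_tensor T E]].

End weights.

Section lerner.
Context {R : realType} {d : nat}.
Variables (mu : {measure set (Rd R d) -> \bar R}) (S : set (set (Rd R d))).
Implicit Types (psi phi : set (Rd R d) -> Rd R d -> R[i]).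

Definition admissible psi :=
  forall Q, S Q ->
    [/\ cmeasurable (psi Q),
        forall x, ~ Q x -> psi Q x = 0
      & {ae mu, forall x, `|psi Q x| <= 1}].

(* The series over S is an unordered sum in the complex plane. *)
Definition lerner psi phi (f : Rd R d -> R[i]) : Rd R d -> R[i] := fun x =>
  summability.sum (fun Q : set (Rd R d) =>
    (if Q \in S then psi Q x * average mu Q (fun y => phi Q y * f y) else 0)
      : R[i]^o).

End lerner.

(* Main.v *)
Require Import Defs.
From HB Require Import structures.
From mathcomp Require Import all_boot all_order all_algebra.
From mathcomp Require Import all_classical all_reals all_analysis.
From mathcomp Require Import sesquilinear complex.
From mathcomp Require Import measurable_realfun ring lra.

Set Implicit Arguments.
Unset Strict Implicit.
Unset Printing Implicit Defensive.

Import Order.TTheory GRing.Theory Num.Theory.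
Import numFieldNormedType.Exports.

Local Open Scope classical_set_scope.
Local Open Scope ring_scope.
Local Open Scope complex_scope.

(** Everything is expressed with the real quadratic forms of the weight [W], of
    its inverse [V], and of their averages [A Q] and [B Q] over cubes. The bound
    [|A^(1/2) B^(1/2)|^2 <= M] is equivalent to
    [(B A u, A u) <= M (A u, u)] for all [u], and to the same inequality with
    [A] and [B] exchanged ([sqrt_norm_form], [sqrt_norm_formV] and
    [form_sqrt_norm]). Write [w_e(E)] for the integral over [E] of
    [(W x e, e)].

    Upper bound. Let [M >= 1]. Integrating Young's inequality
    [2 (u, v) <= s (W u, u) + (V v, v) / s] with [u = e], [v = A e] over a part
    [E] of [Q] of at least half its measure gives [w_e(E) >= w_e(Q) / (4 M)]
    ([weight_large_part]). By sparseness, the cubes of [S] strictly inside [Q]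
    carry therefore at most the fraction [rho = 1 - 1 / (4 M)] of [w_e(Q)]
    ([weight_decay]), and this geometric decay yields a packing inequality for
    arbitrary vectors [e_Q] ([packing], [weight_packing]): the integral of
    [(sum_Q 1_Q |W^(1/2) e_Q|)^2] is at most [(2 + 16 M) sum_Q w_(e_Q)(Q)].
    Take for [e_Q] the mean of [phi_Q f]. The sum on the right is the real inner
    product of [f] with the sum of the [conj(phi_Q) 1_Q A e_Q]; packing for [V]
    and the form of the [A2] condition bound it by [(2 + 16 M) M |f|^2]
    ([avg_carleson]). Since the series [sum_Q psi_Q e_Q] is dominated in the norm
    of [W x] by the packed sum, it converges absolutely almost everywhere and
    its sum has norm at most [18 M^(3/2) |f|] ([list_bound], [lop_bound]). The sum
    extends the tensor product of the Lerner operator ([lerner_tensor],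
    [lerner_extension]). If [M < 1] all the masses vanish ([weight_degenerate]).

    Lower bound. The average over one cube [Q] is a Lerner operator. Applied to
    functions close to [V v] on [Q], it gives values close to [B v], while the
    squared norms of these functions are close to [mu(Q) (B v, v)]. A norm at
    most [n] gives [(A B v, B v) <= 4 n^2 (B v, v)], the factor [4] leaving room
    for approximate equalities ([mean_form_bound], [A2_char_tensor_norm]). The
    function [V v] is approximated by finite sums of simple tensors with a
    greedy choice in a dense sequence ([tensor_approximation]).

    If every Lerner operator is bounded, two of them are enough to bound the
    characteristic uniformly. The parts [own Q] of the cubes of [S] are disjoint
    and have at least half the measure. The symbols [1_(own Q)], [1_Q] bound
    [w_(B v)(own Q)] by a multiple of [mu(Q) (B v, v)]; the symbols [1_Q],
    [1_(own Q)] bound [w_e(Q)] by a multiple of [w_e(own Q)]. With [e = B v] this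
    is the form of the [A2] condition ([own_average_form], [own_mass_form],
    [bounded_A2_class]). *)

(** * The real part of the inner product *)

Section real_inner_product.
Context {R : realType} {H : completeNormedModType R[i]}.
Variable ip : {dot H for Num.conj}.
Hypothesis ip_norm : forall u : H, ip u u = `|u| ^+ 2.
Implicit Types (u v w : H) (r s t : R) (a b : R[i]).

Lemma ipC u v : ip u v = (ip v u)^*%C.
Proof. by rewrite hermC /= expr0 mul1r. Qed.

Lemma ipDl u v w : ip (u + v) w = ip u w + ip v w.
Proof. exact: linearDl. Qed.

Lemma ipDr u v w : ip w (u + v) = ip w u + ip w v.
Proof. exact: linearDr. Qed.

Lemma ipZl a u w : ip (a *: u) w = a * ip u w.
Proof. by rewrite linearZl_LR. Qed.

Lemma ipZr a u w : ip w (a *: u) = a^*%C * ip w u.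
Proof. by rewrite linearZr_LR. Qed.

Lemma ip0l w : ip 0 w = 0. Proof. by rewrite linear0l. Qed.
Lemma ip0r w : ip w 0 = 0. Proof. by rewrite linear0r. Qed.

Lemma rnormE u : `|u| = (rnorm u)%:C.
Proof. by rewrite /rnorm RRe_real// ger0_real. Qed.

Lemma rnorm_ge0 u : 0 <= rnorm u.
Proof. by rewrite -ler0c -rnormE. Qed.

Lemma rnorm_eq0 u : (rnorm u == 0) = (u == 0).
Proof. by rewrite -(inj_eq (@complexI R)) -rnormE normr_eq0. Qed.

Lemma rnorm0 : rnorm (0 : H) = 0.
Proof. by apply/eqP; rewrite rnorm_eq0. Qed.

Lemma rnormN u : rnorm (- u) = rnorm u.
Proof. by rewrite /rnorm normrN. Qed.

Lemma rnormD u v : rnorm (u + v) <= rnorm u + rnorm v.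
Proof. by rewrite -lecR rmorphD/= -!rnormE ler_normD. Qed.

Lemma rnormB u v : rnorm (u - v) = rnorm (v - u).
Proof. by rewrite -rnormN opprB. Qed.

Lemma rnormZ a u : rnorm (a *: u) = complex.Re `|a| * rnorm u.
Proof.
apply: (@complexI R); rewrite -rnormE normrZ rmorphM/= rnormE.
by congr (_ * _); rewrite RRe_real// ger0_real.
Qed.

Lemma normcR r : `|r%:C| = `|r|%:C.
Proof. by rewrite normc_def/= expr0n/= addr0 sqrtr_sqr. Qed.

Lemma rnormZr r u : rnorm (r%:C *: u) = `|r| * rnorm u.
Proof. by rewrite rnormZ normcR. Qed.

(** The space is handled as a real one: the imaginary part of [ip u v] is
    [re_dot u ('i *: v)], by [Im_ip]. *)
Definition re_dot u v : R := complex.Re (ip u v).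
Local Notation rdot := re_dot.

Lemma rdotC u v : rdot u v = rdot v u.
Proof. by rewrite /re_dot ipC; case: (ip v u). Qed.

Lemma rdotDl u v w : rdot (u + v) w = rdot u w + rdot v w.
Proof. by rewrite /re_dot ipDl; case: (ip u w); case: (ip v w). Qed.

Lemma rdotDr u v w : rdot w (u + v) = rdot w u + rdot w v.
Proof. by rewrite rdotC rdotDl !(rdotC _ w). Qed.

Lemma rdotZl r u w : rdot (r%:C *: u) w = r * rdot u w.
Proof. by rewrite /re_dot ipZl; case: (ip u w) => x y; simpc. Qed.

Lemma rdotZr r u w : rdot w (r%:C *: u) = r * rdot w u.
Proof. by rewrite rdotC rdotZl rdotC. Qed.

Lemma rdotNl u w : rdot (- u) w = - rdot u w.
Proof.
have -> : - u = (-1)%:C *: u by rewrite rmorphN/= rmorph1 scaleN1r.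
by rewrite rdotZl mulN1r.
Qed.

Lemma rdotNr u w : rdot w (- u) = - rdot w u.
Proof. by rewrite rdotC rdotNl rdotC. Qed.

Lemma rdotBl u v w : rdot (u - v) w = rdot u w - rdot v w.
Proof. by rewrite rdotDl rdotNl. Qed.

Lemma rdotBr u v w : rdot w (u - v) = rdot w u - rdot w v.
Proof. by rewrite rdotDr rdotNr. Qed.

Lemma rdot0l w : rdot 0 w = 0. Proof. by rewrite /re_dot ip0l. Qed.
Lemma rdot0r w : rdot w 0 = 0. Proof. by rewrite /re_dot ip0r. Qed.

Lemma rdotii u : rdot u u = rnorm u ^+ 2.
Proof. by rewrite /re_dot ip_norm rnormE -rmorphXn/=. Qed.

Lemma Im_ip u v : complex.Im (ip u v) = rdot u ('i%C *: v).
Proof. by rewrite /re_dot ipZr; case: (ip u v) => x y /=; simpc. Qed.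

Lemma ipE u v : ip u v = rdot u v +i* rdot u ('i%C *: v).
Proof. by rewrite -Im_ip /re_dot; case: (ip u v). Qed.

Lemma rdotii_ge0 u : 0 <= rdot u u.
Proof. by rewrite rdotii sqr_ge0. Qed.

Lemma rdot_sumr I (s : seq I) (P : pred I) (F : I -> H) w :
  rdot w (\sum_(i <- s | P i) F i) = \sum_(i <- s | P i) rdot w (F i).
Proof.
elim/big_rec2: _ => [|i x y _ <-]; first exact: rdot0r.
by rewrite rdotDr.
Qed.

Lemma rdot_suml I (s : seq I) (P : pred I) (F : I -> H) w :
  rdot (\sum_(i <- s | P i) F i) w = \sum_(i <- s | P i) rdot (F i) w.
Proof. by rewrite rdotC rdot_sumr; under eq_bigr do rewrite rdotC. Qed.

Lemma rdot_inj u v : (forall w, rdot u w = rdot v w) -> u = v.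
Proof.
move=> uv; apply/eqP; rewrite -subr_eq0 -rnorm_eq0 -sqrf_eq0 -rdotii.
by rewrite rdotBl uv subrr.
Qed.

(** The vertex [- q / p] gives the bound; when [p = 0] the polynomial is affine
    and its sign forces [q = 0]. *)
Lemma discriminant (p q c : R) : 0 <= p ->
  (forall t, 0 <= p * t ^+ 2 + 2 * q * t + c) -> q ^+ 2 <= p * c.
Proof.
move=> p0 h; have [p_eq0|pN0] := eqVneq p 0.
  have c0 : 0 <= c by have := h 0; rewrite expr0n/= !mulr0 !add0r.
  rewrite p_eq0 mul0r; have [->|q0] := eqVneq q 0; first by rewrite expr0n.
  have := h (- (c + 1) / (2 * q)).
  rewrite p_eq0 mul0r add0r.
  rewrite -[2 * q * _]mulrC divfK ?mulf_neq0//; lra.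
have pp : 0 < p by rewrite lt_def pN0.
have := h (- q / p).
rewrite -(pmulr_rge0 _ pp).
have -> : p * (p * (- q / p) ^+ 2 + 2 * q * (- q / p) + c) = p * c - q ^+ 2.
  by field.
by rewrite subr_ge0.
Qed.

(** Positivity together with the symmetry and the norm bound that it entails
    over the complex numbers; see [positive_opP]. *)
Definition rposop (A : H -> H) := [/\ linear A,
  exists2 C : R, 0 <= C & forall u, rnorm (A u) <= C * rnorm u,
  forall u v, rdot (A u) v = rdot u (A v) & forall u, 0 <= rdot (A u) u].

Section linear_maps.
Variables (A : H -> H) (lA : linear A).

Lemma lin0 : A 0 = 0.
Proof.
by have := lA (-1) 0 0; rewrite scaler0 addr0 scaleN1r addNr.
Qed.
Lemma linD u v : A (u + v) = A u + A v.
Proof. by have := lA 1 u v; rewrite !scale1r. Qed.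
Lemma linZ a u : A (a *: u) = a *: A u.
Proof. by have := lA a u 0; rewrite !addr0 lin0 addr0. Qed.
Lemma linN u : A (- u) = - A u.
Proof. by rewrite -scaleN1r linZ scaleN1r. Qed.
Lemma linB u v : A (u - v) = A u - A v.
Proof. by rewrite linD linN. Qed.
End linear_maps.

Lemma pos_form_CS (A : H -> H) u v : linear A ->
    (forall u v, rdot (A u) v = rdot u (A v)) ->
    (forall u, 0 <= rdot (A u) u) ->
  rdot (A u) v ^+ 2 <= rdot (A u) u * rdot (A v) v.
Proof.
move=> lA sA pA; rewrite mulrC [rdot (A u) v]rdotC; apply: discriminant => // t.
have := pA (t%:C *: v + u).
rewrite (linD lA) (linZ lA) !rdotDl !rdotDr !rdotZl !rdotZr.
rewrite (rdotC (A u) v) (rdotC v) (sA u v) (rdotC u); lra.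
Qed.

Lemma rdot_CS u v : rdot u v ^+ 2 <= rdot u u * rdot v v.
Proof.
by apply: (@pos_form_CS id) => // w; rewrite rdotii_ge0.
Qed.

Lemma ler_rdot u v : `|rdot u v| <= rnorm u * rnorm v.
Proof.
have := rdot_CS u v; rewrite !rdotii -exprMn -real_normK ?num_real//.
by rewrite ler_pXn2r ?nnegrE ?mulr_ge0 ?rnorm_ge0.
Qed.

Lemma rnorm_le_rdot u (c : R) : 0 <= c ->
  (forall v, rdot u v <= c * rnorm v) -> rnorm u <= c.
Proof.
move=> c0 h; have := h u; rewrite rdotii expr2.
have := rnorm_ge0 u; rewrite le0r => /orP[/eqP->//|u0].
by rewrite ler_pM2r.
Qed.

(** Cauchy-Schwarz for the form of [A] carries a bound on its diagonal over to
    all its values. *)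
Lemma pos_form_norm (A : H -> H) (M : R) : linear A ->
    (forall u v, rdot (A u) v = rdot u (A v)) ->
    (forall u, 0 <= rdot (A u) u) -> 0 <= M ->
    (forall u, rdot (A u) u <= M * rdot u u) ->
  forall u, rnorm (A u) <= M * rnorm u.
Proof.
move=> lA sA pA M0 hM u; apply: rnorm_le_rdot => [|v].
  by rewrite mulr_ge0 ?rnorm_ge0.
apply: le_trans (ler_norm _) _.
rewrite -(@ler_pXn2r _ 2) ?nnegrE ?mulr_ge0 ?rnorm_ge0//.
rewrite real_normK ?num_real//; apply: le_trans (pos_form_CS _ _ lA sA pA) _.
apply: le_trans (ler_pM (pA u) (pA v) (hM u) (hM v)) _.
by rewrite !rdotii !exprMn; lra.
Qed.

(** Convergence measured by the real norm, so that the rate is a real number. *)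
Definition hcvg (u : nat -> H) (l : H) :=
  forall e : R, 0 < e -> exists N, forall n, (N <= n)%N -> rnorm (u n - l) < e.

Lemma ltc0_real (e : R[i]) : 0 < e -> exists2 r : R, 0 < r & e = r%:C.
Proof.
move=> e0; exists (complex.Re e); last by rewrite RRe_real// gtr0_real.
by move: e0; rewrite ltcE => /andP[].
Qed.

Lemma hcvgP (u : nat -> H) l : hcvg u l <-> (u @ \oo --> l).
Proof.
split=> [ul|/cvgrPdist_lt ul].
  apply/cvgrPdist_lt => e e0; have [r r0 ->] := ltc0_real e0.
  have [N hN] := ul _ r0; exists N => // n Nn.
  by rewrite rnormE ltcR rnormB hN.
move=> e e0; have e0' : 0 < e%:C :> R[i] by rewrite ltcR.
have [N _ hN] := ul _ e0'; exists N => n Nn.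
by have := hN n Nn; rewrite rnormE ltcR rnormB.
Qed.

Lemma hcomplete (u : nat -> H) :
    (forall e : R, 0 < e -> exists N, forall m n, (N <= m)%N -> (N <= n)%N ->
      rnorm (u m - u n) < e) ->
  exists l, hcvg u l.
Proof.
move=> cu; have : cvg (u @ \oo).
  apply/cauchy_cvgP/cauchy_exP => e e0; have [r r0 ->] := ltc0_real e0.
  have [N hN] := cu _ r0; exists (u N), N => // n Nn /=.
  by rewrite -ball_normE /ball_/= rnormE ltcR hN.
by move=> /cvg_ex[l /hcvgP]; exists l.
Qed.

Lemma bounded_opP (A : H -> H) : bounded_op A <->
  linear A /\ exists2 C : R, 0 <= C & forall u, rnorm (A u) <= C * rnorm u.
Proof.
split=> [[lA cA]|[lA [C C0 hC]]]; split=> //.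
  have c0 : {for 0, continuous A} by exact: cA.
  have /cvgrPdist_lt/(_ 1 ltr01) := c0; rewrite (lin0 lA).
  move=> /nbhs_norm0P[e /= e0 he].
  have [r r0 er] := ltc0_real e0.
  exists (2 / r); first by rewrite divr_ge0// ltW.
  move=> u; have [->|u0] := eqVneq u 0; first by rewrite (lin0 lA) rnorm0 mulr0.
  have nu : 0 < rnorm u by rewrite lt_def rnorm_eq0 u0 rnorm_ge0.
  pose k := r / (2 * rnorm u).
  have k0 : 0 < k by rewrite divr_gt0// mulr_gt0.
  have := he (k%:C *: u); rewrite /= sub0r normrN (linZ lA).
  rewrite !rnormE !rnormZr er !ltcR gtr0_norm//.
  have -> : k * rnorm u = r / 2 by rewrite /k; field; rewrite gt_eqF.
  have rr : r / 2 < r by lra.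
  move=> /(_ rr); rewrite -ltr_pdivlMl// => /ltW/le_trans; apply.
  by rewrite mulr1 /k le_eqVlt; apply/orP; left; apply/eqP; field; rewrite !gt_eqF.
move=> x; apply/cvgrPdist_lt => e e0; have [r r0 ->] := ltc0_real e0.
have C1 : 0 < C + 1 by lra.
near=> y; rewrite -(linB lA) rnormE ltcR; apply: le_lt_trans (hC _) _.
have : rnorm (x - y) < r / (C + 1).
  rewrite -ltcR -rnormE; near: y; apply: cvgr_dist_lt => //.
  by rewrite ltcR divr_gt0.
rewrite ltr_pdivlMr// => /(le_lt_trans _); apply.
by rewrite mulrC ler_wpM2l ?rnorm_ge0//; lra.
Unshelve. all: by end_near. Qed.

Lemma positive_opP (A : H -> H) : positive_op ip A <-> rposop A.
Proof.
split=> [[/bounded_opP[lA bA] pA]|[lA bA sA pA]]; last first.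
  split; first by apply/bounded_opP.
  move=> u; rewrite lecE/= pA andbT; apply/eqP.
  have : complex.Im (ip (A u) u) = - complex.Im (ip (A u) u).
    by rewrite {1}Im_ip sA (linZ lA) -Im_ip ipC; case: (ip _ _).
  lra.
have imA u : complex.Im (ip (A u) u) = 0.
  by have := pA u; rewrite lecE => /andP[/eqP].
split=> //; last by move=> u; have := pA u; rewrite lecE => /andP[].
move=> u v; rewrite [RHS]rdotC.
have := imA (u + 'i%C *: v).
rewrite (linD lA) (linZ lA) !ipDl !ipDr !ipZl !ipZr.
have := imA v; have := imA u; rewrite /re_dot.
case: (ip (A u) u) => a1 a2; case: (ip (A v) v) => b1 b2.
case: (ip (A u) v) => c1 c2; case: (ip (A v) u) => d1 d2 /=; lra.
Qed.

End real_inner_product.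

(** * Riesz representation and square roots of positive operators *)

Section riesz_and_roots.
Context {R : realType} {H : completeNormedModType R[i]}.
Variable ip : {dot H for Num.conj}.
Hypothesis ip_norm : forall u : H, ip u u = `|u| ^+ 2.
Implicit Types (u v w : H) (r s t : R) (a b : R[i]).
Local Notation rdot := (re_dot ip).

Lemma hcvg_rdot (x : nat -> H) l v :
  hcvg x l -> rdot (x n) v @[n --> \oo] --> rdot l v.
Proof.
move=> xl; apply/cvgrPdist_lt => e e0.
have k0 : 0 < rnorm v + 1 by have := rnorm_ge0 v; lra.
have [N hN] := xl _ (divr_gt0 e0 k0); exists N => // n /= Nn.
rewrite distrC -rdotBl; apply: le_lt_trans (ler_rdot ip_norm _ _) _.
have := hN n Nn; rewrite ltr_pdivlMr// => /(le_lt_trans _); apply.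
by rewrite ler_wpM2l ?rnorm_ge0//; lra.
Qed.

Lemma hcvg_uniq (x : nat -> H) l l' : hcvg x l -> hcvg x l' -> l = l'.
Proof.
move=> xl xl'; apply: (rdot_inj ip_norm) => w.
by apply: (cvg_unique _ (hcvg_rdot (v := w) xl) (hcvg_rdot (v := w) xl')).
Qed.

Lemma hcvg_norm_le (x : nat -> H) l (c : R) : hcvg x l ->
  (forall n, rnorm (x n) <= c) -> rnorm l <= c.
Proof.
move=> xl xc; apply/ler_addgt0Pr => e e0.
have [N hN] := xl _ e0; have := hN N (leqnn _).
have := rnormD (x N) (l - x N); rewrite subrKC (rnormB l).
by have := xc N; lra.
Qed.

Lemma hcvgD (x y : nat -> H) l m : hcvg x l -> hcvg y m ->
  hcvg (fun n => x n + y n) (l + m).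
Proof. by move=> /hcvgP xl /hcvgP ym; apply/hcvgP; apply: cvgD. Qed.

Lemma hcvgZ a (x : nat -> H) l : hcvg x l -> hcvg (fun n => a *: x n) (a *: l).
Proof. by move=> /hcvgP xl; apply/hcvgP; apply: cvgZr. Qed.

Lemma hcvgS (x : nat -> H) l : hcvg x l -> hcvg (fun n => x n.+1) l.
Proof.
by move=> xl e e0; have [N hN] := xl e e0; exists N => n Nn; apply/hN/leqW.
Qed.

(** The minimisers of the energy [rdot u u - 2 * l u] represent [l]; minimising
    sequences converge by the parallelogram law. *)
Lemma riesz_real (l : H -> R) (C : R) : 0 <= C ->
    (forall u v, l (u + v) = l u + l v) ->
    (forall r u, l (r%:C *: u) = r * l u) ->
    (forall u, l u <= C * rnorm u) ->
  exists e, forall v, l v = rdot e v.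
Proof.
move=> C0 lD lZ lC.
pose J u := rdot u u - 2 * l u.
have J_lb : lbound (range J) (- C ^+ 2).
  move=> _ [u _ <-]; rewrite /J rdotii//; have := lC u.
  have := sqr_ge0 (rnorm u - C); nra.
have hJ : has_inf (range J) by split; [exists (J 0), 0 | exists (- C ^+ 2)].
pose m := inf (range J).
have mJ u : m <= J u by apply: ge_inf; [case: hJ|exists u].
have JD u v t : J (u + t%:C *: v) =
    J u + 2 * t * (rdot u v - l v) + t ^+ 2 * rdot v v.
  rewrite /J lD lZ !rdotDl !rdotDr !rdotZl !rdotZr (rdotC ip v u); lra.
have [x Jx] : {x : nat -> H & forall n, J (x n) < m + n.+1%:R^-1}.
  apply: (@choice _ _ (fun n u => J u < m + n.+1%:R^-1)) => n.
  have [_ [u _ <-] hu] := @inf_adherent _ (range J) n.+1%:R^-1 (ltac:(by rewrite invr_gt0)) hJ.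
  by exists u.
clearbody m.
have xq n v : (rdot (x n) v - l v) ^+ 2 <= rdot v v * n.+1%:R^-1.
  apply: discriminant => [|t]; first exact: rdotii_ge0.
  have := mJ (x n + t%:C *: v); rewrite JD; have := Jx n.
  by move: (J _) (n.+1%:R^-1) => j q; lra.
(* Parallelogram law: the energy at the midpoint is at least [m]. *)
have xx n k : rnorm (x n - x k) ^+ 2 <= 2 * (n.+1%:R^-1 + k.+1%:R^-1).
  have := mJ (x k + (2^-1)%:C *: (x n - x k)).
  have := Jx n; have := Jx k.
  move: (n.+1%:R^-1) (k.+1%:R^-1) => q q'.
  rewrite -(rdotii ip_norm) /J lD lZ.
  have -> : l (x n - x k) = l (x n) - l (x k).
    rewrite lD; congr (_ + _); have := lZ (-1) (x k).
    by rewrite rmorphN/= rmorph1 scaleN1r mulN1r.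
  rewrite !(rdotBl, rdotBr, rdotDl, rdotDr, rdotZl, rdotZr) (rdotC ip (x k) (x n)).
  lra.
have [e xe] : exists e, hcvg x e.
  apply: hcomplete => e e0.
  have e4 : 0 < e ^+ 2 / 4 by rewrite divr_gt0// exprn_gt0.
  have [N hN] : exists N : nat, forall n, (N <= n)%N -> n.+1%:R^-1 < e ^+ 2 / 4.
    have [N _ hN] : \forall n \near \oo, n.+1%:R^-1 < e ^+ 2 / 4.
      exact: near_infty_natSinv_lt (PosNum e4).
    by exists N => n /hN.
  exists N => n k /hN hn /hN hk.
  rewrite -(@ltr_pXn2r _ 2) ?nnegrE ?rnorm_ge0 ?ltW//.
  apply: le_lt_trans (xx _ _) _.
  by move: (n.+1%:R^-1) (k.+1%:R^-1) hn hk => q q'; lra.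
exists e => v; apply/esym/eqP; rewrite -subr_eq0 -sqrf_eq0 eq_le sqr_ge0 andbT.
have : (rdot (x n) v - l v) * (rdot (x n) v - l v) @[n --> \oo] -->
    (rdot e v - l v) * (rdot e v - l v).
  by apply: cvgM; apply: cvgB; [exact: hcvg_rdot|exact: cvg_cst|
    exact: hcvg_rdot|exact: cvg_cst].
have : rdot v v * n.+1%:R^-1 @[n --> \oo] --> (rdot v v * 0 : R).
  by apply: cvgMr; exact: cvg_harmonic.
rewrite mulr0 expr2 => h1 h2; apply: (ler_cvg_to h2 h1).
by apply: nearW => n; rewrite -expr2; exact: xq.
Qed.

(** The iteration [B := (T + B^2) / 2] from [B = 0] with [T = 1 - A] converges
    to [1 - sqrt A]: its increments are dominated by those of the scalar
    iteration with [T = 1]. *)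
Section square_root.
Variable T : H -> H.
Hypotheses (lT : linear T) (sT : forall u v, rdot (T u) v = rdot u (T v)).
Hypothesis T1 : forall u, rnorm (T u) <= rnorm u.

Fixpoint sqrt_iter n u : H :=
  if n is n.+1 then
    (2^-1)%:C *: (T u + sqrt_iter n (sqrt_iter n u)) else 0.
Fixpoint sqrt_bound n : R :=
  if n is n.+1 then 2^-1 * (1 + sqrt_bound n ^+ 2) else 0.

Lemma sqrt_bound01 n : 0 <= sqrt_bound n <= 1.
Proof. by elim: n => [|n /andP[h1 h2]] /=; [lra|apply/andP; split; nra]. Qed.

Lemma sqrt_bound_leS n : sqrt_bound n <= sqrt_bound n.+1.
Proof. rewrite /=; have := sqr_ge0 (1 - sqrt_bound n); lra. Qed.

Lemma sqrt_iter_linear n : linear (sqrt_iter n).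
Proof.
elim: n => [|n IH] a u v /=; first by rewrite scaler0 addr0.
rewrite lT IH IH addrACA -(scalerDr a) [LHS]scalerDr; congr (_ + _).
by rewrite !scalerA (mulrC a).
Qed.

Lemma sqrt_iter_sym n u v : rdot (sqrt_iter n u) v = rdot u (sqrt_iter n v).
Proof.
elim: n u v => [|n IH] u v /=; first by rewrite rdot0l rdot0r.
by rewrite rdotZl rdotZr rdotDl rdotDr sT !IH.
Qed.

Lemma sqrt_iter_le n u : rnorm (sqrt_iter n u) <= sqrt_bound n * rnorm u.
Proof.
elim: n u => [|n IH] u /=; first by rewrite rnorm0 mul0r.
rewrite rnormZr ger0_norm ?invr_ge0// -mulrA ler_pM2l ?invr_gt0//.
apply: le_trans (rnormD _ _) _; rewrite mulrDl mul1r lerD//.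
apply: le_trans (IH _) _; rewrite expr2 -mulrA ler_wpM2l//.
by case/andP: (sqrt_bound01 n).
Qed.

Lemma sqrt_iter_step n u :
  rnorm (sqrt_iter n.+1 u - sqrt_iter n u) <=
  (sqrt_bound n.+1 - sqrt_bound n) * rnorm u.
Proof.
elim: n u => [|n IH] u.
  rewrite /= subr0 addr0 rnormZr ger0_norm ?invr_ge0// expr0n/= subr0 addr0.
  by rewrite mulr1 ler_pM2l// invr_gt0.
pose B := sqrt_iter n; pose B' := sqrt_iter n.+1.
have -> : sqrt_iter n.+2 u - sqrt_iter n.+1 u =
    (2^-1)%:C *: (B' (B' u - B u) + (B' (B u) - B (B u))).
  rewrite -[sqrt_iter n.+2 u]/((2^-1)%:C *: (T u + B' (B' u))).
  rewrite -[sqrt_iter n.+1 u]/((2^-1)%:C *: (T u + B (B u))).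
  rewrite -scalerBr opprD addrACA subrr add0r; congr (_ *: _).
  have -> : B' (B' u - B u) = B' (B' u) - B' (B u).
    exact: linB (sqrt_iter_linear n.+1) _ _.
  by rewrite subrKA.
rewrite rnormZr ger0_norm ?invr_ge0//.
have h1 := le_trans (sqrt_iter_le n.+1 (B' u - B u))
  (ler_wpM2l (andP (sqrt_bound01 n.+1)).1 (IH u)).
have d0 : 0 <= sqrt_bound n.+1 - sqrt_bound n by rewrite subr_ge0 sqrt_bound_leS.
have h2 := le_trans (IH (B u)) (ler_wpM2l d0 (sqrt_iter_le n u)).
have h3 := rnormD (B' (B' u - B u)) (B' (B u) - B (B u)).
have -> : sqrt_bound n.+2 - sqrt_bound n.+1 = 2^-1 *
    ((sqrt_bound n.+1 - sqrt_bound n) * (sqrt_bound n.+1 + sqrt_bound n)).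
  rewrite -[sqrt_bound n.+2]/(2^-1 * (1 + sqrt_bound n.+1 ^+ 2)).
  rewrite {2}[sqrt_bound n.+1]/=; lra.
rewrite -mulrA ler_pM2l ?invr_gt0//; apply: le_trans h3 _.
rewrite {}/B' {}/B in h1 h2 *.
move: h1 h2; set p := sqrt_bound n.+1; set q := sqrt_bound n; lra.
Qed.

Lemma sqrt_iter_dist n k u : (n <= k)%N ->
  rnorm (sqrt_iter k u - sqrt_iter n u) <= (sqrt_bound k - sqrt_bound n) * rnorm u.
Proof.
elim: k => [|k IH]; first by rewrite leqn0 => /eqP->; rewrite !subrr rnorm0 mul0r.
rewrite leq_eqVlt => /orP[/eqP->|]; first by rewrite !subrr rnorm0 mul0r.
rewrite ltnS => /IH h.
have := rnormD (sqrt_iter k.+1 u - sqrt_iter k u) (sqrt_iter k u - sqrt_iter n u).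
rewrite subrKA => /le_trans; apply.
have := sqrt_iter_step k u; lra.
Qed.

Lemma sqrt_iter_cvg u : exists l, hcvg (fun n => sqrt_iter n u) l.
Proof.
apply: hcomplete => e e0.
have hs : has_sup (range sqrt_bound).
  split; first by exists 0, 0%N.
  by exists 1 => _ [n _ <-]; case/andP: (sqrt_bound01 n).
have k0 : 0 < 2 * (rnorm u + 1) by have := rnorm_ge0 u; lra.
have [_ [N _ <-] hN] := @sup_adherent _ (range sqrt_bound) _ (divr_gt0 e0 k0) hs.
exists N => m n Nm Nn.
have := rnormD (sqrt_iter m u - sqrt_iter N u) (sqrt_iter N u - sqrt_iter n u).
rewrite subrKA => /le_lt_trans; apply.
rewrite (rnormB (sqrt_iter N u)).
have bnd k : (N <= k)%N ->
    rnorm (sqrt_iter k u - sqrt_iter N u) < e / 2.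
  move=> Nk; apply: le_lt_trans (sqrt_iter_dist u Nk) _.
  have : sqrt_bound k <= sup (range sqrt_bound).
    by apply: ub_le_sup; [case: hs|exists k].
  move: hN; set S := sup _ => hN hk.
  have h : sqrt_bound k - sqrt_bound N < e / (2 * (rnorm u + 1)) by lra.
  move: h; rewrite ltr_pdivlMr// => h.
  have : 0 <= sqrt_bound k - sqrt_bound N.
    by rewrite subr_ge0; apply: (homo_leq (@lexx _ _) le_trans sqrt_bound_leS).
  lra.
by have := bnd _ Nm; have := bnd _ Nn; lra.
Qed.

Lemma sqrt_fixpoint : exists B : H -> H, [/\ linear B,
  forall u v, rdot (B u) v = rdot u (B v), forall u, rnorm (B u) <= rnorm u &
  forall u, B u = (2^-1)%:C *: (T u + B (B u))].
Proof.
have [B hB] := choice sqrt_iter_cvg.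
have B1 u : rnorm (B u) <= rnorm u.
  apply: (hcvg_norm_le (hB u)) => n; apply: le_trans (sqrt_iter_le n u) _.
  by rewrite ler_piMl ?rnorm_ge0//; case/andP: (sqrt_bound01 n).
exists B; split=> //.
- move=> a u v; apply: hcvg_uniq (hB _) _.
  under [X in hcvg X _]funext do rewrite sqrt_iter_linear.
  exact: hcvgD (hcvgZ _ (hB u)) (hB v).
- move=> u v; have h1 := hcvg_rdot (v := v) (hB u).
  have h2 := hcvg_rdot (v := u) (hB v).
  have h3 : rdot (sqrt_iter n u) v @[n --> \oo] --> rdot (B v) u.
    by under eq_cvg do rewrite sqrt_iter_sym rdotC.
  by rewrite [RHS]rdotC; apply: (cvg_unique _ h1 h3).
move=> u; apply: hcvg_uniq (hcvgS (hB u)) _.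
apply: hcvgZ; apply: hcvgD => [e e0|e e0].
  by exists 0%N => n _; rewrite subrr rnorm0.
have e2 : 0 < e / 2 by lra.
have [N1 h1] := hB u _ e2; have [N2 h2] := hB (B u) _ e2.
exists (maxn N1 N2) => n; rewrite geq_max => /andP[/h1 {}h1 /h2 {}h2].
have := rnormD (sqrt_iter n (sqrt_iter n u - B u)) (sqrt_iter n (B u) - B (B u)).
rewrite (linB (sqrt_iter_linear n)) subrKA => /le_lt_trans; apply.
rewrite -(linB (sqrt_iter_linear n)).
have : rnorm (sqrt_iter n (sqrt_iter n u - B u)) <= rnorm (sqrt_iter n u - B u).
  apply: le_trans (sqrt_iter_le n _) _.
  by rewrite ler_piMl ?rnorm_ge0//; case/andP: (sqrt_bound01 n).
lra.
Qed.

End square_root.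

Lemma pos_sqrt_exists (A : H -> H) : rposop ip A ->
  exists2 B, rposop ip B & B \o B = A.
Proof.
move=> [lA [C C0 hC] sA pA].
pose M := C + 1; have M0 : 0 < M by rewrite /M; lra.
(* Dividing by a bound of [A] makes [T] positive, hence a contraction. *)
pose T u := u - (M^-1)%:C *: A u.
have lT : linear T.
  move=> a u v; rewrite /T (linD lA) (linZ lA) scalerDr opprD addrACA.
  by rewrite scalerBr !scalerA (mulrC a).
have sT u v : rdot (T u) v = rdot u (T v).
  by rewrite rdotBl rdotBr rdotZl rdotZr sA.
have AM u : rdot (A u) u <= M * rdot u u.
  apply: le_trans (ler_norm _) _; apply: le_trans (ler_rdot ip_norm _ _) _.
  rewrite rdotii// expr2 mulrA ler_wpM2r ?rnorm_ge0//.
  apply: le_trans (hC u) _; rewrite ler_wpM2r ?rnorm_ge0// /M; lra.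
have pT u : 0 <= rdot (T u) u.
  by rewrite rdotBl rdotZl subr_ge0 ler_pdivrMl.
have T1 u : rnorm (T u) <= rnorm u.
  have := @pos_form_norm _ _ _ ip_norm T 1 lT sT pT ler01 _ u.
  rewrite mul1r; apply => v; rewrite rdotBl rdotZl mul1r lerBlDr lerDl.
  by rewrite mulr_ge0// invr_ge0 ltW.
have [B [lB sB B1 fB]] := sqrt_fixpoint lT sT T1.
have cA u : A u = M%:C *: (u - (2%:C *: B u - B (B u))).
  rewrite {1}fB scalerA -rmorphM/= divff// rmorph1 scale1r addrK.
  rewrite /T opprB addrC subrK scalerA -rmorphM/= divff ?gt_eqF//.
  by rewrite rmorph1 scale1r.
pose k : R := Num.sqrt M; have k0 : 0 <= k by exact: sqrtr_ge0.
have kk : k * k = M by rewrite -expr2 sqr_sqrtr// ltW.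
clearbody k.
exists (fun u => k%:C *: (u - B u)); last first.
  apply/funext => u; rewrite /= cA (linZ lB) -scalerBr scalerA -rmorphM/= kk.
  congr (_ *: _); rewrite (linB lB).
  have -> : 2%:C = 1 + 1 :> R[i] by rewrite rmorphD/= rmorph1.
  by rewrite scalerDl scale1r -addrA -opprD addrA.
split.
- by move=> a u v; rewrite lB opprD addrACA scalerDr -scalerBr !scalerA (mulrC a).
- exists (2 * k) => [|u]; first by rewrite mulr_ge0.
  rewrite rnormZr ger0_norm// (mulrC 2) -mulrA ler_wpM2l//.
  have := rnormD u (- B u); rewrite rnormN; have := B1 u; lra.
- by move=> u v; rewrite rdotZl rdotZr rdotBl rdotBr sB.
- move=> u; rewrite rdotZl mulr_ge0// rdotBl subr_ge0.
  apply: le_trans (ler_norm _) _; apply: le_trans (ler_rdot ip_norm _ _) _.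
  by rewrite rdotii// expr2 ler_wpM2r ?rnorm_ge0.
Qed.

Lemma opsqrtP (A : H -> H) : rposop ip A ->
  rposop ip (opsqrt ip A) /\ (forall u, opsqrt ip A (opsqrt ip A u) = A u).
Proof.
move=> /pos_sqrt_exists[B pB BA].
have [/positive_opP pS SA] : (positive_op ip (opsqrt ip A) /\ opsqrt ip A \o opsqrt ip A = A).
  by apply: (@xgetPex _ (cst 0) [set B | positive_op ip B /\ B \o B = A]);
    exists B; split=> //; apply/positive_opP.
by split=> [|u]; [exact: pS | rewrite -[in RHS]SA].
Qed.

End riesz_and_roots.

(** * Quadratic forms of two positive operators *)

Section quadratic_forms.
Context {R : realType} {H : completeNormedModType R[i]}.
Variable ip : {dot H for Num.conj}.
Hypothesis ip_norm : forall u : H, ip u u = `|u| ^+ 2.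
Implicit Types (u v w : H) (r s t : R) (a b : R[i]).
Local Notation rdot := (re_dot ip).

Section two_operators.
Variables (A B : H -> H) (M : R).
Hypotheses (M0 : 0 <= M) (pA : rposop ip A) (pB : rposop ip B).
Let X := opsqrt ip B.
Let Y := opsqrt ip A.

Let pX : rposop ip X. Proof. by case: (opsqrtP ip_norm pB). Qed.
Let pY : rposop ip Y. Proof. by case: (opsqrtP ip_norm pA). Qed.
Let XX u : X (X u) = B u. Proof. by case: (opsqrtP ip_norm pB). Qed.
Let YY u : Y (Y u) = A u. Proof. by case: (opsqrtP ip_norm pA). Qed.

Lemma sqrt_form C D u : rposop ip C -> (forall u, C (C u) = D u) ->
  rdot (D u) u = rnorm (C u) ^+ 2.
Proof. by move=> [_ _ sC _] <-; rewrite sC rdotii. Qed.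

Lemma sqrt_norm_form :
    (forall u, rnorm (Y (X u)) ^+ 2 <= M * rnorm u ^+ 2) ->
  forall u, rdot (A (B u)) (B u) <= M * rdot (B u) u.
Proof.
move=> h u; rewrite (sqrt_form _ pY YY) (sqrt_form _ pX XX).
by rewrite -(XX u); exact: h.
Qed.

(** [Y X] and its adjoint [X Y] have the same norm: with [z = X Y (Y u)] one has
    [|z|^2 = (Y u, Y X z) <= |Y u| |Y X z|]. *)
Lemma sqrt_norm_formV :
    (forall u, rnorm (Y (X u)) ^+ 2 <= M * rnorm u ^+ 2) ->
  forall u, rdot (B (A u)) (A u) <= M * rdot (A u) u.
Proof.
move=> h u; rewrite (sqrt_form _ pY YY) (sqrt_form _ pX XX) -(YY u).
set z := X (Y (Y u)).
have hz := h z; have [_ _ sX _] := pX; have [_ _ sY _] := pY.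
have e : rnorm z ^+ 2 = rdot (Y u) (Y (X z)) by rewrite -(rdotii ip_norm) sX sY.
have h1 : rnorm z ^+ 2 <= rnorm (Y u) * rnorm (Y (X z)).
  by rewrite e; exact: le_trans (ler_norm _) (ler_rdot ip_norm _ _).
have z0 := rnorm_ge0 z; have y0 := rnorm_ge0 (Y u).
have w0 := rnorm_ge0 (Y (X z)).
have h2 : (rnorm z ^+ 2) ^+ 2 <= rnorm (Y u) ^+ 2 * rnorm (Y (X z)) ^+ 2.
  by rewrite -exprMn ler_pXn2r ?nnegrE ?mulr_ge0 ?sqr_ge0.
have h3 : (rnorm z ^+ 2) ^+ 2 <= rnorm (Y u) ^+ 2 * (M * rnorm z ^+ 2).
  by apply: le_trans h2 _; rewrite ler_wpM2l ?sqr_ge0.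
have := sqr_ge0 (rnorm z); rewrite le0r => /orP[/eqP->|zp].
  by rewrite mulr_ge0 ?sqr_ge0.
by rewrite -(ler_pM2r zp) -expr2; apply: le_trans h3 _; rewrite mulrCA mulrA.
Qed.

(** With [P = X A X], the assumption bounds the form of [P] on the range of
    [P]; Cauchy-Schwarz for the form of [P] extends the bound everywhere. *)
Lemma form_sqrt_norm :
    (forall u, rdot (A (B u)) (B u) <= M * rdot (B u) u) ->
  forall u, rnorm (Y (X u)) ^+ 2 <= M * rnorm u ^+ 2.
Proof.
move=> h w; have [lX bX sX posX] := pX; have [lA bA sA posA] := pA.
pose P u := X (A (X u)).
have lP : linear P by move=> a u v; rewrite /P lX lA lX.
have sP u v : rdot (P u) v = rdot u (P v) by rewrite /P sX sA sX.
have qP u : rdot (P u) u = rnorm (Y (X u)) ^+ 2.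
  by rewrite /P sX (sqrt_form _ pY YY).
have posP u : 0 <= rdot (P u) u by rewrite qP sqr_ge0.
have h1 : rdot (P (P w)) (P w) <= M * rnorm (P w) ^+ 2.
  have := h (A (X w)); rewrite (sqrt_form _ pX XX) -/(P w) -!XX -/(P w).
  by rewrite -sX.
have h2 := pos_form_CS (P w) w lP sP posP.
rewrite sP rdotii// in h2.
have h3 : rdot (P w) w <= rnorm (P w) * rnorm w.
  exact: le_trans (ler_norm _) (ler_rdot ip_norm _ _).
rewrite -qP.
have := posP w; move: (rdot (P w) w) h2 h3 => q h2 h3 q0.
have := rnorm_ge0 (P w); have := rnorm_ge0 w.
move: (rnorm w) (rnorm (P w)) (rdot _ _) h1 h2 h3 => b p z h1 h2 h3 b0.
rewrite le0r => /orP[/eqP p0|p0].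
  by move: h3; rewrite p0 mul0r => h3; apply: le_trans h3 _; rewrite mulr_ge0 ?sqr_ge0.
have h4 : p ^+ 2 * p ^+ 2 <= (M * q) * p ^+ 2.
  rewrite -expr2; apply: le_trans h2 _; rewrite mulrAC.
  by rewrite ler_wpM2r.
rewrite ler_pM2r ?exprn_gt0// in h4.
have h5 : p * p <= (M * b) * p.
  rewrite -expr2; apply: le_trans h4 _; rewrite -mulrA ler_wpM2l// mulrC//.
rewrite ler_pM2r// in h5.
by apply: le_trans h3 _; rewrite expr2 mulrA ler_wpM2r.
Qed.

End two_operators.

Lemma opnorm_sq_le (A : H -> H) (M : R) : linear A -> 0 <= M ->
  ((opnorm A `^ 2)%E <= M%:E)%E <->
  forall u, rnorm (A u) ^+ 2 <= M * rnorm u ^+ 2.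
Proof.
move=> lA M0; have op0 : (0 <= opnorm A)%E.
  apply: ereal_sup_ubound; exists 0; first by rewrite /= rnorm0 ler01.
  by rewrite (lin0 lA) rnorm0.
split=> [h u|h].
  have [->|uN0] := eqVneq u 0.
    by rewrite (lin0 lA) rnorm0 expr0n/= mulr0.
  have nu : 0 < rnorm u by rewrite lt_def rnorm_eq0 uN0 rnorm_ge0.
  pose v := ((rnorm u)^-1)%:C *: u.
  have v1 : rnorm v <= 1.
    rewrite rnormZr ger0_norm ?invr_ge0 ?rnorm_ge0// mulVf ?lexx//.
    by rewrite gt_eqF.
  have h1 : ((rnorm (A v))%:E <= opnorm A)%E.
    by apply: ereal_sup_ubound; exists v.
  have h2 : ((rnorm (A v) ^+ 2)%:E <= M%:E)%E.
    apply: le_trans h; rewrite -[X in (X%:E <= _)%E]powR_mulrn ?rnorm_ge0//.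
    rewrite -poweR_EFin; apply: gt0_ler_poweR => //.
    - by rewrite in_itv/= lee_fin rnorm_ge0 leey.
    - by rewrite in_itv/= op0 leey.
  move: h2; rewrite lee_fin /v (linZ lA) rnormZr.
  rewrite ger0_norm ?invr_ge0 ?rnorm_ge0// exprMn exprVn mulrC.
  by rewrite ler_pdivrMr ?exprn_gt0.
have : (opnorm A <= (Num.sqrt M)%:E)%E.
  apply: ge_ereal_sup => _ [u /= u1 <-]; rewrite lee_fin.
  rewrite -(@ler_pXn2r _ 2) ?nnegrE ?rnorm_ge0 ?sqrtr_ge0// sqr_sqrtr//.
  apply: le_trans (h u) _; rewrite ler_piMr//.
  by rewrite expr_le1 ?rnorm_ge0.
move=> hs; have -> : M%:E = ((Num.sqrt M)%:E `^ 2)%E.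
  by rewrite poweR_EFin powR_mulrn ?sqrtr_ge0// sqr_sqrtr.
apply: gt0_ler_poweR => //.
- by rewrite in_itv/= op0 leey.
- by rewrite in_itv/= lee_fin sqrtr_ge0 leey.
Qed.

Lemma opinv_bounded (A : H -> H) : bounded_op (opinv A).
Proof.
rewrite /opinv; case: xgetP => [B _ []//|_].
apply/bounded_opP; split; first by move=> a u v; rewrite /= scaler0 addr0.
by exists 0 => // u; rewrite /= rnorm0 mul0r.
Qed.

(** For [u = A w] one has [(opinv A u, u) = (w, A w)]. *)
Lemma opinvP (A : H -> H) : rposop ip A -> invertible_op A ->
  [/\ rposop ip (opinv A), forall u, A (opinv A u) = u &
      forall u, opinv A (A u) = u].
Proof.
move=> [lA bA sA pA] [B hB].
have [bV AV VA] : is_opinv A (opinv A) by apply: (@xgetPex _ (cst 0)); exists B.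
have {}AV u : A (opinv A u) = u by exact: (congr1 (fun f => f u) AV).
have {}VA u : opinv A (A u) = u by exact: (congr1 (fun f => f u) VA).
have /bounded_opP[lV cV] := bV.
split=> //; split=> //.
  by move=> u v; rewrite -[v in LHS]AV -sA AV.
by move=> u; have := pA (opinv A u); rewrite AV rdotC.
Qed.

(** The form of [A] is nonnegative at [s u - B v]. *)
Lemma young_form (A B : H -> H) s u v : rposop ip A ->
    (forall u, A (B u) = u) -> 0 < s ->
  2 * rdot u v <= s * rdot (A u) u + s^-1 * rdot (B v) v.
Proof.
move=> [lA _ sA pA] AB s0.
have := pA (s%:C *: u - B v).
rewrite (linB lA) (linZ lA) AB !(rdotBl, rdotBr, rdotZl, rdotZr).
rewrite (sA u (B v)) AB (rdotC ip v u) (rdotC ip v).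
move: (rdot (A u) u) (rdot u v) (rdot (B v) v) => x y z.
move=> h.
have e : s * x + s^-1 * z = s^-1 * (s * (s * x - y) - (s * y - z)) + 2 * y.
  by field; rewrite gt_eqF.
by rewrite e lerDr mulr_ge0 ?invr_ge0 ?(ltW s0).
Qed.

End quadratic_forms.

Section seminorm.
Context {R : realType} {H : completeNormedModType R[i]}.
Variable ip : {dot H for Num.conj}.
Hypothesis ip_norm : forall u : H, ip u u = `|u| ^+ 2.
Local Notation rdot := (re_dot ip).
Variables (A : H -> H) (pA : rposop ip A).

(** The seminorm [|A^(1/2) u|], without the operator square root. *)
Definition formnorm (A : H -> H) (u : H) : R := Num.sqrt (rdot (A u) u).

Lemma form_ge0 u : 0 <= rdot (A u) u. Proof. by case: pA. Qed.

Lemma formnormD u v : formnorm A (u + v) <= formnorm A u + formnorm A v.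
Proof.
have [lA _ sA pos] := pA.
rewrite /formnorm -(@ler_pXn2r _ 2) ?nnegrE ?addr_ge0 ?sqrtr_ge0//.
rewrite sqr_sqrtr ?form_ge0// sqrrD !sqr_sqrtr ?form_ge0//.
rewrite (linD lA) !rdotDl !rdotDr.
have h : rdot (A u) v <= Num.sqrt (rdot (A u) u) * Num.sqrt (rdot (A v) v).
  rewrite -sqrtrM ?form_ge0//; apply: le_trans (ler_norm _) _.
  by rewrite -sqrtr_sqr ler_wsqrtr// (pos_form_CS u v lA sA pos).
have -> : rdot (A v) u = rdot (A u) v by rewrite sA rdotC.
by rewrite mulr2n; lra.
Qed.

Lemma form_scale (a : R[i]) u : rdot (A (a *: u)) (a *: u) = complex.Re `|a| ^+ 2 * rdot (A u) u.
Proof.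
have [lA _ _ _] := pA.
rewrite (linZ lA) /re_dot ipZl ipZr mulrA -[a * _]sqr_normc normc_def.
by rewrite -rmorphXn/=; case: (ip _ _) => x y /=; simpc.
Qed.

Lemma formnormZ (a : R[i]) u : formnorm A (a *: u) = complex.Re `|a| * formnorm A u.
Proof.
rewrite /formnorm form_scale sqrtrM ?sqr_ge0// sqrtr_sqr ger0_norm//.
by rewrite normc_def/= sqrtr_ge0.
Qed.

Lemma formnorm0 : formnorm A 0 = 0.
Proof. by rewrite /formnorm rdot0r sqrtr0. Qed.

Lemma formnorm_sum I (s : seq I) (F : I -> H) :
  formnorm A (\sum_(i <- s) F i) <= \sum_(i <- s) formnorm A (F i).
Proof.
elim: s => [|i s IH]; first by rewrite !big_nil formnorm0.
by rewrite !big_cons (le_trans (formnormD _ _))// lerD2l.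
Qed.

Lemma formnorm_sqr u : formnorm A u ^+ 2 = rdot (A u) u.
Proof. by rewrite /formnorm sqr_sqrtr ?form_ge0. Qed.

Lemma formnorm_ge0 u : 0 <= formnorm A u. Proof. exact: sqrtr_ge0. Qed.

End seminorm.

(** * Cubes of a dyadic grid and sparse families *)

(** The default value [set0] marks the indices that enumerate nothing. *)
Lemma countable_enum (T : Type) (A : set (set T)) : countable A -> ~ A set0 ->
  exists q : nat -> set T, [/\ forall i, A (q i) \/ q i = set0,
    forall i j, A (q i) -> q i = q j -> i = j & forall P, A P -> exists i, q i = P].
Proof.
move=> /countable_injP[f finj] A0.
pose q i := if pselect (exists P, A P /\ f P = i) is left h then projT1 (cid h) else set0.
have qP i : (A (q i) /\ f (q i) = i) \/ q i = set0.
  by rewrite /q; case: pselect => [h|_]; [left; case: (cid h)|right].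
exists q; split.
- by move=> i; case: (qP i) => [[]|]; [left|right].
- move=> i j Aqi ij; case: (qP i) => [[_ <-]|e]; last by rewrite e in Aqi.
  by rewrite ij in Aqi *; case: (qP j) => [[_ ->]//|e]; rewrite e in Aqi.
move=> P AP; exists (f P); case: (qP (f P)) => [[Aq /finj]|].
  by apply; rewrite inE.
rewrite /q; case: pselect => [h|[]]; last by exists P.
by case: (cid h) => P' [] /= AP' _ P'0; rewrite P'0 in AP'.
Qed.

Section geometry.
Context {R : realType} {d : nat}.
Hypothesis d_gt0 : (0 < d)%N.
Implicit Types (Q P : set (Rd R d)) (l : R).

Lemma itv_side_le (lo hi : bool) (a b x : R) :
  x \in Interval (BSide lo a) (BSide hi b) -> a <= x <= b.
Proof.
by case: lo; case: hi; rewrite in_itv/= => /andP[] h1 h2;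
  apply/andP; split; rewrite ?(ltW h1) ?(ltW h2)// ?h1 ?h2.
Qed.

Lemma itv_side_lt (lo hi : bool) (a b x : R) :
  a < x < b -> x \in Interval (BSide lo a) (BSide hi b).
Proof.
by case: lo; case: hi; rewrite in_itv/= => /andP[] h1 h2;
  apply/andP; split; rewrite ?(ltW h1) ?(ltW h2)// ?h1 ?h2.
Qed.

Lemma cube_neq0 l Q : 0 < l -> cube l Q -> Q !=set0.
Proof.
move=> l0 [a [lo [hi ->]]]; exists (\row_i (a ord0 i + l / 2)) => i /=.
by rewrite mxE; apply: itv_side_lt; apply/andP; split; lra.
Qed.

(** Faces may be open or closed, so sides are compared on points that stay at
    distance [t] from the faces of [Q]. *)
Lemma cube_sub_le l l' Q Q' : 0 < l -> 0 < l' ->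
  cube l Q -> cube l' Q' -> Q `<=` Q' -> l <= l'.
Proof.
move=> l0 l0' [a [lo [hi QE]]] [a' [lo' [hi' QE']]] QQ'.
rewrite leNgt; apply/negP => ll'.
pose t := (l - l') / 4.
pose x : Rd R d := (\row_i (a ord0 i + t) : 'rV[R]_d).
pose y : Rd R d := (\row_i (a ord0 i + l - t) : 'rV[R]_d).
have t0 : 0 < t by rewrite /t; lra.
have tl : t < l by rewrite /t; lra.
have Qx : Q x.
  by rewrite QE => i /=; rewrite mxE; apply: itv_side_lt; apply/andP; split; lra.
have Qy : Q y.
  by rewrite QE => i /=; rewrite mxE; apply: itv_side_lt; apply/andP; split; lra.
have := QQ' _ Qx; have := QQ' _ Qy; rewrite QE' /=.
move=> /(_ (Ordinal d_gt0)) + /(_ (Ordinal d_gt0)).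
rewrite !mxE => /itv_side_le h1 /itv_side_le h2.
by move: h1 h2 => /andP[h1 h2] /andP[h3 h4]; rewrite /t in h1 h2 h3 h4 *; lra.
Qed.

Lemma coord_measurable (i : 'I_d) :
  measurable_fun setT (fun x : Rd R d => (x : 'rV[R]_d) ord0 i).
Proof.
apply: (measurability _ (measurable_realfun.RGenOpens.measurableE R)).
move=> _ [_ [a [b ->] <-]]; rewrite setTI; apply: sub_sigma_algebra.
have /(@continuousP 'rV[R]_d R) h := @coord_continuous R 1 d ord0 i.
by apply: h; exact: interval_open.
Qed.

Lemma cube_measurable l Q : cube l Q -> measurable Q.
Proof.
move=> [a [lo [hi ->]]].
have -> : [set x : Rd R d | forall i : 'I_d, (x : 'rV[R]_d) ord0 i \in
    Interval (BSide (lo i) (a ord0 i)) (BSide (hi i) (a ord0 i + l))] =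
  \bigcap_(i in [set: 'I_d]) ((fun x : Rd R d => (x : 'rV[R]_d) ord0 i) @^-1`
    [set` Interval (BSide (lo i) (a ord0 i)) (BSide (hi i) (a ord0 i + l))]).
  by apply/seteqP; split=> x /= h i; first move=> _; exact: h.
apply: fin_bigcap_measurable => [|i _]; first exact: finite_finset.
rewrite -[X in measurable X]setTI; apply: coord_measurable => //.
Qed.

Lemma cube_sub_compact l Q : cube l Q ->
  exists2 K : set 'rV[R]_d, compact K & Q `<=` K.
Proof.
move=> [a [lo [hi ->]]].
exists [set v | forall i : 'I_d, `[a ord0 i, a ord0 i + l]%classic (v ord0 i)].
  by apply: (@rV_compact R d (fun i => `[a ord0 i, a ord0 i + l]%classic)) => i;
    exact: segment_compact.
by move=> x /= h i; rewrite in_itv/=; exact: itv_side_le (h i).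
Qed.

Section grid.
Variable D : set (set (Rd R d)).
Hypothesis D_grid : dyadic_grid D.

Lemma expz2_gt0 (k : int) : 0 < (2 : R) ^ k.
Proof. exact: exprz_gt0. Qed.

Lemma grid_measurable Q : D Q -> measurable Q.
Proof. by case: D_grid => _ h _ _ /h[k /cube_measurable]. Qed.

Lemma grid_neq0 Q : D Q -> Q !=set0.
Proof. by case: D_grid => _ h _ _ /h[k /cube_neq0]; apply; exact: expz2_gt0. Qed.

Lemma grid_sub_compact Q : D Q -> exists2 K : set 'rV[R]_d, compact K & Q `<=` K.
Proof. by case: D_grid => _ h _ _ /h[k /cube_sub_compact]. Qed.

Lemma grid_nested Q P x : D Q -> D P -> Q x -> P x -> Q `<=` P \/ P `<=` Q.
Proof.
case: D_grid => _ _ _ h DQ DP Qx Px; case: (h _ _ DQ DP) => e.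
- by have : (Q `&` P) x by []; rewrite e.
- by left => y; rewrite -e => -[].
- by right => y; rewrite -e => -[].
Qed.

(** Scales are monotone for inclusion, and two nested cubes of the same scale
    meet, hence are the same block of a partition. *)
Lemma grid_scale_sub k k' Q P : D Q -> D P -> cube (2 ^ k) Q -> cube (2 ^ k') P ->
  Q `<=` P -> k <= k' /\ (k = k' -> Q = P).
Proof.
move=> DQ DP cQ cP QP; split.
  have := cube_sub_le (expz2_gt0 k) (expz2_gt0 k') cQ cP QP.
  by rewrite ler_eXz2l// ltr1n.
move=> kk'; have [x Qx] := grid_neq0 DQ.
case: D_grid => _ _ /(_ k)[_ tr _] _.
by apply: tr; [split|split=> //; rewrite kk'|exists x; split=> //; exact: QP].
Qed.

End grid.

Section sparse_family.
Variables (D S : set (set (Rd R d))).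
Hypotheses (D_grid : dyadic_grid D) (SD : S `<=` D).
Variable mu : {measure set (Rd R d) -> \bar R}.
Hypothesis S_sparse : sparse mu D S.

Definition inner (S : set (set (Rd R d))) Q :=
  \bigcup_(P in [set P | S P /\ P `<` Q]) P.

Lemma countable_family : countable S.
Proof. by case: D_grid => cD _ _ _; exact: sub_countable (subset_card_le SD) cD. Qed.

Lemma inner_sub Q : inner S Q `<=` Q.
Proof. by move=> x [P [_ [PQ _]] Px]; exact: PQ. Qed.

Lemma family_bigcup_measurable (F : set (set (Rd R d))) : F `<=` D ->
  measurable (\bigcup_(P in F) P).
Proof.
move=> FD; have cF : countable F.
  by case: D_grid => cD _ _ _; exact: sub_countable (subset_card_le FD) cD.
have F0 : ~ F set0 by move=> /FD/(grid_neq0 D_grid)[].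
have [q [q1 _ q2]] := countable_enum cF F0.
have -> : \bigcup_(P in F) P = \bigcup_i q i.
  apply/seteqP; split=> x [P].
    by move=> /q2[i <-] Px; exists i.
  by move=> _ Px; exists (q P) => //; case: (q1 P) Px => [//|->].
apply: bigcupT_measurable => i; case: (q1 i) => [/FD|-> //].
exact: grid_measurable.
Qed.

Lemma inner_measurable Q : measurable (inner S Q).
Proof. by apply: family_bigcup_measurable => P [/SD]. Qed.

(** Cubes of [S] between [P] and [Q] have scales between those of [P] and [Q];
    one of largest scale among them is a child of [Q]. *)
Lemma sub_child Q P : S Q -> S P -> P `<` Q ->
  exists2 P', children S Q P' & P `<=` P'.
Proof.
move=> SQ SP PQ; have [cD hD hpart hnest] := D_grid.
have [kQ cQ] := hD _ (SD SQ); have [kP cP] := hD _ (SD SP).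
have mid P' k : S P' -> cube (2 ^ k) P' -> P `<=` P' -> P' `<` Q ->
    kP <= k /\ k < kQ.
  move=> SP' cP' PP' [P'Q nQP'].
  have [h1 _] := grid_scale_sub D_grid (SD SP) (SD SP') cP cP' PP'.
  have [h2 h3] := grid_scale_sub D_grid (SD SP') (SD SQ) cP' cQ P'Q.
  split=> //; rewrite lt_neqAle h2 andbT; apply/eqP => /h3 e.
  by apply: nQP'; rewrite e.
(* Scales are counted downwards from that of [Q]. *)
pose A (n : nat) := exists P', [/\ S P', P `<=` P', P' `<` Q & cube (2 ^ (kQ - n%:Z)) P'].
have [n0 hn0] : exists n, A n.
  have [_ h] := mid P kP SP cP (@subset_refl _ _) PQ.
  exists `|kQ - kP|%N; exists P; split=> //.
  by rewrite gez0_abs ?subr_ge0 ?ltW// subKr.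
have [n hn nmin] : exists2 n, A n & forall m, A m -> (n <= m)%N.
  have ex : exists n, `[< A n >] by exists n0; apply/asboolP.
  case: (ex_minnP ex) => n /asboolP hn hmin; exists n => // m Am.
  by apply: hmin; apply/asboolP.
have [P' [SP' PP' P'Q cP']] := hn; exists P' => //; split=> // Q'' SQ'' Q''Q P'Q''.
have [k cQ''] := hD _ (SD SQ'').
have PQ'' := subset_trans PP' P'Q''.
have [_ kkQ] := mid _ _ SQ'' cQ'' PQ'' Q''Q.
have [h1 h2] := grid_scale_sub D_grid (SD SP') (SD SQ'') cP' cQ'' P'Q''.
apply/esym/h2/eqP; rewrite eq_le h1/=.
have /nmin : A `|kQ - k|%N.
  by exists Q''; split=> //; rewrite gez0_abs ?subr_ge0 ?(ltW kkQ)// subKr.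
rewrite -lez_nat gez0_abs ?subr_ge0 ?(ltW kkQ)// => h.
by rewrite lerBrDl -lerBrDr.
Qed.

Lemma inner_children Q : S Q -> inner S Q = \bigcup_(P in children S Q) P.
Proof.
move=> SQ; apply/seteqP; split=> x [P].
  move=> [SP PQ] Px; have [P' cP' PP'] := sub_child SQ SP PQ.
  by exists P' => //; exact: PP'.
by move=> [SP PQ _] Px; exists P.
Qed.

(** Sparseness bounds the sum over the children, which cover [inner S Q]. *)
Lemma inner_half Q : S Q -> (mu (inner S Q) <= (2^-1)%:E * mu Q)%E.
Proof.
move=> SQ; apply: le_trans (S_sparse (SD SQ)).
rewrite inner_children//.
have cS : countable (children S Q).
  apply: sub_countable countable_family.
  by apply: subset_card_le => P [].
have c0 : ~ children S Q set0 by move=> [/SD/(grid_neq0 D_grid)[]].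
have [q [q1 q3 q2]] := countable_enum cS c0.
have mq i : measurable (q i).
  by case: (q1 i) => [[/SD + _ _]|-> //]; exact: grid_measurable.
have -> : \bigcup_(P in children S Q) P = \bigcup_i q i.
  apply/seteqP; split=> x [P].
    by move=> /q2[i <-] Px; exists i.
  by move=> _ Px; exists (q P) => //; case: (q1 P) Px => [//|->].
apply: le_trans (le_mu_bigcup mu mq (bigcupT_measurable _ mq)) _.
apply: lime_le; first by apply: is_cvg_nneseries.
apply: nearW => n; apply: esum_ge.
pose r := [seq q i | i <- iota 0 n & `[< children S Q (q i) >]].
have ur : uniq r.
  rewrite map_inj_in_uniq ?filter_uniq ?iota_uniq// => i j.
  by rewrite mem_filter => /andP[/asboolP qi _] _; exact: q3.
exists [set` r].
  split; first exact: finite_seq.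
  move=> P Pr; have [i + ->] := @mapP _ _ _ _ _ Pr; rewrite mem_filter => /andP[/asboolP qi _]; exact: qi.
rewrite -(fsbig_seq _ _ ur) big_map big_filter [leRHS]big_mkcond/= /index_iota subn0.
apply: lee_sum => i _; case: asboolP => // nqi.
by case: (q1 i) => // ->; rewrite measure0.
Qed.

End sparse_family.

End geometry.

(** * Integrals of real functions and weak measurability *)

Section real_integrals.
Context {d : measure_display} {T : measurableType d} {R : realType}.
Implicit Types (mu : {measure set T -> \bar R}) (f g : T -> R) (A : set T).

Lemma measurable_sup_superlevel (g : nat -> T -> R) (h : T -> R) :
    (forall k, measurable_fun setT (g k)) ->
    (forall k x, g k x <= h x) ->
    (forall x a, a < h x -> exists k, a < g k x) ->
  measurable_fun setT h.
Proof.
move=> mg gh hg; apply: (measurability _ (measurable_realfun.RGenOInfty.measurableE R)).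
move=> _ [_ [a ->] <-]; rewrite setTI.
have -> : h @^-1` `]a, +oo[%classic = \bigcup_k (g k @^-1` `]a, +oo[%classic).
  apply/seteqP; split=> x /=; rewrite in_itv/= andbT.
    by move=> /hg[k ak]; exists k => //=; rewrite in_itv/= ak.
  by move=> [k _ /=]; rewrite in_itv/= andbT => /lt_le_trans; apply.
apply: bigcupT_measurable => k; rewrite -[X in measurable X]setTI.
by apply: mg => //; exact: measurable_itv.
Qed.

Lemma integral_1 mu A f : measurable A ->
  (\int[mu]_(x in A) (f x)%:E)%E = (\int[mu]_x (\1_A x * f x)%:E)%E.
Proof.
move=> mA; rewrite integral_mkcond; apply: eq_integral => x _.
by rewrite /patch indicE; case: (x \in A); rewrite ?mul1r ?mul0r.
Qed.

Lemma Rint_EFin mu A f : measurable A -> mu.-integrable A (EFin \o f) ->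
  (\int[mu]_(x in A) f x)%:E = (\int[mu]_(x in A) (f x)%:E)%E.
Proof. by move=> mA h; rewrite /Rintegral fineK// integrable_fin_num. Qed.

Lemma integrable_le mu A f g : measurable A -> measurable_fun A f ->
  (forall x, A x -> `|f x| <= g x) -> mu.-integrable A (EFin \o g) ->
  mu.-integrable A (EFin \o f).
Proof.
move=> mA mf fg; apply: le_integrable => //; first exact/measurable_EFinP.
move=> x Ax /=; rewrite lee_fin (le_trans (fg _ Ax))//; exact: ler_norm.
Qed.

Lemma ge0_integrable mu A f : measurable A -> measurable_fun A f ->
  (forall x, A x -> 0 <= f x) -> (\int[mu]_(x in A) (f x)%:E < +oo)%E ->
  mu.-integrable A (EFin \o f).
Proof.
move=> mA mf f0 fi; apply/integrableP; split; first exact/measurable_EFinP.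
under eq_integral => x /set_mem Ax do rewrite /= ger0_norm ?f0//.
by [].
Qed.

Lemma integrable_ind mu A f : measurable A -> mu.-integrable A (EFin \o f) ->
  mu.-integrable setT (fun x => (\1_A x * f x)%:E).
Proof.
move=> mA /(integrable_mkcond _ mA); apply: eq_integrable => // x _.
by rewrite /= /patch indicE; case: (x \in A); rewrite ?mul1r ?mul0r.
Qed.

Lemma Rint_ind mu A f : measurable A ->
  \int[mu]_(x in A) f x = \int[mu]_x (\1_A x * f x).
Proof. by move=> mA; rewrite /Rintegral integral_1. Qed.

End real_integrals.

Section locally_finite.
Context {R : realType} {d : nat}.
Variable mu : {measure set (Rd R d) -> \bar R}.
Hypothesis mu_lf : locally_finite_measure mu.

Lemma compact_borel (K : set 'rV[R]_d) : compact K -> measurable (K : set (Rd R d)).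
Proof.
move=> /(compact_closed (@norm_hausdorff _ _)) cK.
rewrite -(setCK K); apply: measurableC.
by apply: sub_sigma_algebra; exact: closed_openC.
Qed.

(** Finitely many of the open sets of finite measure cover a compact set. *)
Lemma compact_measure_lty (K : set 'rV[R]_d) : compact K -> (mu K < +oo)%E.
Proof.
move=> cK; have mK := compact_borel cK.
have [U hU] := choice mu_lf.
have mU x : measurable (U x : set (Rd R d)).
  by case: (hU x) => oU _ _; exact: sub_sigma_algebra.
move: cK; rewrite compact_cover => /(_ _ setT U).
case => [x _|x Kx|F _ KF]; first by case: (hU x).
  by exists x => //; case: (hU x).
have fin (s : seq 'rV[R]_d) : measurable (\big[setU/set0]_(x <- s) U x : set (Rd R d)) /\
    (mu (\big[setU/set0]_(x <- s) U x) < +oo)%E.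
  elim: s => [|x s [m1 m2]]; first by rewrite big_nil measure0.
  rewrite big_cons; split; first exact: measurableU.
  apply: le_lt_trans (measureU2 _ (mU x) m1) _.
  by rewrite lte_add_pinfty//; case: (hU x).
have [m1 m2] := fin (finmap.enum_fset F).
apply: le_lt_trans m2; apply: le_measure; rewrite ?inE//.
by rewrite -bigcup_fset.
Qed.

Lemma grid_finite (D : set (set (Rd R d))) Q : dyadic_grid D -> D Q -> (mu Q < +oo)%E.
Proof.
move=> gD DQ; have [K cK QK] := grid_sub_compact gD DQ.
apply: le_lt_trans (compact_measure_lty cK).
by apply: le_measure; rewrite ?inE//; [exact: grid_measurable DQ|exact: compact_borel].
Qed.

Lemma compact_exhaustion : exists K : nat -> set 'rV[R]_d,
  (forall n, compact (K n)) /\ \bigcup_n K n = setT.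
Proof.
exists (fun n => [set v | forall i : 'I_d, `[- n%:R, n%:R]%classic (v ord0 i)]).
split=> [n|].
  by apply: (@rV_compact R d (fun i => `[- n%:R, n%:R]%classic)) => i;
    exact: segment_compact.
apply/seteqP; split=> // v _.
have [n hn] : exists n : nat, forall i, `|v ord0 i| <= n%:R.
  exists (\max_(i < d) Num.bound `|v ord0 i|) => i.
  apply: (@le_trans _ _ (Num.bound `|v ord0 i|)%:R); first exact: (ltW (archi_boundP (normr_ge0 _))).
  by rewrite ler_nat; exact: leq_bigmax.
by exists n => // i /=; rewrite in_itv/= -ler_norml.
Qed.

Lemma compact_measurable_fun (f : Rd R d -> R) :
  (forall K : set 'rV[R]_d, compact K -> measurable_fun (K : set (Rd R d)) f) ->
  measurable_fun setT f.
Proof.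
move=> mf; have [K [cK <-]] := compact_exhaustion.
apply/measurable_fun_bigcup => n; first exact: compact_borel.
exact: mf.
Qed.

End locally_finite.

Section weak_measurability.
Context {d : measure_display} {T : measurableType d} {R : realType}.
Context {H : completeNormedModType R[i]} (ip : {dot H for Num.conj}).
Hypothesis ip_norm : forall u : H, ip u u = `|u| ^+ 2.
Hypothesis H_sep : separable_space (H := H).
Local Notation rdot := (re_dot ip).

Lemma dense_sequence : exists z : nat -> H,
  forall u (e : R), 0 < e -> exists k, rnorm (u - z k) < e.
Proof.
have [X [/countable_injP[f finj] dX]] := H_sep.
pose z i := if pselect (exists u, X u /\ f u = i) is left h then projT1 (cid h) else 0.
exists z => u e e0.
have e0' : 0 < e%:C :> R[i] by rewrite ltcR.
have [||v [uv Xv]] := dX (ball u e%:C).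
- by exists u; exact: ballxx.
- exact: ball_open.
exists (f v); have -> : z (f v) = v.
  rewrite /z; case: pselect => [h|[]]; last by exists v.
  by case: (cid h) => w [] /= Xw /finj; apply; rewrite inE.
by move: uv; rewrite -ball_normE /ball_/= rnormE ltcR.
Qed.

Definition wmeas (f : T -> H) := forall v, measurable_fun setT (fun x => rdot (f x) v).

(** By separability, [|u|^2] is the supremum of [2 (u, z) - |z|^2] over a
    countable dense set, each term being measurable by assumption. *)
Lemma wmeas_sqnorm f : wmeas f -> measurable_fun setT (fun x => rdot (f x) (f x)).
Proof.
move=> mf; have [z hz] := dense_sequence.
apply: (@measurable_sup_superlevel _ _ _
  (fun k x => 2 * rdot (f x) (z k) - rdot (z k) (z k))).
- move=> k; apply: measurable_funB => //.
  by apply: measurable_funM => //; exact: mf.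
- move=> k x; have := rdotii_ge0 ip_norm (f x - z k).
  by rewrite !(rdotBl, rdotBr) (rdotC ip (z k)); lra.
move=> x a ax.
have e0 : 0 < Num.sqrt (rdot (f x) (f x) - a) by rewrite sqrtr_gt0 subr_gt0.
have [k hk] := hz (f x) _ e0; exists k.
move: hk; rewrite -(@ltr_pXn2r _ 2) ?nnegrE ?rnorm_ge0 ?sqrtr_ge0//.
rewrite sqr_sqrtr ?subr_ge0 ?ltW// -(rdotii ip_norm).
by rewrite !(rdotBl, rdotBr) (rdotC ip (z k)); lra.
Qed.

Lemma wmeasD f g : wmeas f -> wmeas g -> wmeas (fun x => f x + g x).
Proof.
move=> mf mg v; under eq_fun do rewrite rdotDl.
by apply: measurable_funD; [exact: mf|exact: mg].
Qed.

Lemma wmeasN f : wmeas f -> wmeas (fun x => - f x).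
Proof.
move=> mf v; under eq_fun do rewrite rdotNl.
by apply: measurable_funN; exact: mf.
Qed.

Lemma wmeas_cst u : wmeas (fun _ => u).
Proof. by move=> v; exact: measurable_cst. Qed.

Lemma wmeas_sum (I : eqType) (s : seq I) (f : I -> T -> H) :
  (forall i, i \in s -> wmeas (f i)) -> wmeas (fun x => \sum_(i <- s) f i x).
Proof.
elim: s => [|i s IH] mf.
  by under eq_fun do rewrite big_nil; exact: wmeas_cst.
under eq_fun do rewrite big_cons; apply: wmeasD; first by apply: mf; rewrite mem_head.
by apply: IH => j js; apply: mf; rewrite in_cons js orbT.
Qed.

Lemma rdot_adjZ (a : R[i]) u v : rdot u (a *: v) = rdot (a^*%C *: u) v.
Proof. by rewrite /re_dot ipZr ipZl. Qed.

(** Polarisation of [wmeas_sqnorm]. *)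
Lemma wmeas_rdot f g : wmeas f -> wmeas g ->
  measurable_fun setT (fun x => rdot (f x) (g x)).
Proof.
move=> mf mg.
have -> : (fun x => rdot (f x) (g x)) = (fun x => 4^-1 *
    (rdot (f x + g x) (f x + g x) - rdot (f x - g x) (f x - g x))).
  apply/funext => x; rewrite !(rdotBl, rdotBr, rdotDl, rdotDr) (rdotC ip (g x)).
  by field.
apply: measurable_funM => //; apply: measurable_funB.
  by apply: wmeas_sqnorm; exact: wmeasD.
by apply: wmeas_sqnorm; apply: wmeasD => //; exact: wmeasN.
Qed.

Lemma rdotZC (a : R[i]) u v : rdot (a *: u) v =
  complex.Re a * rdot u v - complex.Im a * rdot u ('i%C *: v).
Proof.
by rewrite -Im_ip /re_dot ipZl; case: a => x y; case: (ip u v) => z t /=; lra.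
Qed.

Lemma wmeasZ (a : T -> R[i]) f :
  measurable_fun setT (fun x => complex.Re (a x)) ->
  measurable_fun setT (fun x => complex.Im (a x)) ->
  wmeas f -> wmeas (fun x => a x *: f x).
Proof.
move=> ma1 ma2 mf v; under eq_fun do rewrite rdotZC.
by apply: measurable_funB; apply: measurable_funM => //; exact: mf.
Qed.

Lemma wmeas_op (W : T -> H -> H) f :
    (forall x u v, rdot (W x u) v = rdot u (W x v)) ->
    (forall u, wmeas (fun x => W x u)) -> wmeas f ->
  wmeas (fun x => W x (f x)).
Proof.
by move=> sW mW mf v; under eq_fun do rewrite sW; exact: wmeas_rdot.
Qed.

End weak_measurability.

(** * Packing for sparse families *)

Lemma exists_maximal (T : eqType) (r : rel T) (F : seq T) (P : T) :
    reflexive r -> transitive r -> antisymmetric r -> P \in F ->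
  exists2 M, M \in F & r P M /\ forall M', M' \in F -> r M M' -> M' = M.
Proof.
move=> rr tr ar; elim: F P => // a F IH P.
rewrite in_cons => /orP[/eqP->|PF].
  have [/hasP[b bF /andP[ab nab]]|/hasPn h] := boolP (has (fun b => r a b && (b != a)) F).
    have [M MF [bM hM]] := IH b bF; exists M; first by rewrite in_cons MF orbT.
    split=> [|M']; first exact: tr bM.
    rewrite in_cons => /orP[/eqP-> Ma|]; last exact: hM.
    have e : a = b by apply: ar; rewrite ab (tr _ _ _ bM Ma).
    by rewrite e eqxx in nab.
  exists a; first by rewrite mem_head.
  split=> // M'; rewrite in_cons => /orP[/eqP//|/h + aM']; rewrite aM'/=.
  by rewrite negbK => /eqP.
have [M MF [PM hM]] := IH P PF.
have [Ma|nMa] := boolP (r M a); last first.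
  exists M; first by rewrite in_cons MF orbT.
  split=> // M'; rewrite in_cons => /orP[/eqP->|]; last exact: hM.
  by rewrite (negbTE nMa).
exists a; first by rewrite mem_head.
split=> [|M']; first exact: tr Ma.
rewrite in_cons => /orP[/eqP//|M'F] aM'.
have e := hM _ M'F (tr _ _ _ Ma aM'); apply: ar; rewrite aM' e.
by rewrite Ma.
Qed.

Lemma measurable_sum_seq {d} {T : measurableType d} {R : realType} (I : eqType)
    (s : seq I) (f : I -> T -> R) :
    (forall i, i \in s -> measurable_fun setT (f i)) ->
  measurable_fun setT (fun x => \sum_(i <- s) f i x).
Proof.
elim: s => [|i s IH] mf.
  by under eq_fun do rewrite big_nil; exact: measurable_cst.
under eq_fun do rewrite big_cons; apply: measurable_funD.
  by apply: mf; rewrite mem_head.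
by apply: IH => j js; apply: mf; rewrite in_cons js orbT.
Qed.

Lemma ge0_int_sum_seq {d} {T : measurableType d} {R : realType}
    (mu : {measure set T -> \bar R}) (I : eqType) (s : seq I) (f : I -> T -> R) :
    (forall i, i \in s -> measurable_fun setT (f i)) ->
    (forall i x, i \in s -> 0 <= f i x) ->
  (\int[mu]_x (\sum_(i <- s) f i x)%:E = \sum_(i <- s) \int[mu]_x (f i x)%:E)%E.
Proof.
elim: s => [|i s IH] mf f0.
  by rewrite big_nil; under eq_integral do rewrite big_nil; exact: integral0.
have mf' j : j \in s -> measurable_fun setT (f j).
  by move=> js; apply: mf; rewrite in_cons js orbT.
have f0' j x : j \in s -> 0 <= f j x.
  by move=> js; apply: f0; rewrite in_cons js orbT.
rewrite big_cons -IH//; under eq_integral do rewrite big_cons EFinD.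
rewrite ge0_integralD//.
- by move=> x _; rewrite lee_fin f0// mem_head.
- by apply/measurable_EFinP; apply: mf; rewrite mem_head.
- by move=> x _; rewrite lee_fin big_seq sumr_ge0// => j js; exact: f0'.
- by apply/measurable_EFinP; exact: measurable_sum_seq.
Qed.

Section chains.
Context {R : realType} {T : Type}.
Implicit Types (F : seq (set T)) (b : set T -> R).

Definition subb (A B : set T) : bool := `[< A `<=` B >].
Definition psubb (A B : set T) : bool := subb A B && (A != B).

Lemma subb_refl : reflexive subb. Proof. by move=> A; apply/asboolP. Qed.
Lemma subb_trans : transitive subb.
Proof. by move=> A B C /asboolP BA /asboolP AC; apply/asboolP => x /BA/AC. Qed.
Lemma subb_anti : antisymmetric subb.
Proof. by move=> A B /andP[/asboolP AB /asboolP BA]; apply/seteqP. Qed.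

(** Cauchy-Schwarz along a finite chain of sets, with geometric weights: the
    smallest set is removed first, which raises every other exponent by one. *)
Lemma chain_geometric_CS (lam : R) F b : 1 < lam -> uniq F ->
    (forall A B, A \in F -> B \in F -> subb A B || subb B A) ->
    (forall A, A \in F -> 0 <= b A) ->
  (\sum_(A <- F) b A) ^+ 2 <= lam / (lam - 1) *
    \sum_(A <- F) lam ^+ count (psubb^~ A) F * b A ^+ 2.
Proof.
move=> lam1; have lam0 : 0 < lam - 1 by lra.
have [n] := ubnP (size F); elim: n F => // n IH F sF uF tF b0.
have [->|[A0 A0F]] : F = [::] \/ exists A, A \in F.
- by case: F {sF uF tF b0} => [|A F]; [left|right; exists A; rewrite mem_head].
- by rewrite !big_nil expr0n/= mulr0.
have rrefl : reflexive (fun A B => subb B A) by move=> A; exact: subb_refl.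
have rtr : transitive (fun A B => subb B A).
  by move=> A B C h1 h2; exact: subb_trans h2 h1.
have ranti : antisymmetric (fun A B => subb B A).
  by move=> A B; rewrite andbC => /subb_anti.
have [M MF [_ hM]] := exists_maximal rrefl rtr ranti A0F.
pose F' := rem M F.
have FF' : perm_eq F (M :: F') by exact: perm_to_rem.
have uF' : uniq F' by exact: rem_uniq.
have F'F A : A \in F' -> A \in F by exact: mem_rem.
have MF' A : A \in F' -> psubb M A.
  move=> AF'; have /orP[h|h] := tF _ _ MF (F'F _ AF'); apply/andP; split=> //.
  - by apply/eqP => e; move: AF'; rewrite -e /F' mem_rem_uniqF.
  - by rewrite (hM _ (F'F _ AF') h) subb_refl.
  - by apply/eqP => e; move: AF'; rewrite -e /F' mem_rem_uniqF.
rewrite !(perm_big _ FF')/= !big_cons.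
have nM : count (psubb^~ M) F = 0%N.
  apply/eqP; rewrite -leqn0 leqNgt -has_count; apply/hasPn => A AF.
  apply/negP => /andP[/(hM _ AF) -> /eqP]; exact.
rewrite nM expr0 mul1r.
have -> : \sum_(A <- F') lam ^+ count (psubb^~ A) F * b A ^+ 2 =
    lam * \sum_(A <- F') lam ^+ count (psubb^~ A) F' * b A ^+ 2.
  rewrite big_distrr/= big_seq [RHS]big_seq; apply: eq_bigr => A AF'.
  rewrite (permP FF' (psubb^~ A)) /= MF'//= add1n exprS mulrA.
  by [].
have sF' : (size F' < n)%N.
  by rewrite /F' size_rem//; case: (F) MF sF.
have {IH} := IH F' sF' uF' (fun A B hA hB => tF A B (F'F _ hA) (F'F _ hB))
  (fun A hA => b0 A (F'F _ hA)).
move: (\sum_(A <- F') b A) (\sum_(A <- F') _ * _) (b M) => s t bM h.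
have -> : (bM + s) ^+ 2 = lam * s ^+ 2 + lam / (lam - 1) * bM ^+ 2 -
    (lam - 1) * (s - bM / (lam - 1)) ^+ 2.
  by field; rewrite gt_eqF.
have h1 : 0 <= (lam - 1) * (s - bM / (lam - 1)) ^+ 2.
  by rewrite mulr_ge0 ?sqr_ge0 ?ltW.
have h2 : lam * s ^+ 2 <= lam * (lam / (lam - 1) * t).
  by rewrite ler_wpM2l//; lra.
move: h1 h2; set p := (lam - 1) * _; set q := lam / _; lra.
Qed.

End chains.

Lemma potential_rate_gt1 (R : realType) (rho : R) : rho < 1 -> 1 < 1 + (1 - rho) / 2.
Proof. lra. Qed.

(** With [lam = 1 + (1 - rho) / 2] one has [(2 * lam - 1) * rho <= 1], since
    [(2 - rho) * rho = 1 - (1 - rho) ^+ 2]; so the factor [lam] gained at each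
    generation is absorbed by the decay [rho] of the mass. *)
Lemma potential_arith (R : realType) (rho a b : R) : rho < 1 -> 0 <= a -> 0 <= b ->
  a <= rho * (b + a) -> b + 2 * (1 + (1 - rho) / 2) * a <= 2 * (b + a).
Proof.
move=> r1 a0 b0 h.
have h2 : (2 - rho) * a <= (2 - rho) * (rho * (b + a)) by rewrite ler_wpM2l//; lra.
have h3 : 0 <= (1 - rho) ^+ 2 * (b + a) by rewrite mulr_ge0 ?sqr_ge0 ?addr_ge0.
lra.
Qed.

Section packing.
Context {R : realType} {d : nat}.
Variables (D S : set (set (Rd R d))).
Hypotheses (D_grid : dyadic_grid D) (SD : S `<=` D).
Variable mu : {measure set (Rd R d) -> \bar R}.
Implicit Types (F : seq (set (Rd R d))) (Q P : set (Rd R d)).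

(** The number of generations of [F] above the point [x], when the members of
    [F] that contain [x] are nested. *)
Definition cnt F x := count (fun P => x \in P) F.

Lemma measurable_cnt_exp (lam : R) F : (forall P, P \in F -> S P) ->
  measurable_fun setT (fun x => lam ^+ cnt F x).
Proof.
elim: F => [|P F IH] FS; first exact: measurable_cst.
have -> : (fun x => lam ^+ cnt (P :: F) x) =
    (fun x => (1 + (lam - 1) * \1_P x) * lam ^+ cnt F x).
  apply/funext => x; rewrite /cnt/= indicE exprD; congr (_ * _).
  by case: (x \in P) => /=; rewrite ?expr1 ?expr0; lra.
apply: measurable_funM; last by apply: IH => P' P'F; apply: FS; rewrite in_cons P'F orbT.
apply: measurable_funD => //; apply: measurable_funM => //.
by apply: measurable_indic; apply: (grid_measurable D_grid); apply/SD/FS; rewrite mem_head.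
Qed.

Lemma seq_union_measurable F : (forall P, P \in F -> S P) ->
  measurable (\bigcup_(P in [set` F]) P).
Proof. by move=> FS; apply: (family_bigcup_measurable D_grid) => P /FS/SD. Qed.

Section one_weight.
Variables (w : Rd R d -> R) (rho : R).
Hypotheses (w0 : forall x, 0 <= w x) (mw : measurable_fun setT w).
Hypothesis rho1 : rho < 1.
Local Notation nu A := (\int[mu]_x (\1_A x * w x)%:E)%E.
Hypothesis nu_fin : forall Q, S Q -> (nu Q < +oo)%E.
Hypothesis nu_decay : forall Q F, S Q -> (forall P, P \in F -> S P /\ P `<` Q) ->
  (nu (\bigcup_(P in [set` F]) P) <= rho%:E * nu Q)%E.

Variable lam : R.
Hypothesis lamE : lam = 1 + (1 - rho) / 2.

Let ind_ge0 (A : set (Rd R d)) x : 0 <= (\1_A x : R). Proof. by rewrite indicE ler0n. Qed.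

(** Induction on the number of cubes. Off the union [U] of [F] the potential is
    the weight; on each maximal cube of [F] it is [lam] times the potential of
    the smaller cubes, bounded by twice the mass of that cube. The total is at
    most [nu (Q \ U) + 2 * lam * nu U], and [potential_arith] concludes. *)
Lemma potential_bound Q F : S Q -> uniq F -> (forall P, P \in F -> S P /\ P `<` Q) ->
  (\int[mu]_x (\1_Q x * (lam ^+ cnt F x * w x))%:E <= 2%:E * nu Q)%E.
Proof.
have lam0 : 0 <= lam by rewrite lamE ltW// (lt_trans ltr01)// potential_rate_gt1.
have lamX n : 0 <= lam ^+ n by exact: exprn_ge0.
have [n] := ubnP (size F); elim: n Q F => // n IH Q F sF SQ uF FQ.
have mQ : measurable Q by apply: (grid_measurable D_grid); exact: SD.
pose U := \bigcup_(P in [set` F]) P.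
have mU : measurable U by apply: seq_union_measurable => P /FQ[].
have UQ : U `<=` Q by move=> x [P /FQ[_ [PQ _]] Px]; exact: PQ.
pose mx := [seq P <- F | all (fun P' => subb P P' ==> (P' == P)) F].
have mxF P : P \in mx -> P \in F by rewrite mem_filter => /andP[].
have mxmax P P' : P \in mx -> P' \in F -> P `<=` P' -> P' = P.
  rewrite mem_filter => /andP[/allP h PF] /h + PP'.
  by move=> /implyP/(_ (asboolT PP'))/eqP.
have umx : uniq mx by rewrite filter_uniq.
pose sub P := [seq P' <- F | psubb P' P].
have cntP P x : P \in mx -> x \in P -> cnt F x = (cnt (sub P) x).+1.
  move=> Pm xP; rewrite /cnt /sub count_filter.
  have -> : (count (fun P' => x \in P') F = count (fun P' => ((x \in P') && psubb P' P) || (P' == P)) F)%N.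
    apply: eq_in_count => P' P'F; apply/idP/idP => [xP'|].
      have [e|ne] := eqVneq P' P; first by rewrite orbT.
      rewrite orbF xP' /psubb ne andbT/=; apply/asboolP.
      have [SP' _] := FQ _ P'F; have [SP _] := FQ _ (mxF _ Pm).
      have [||//|PP'] := grid_nested D_grid (SD SP') (SD SP) (x := x).
      - by apply/set_mem.
      - by apply/set_mem.
      - by rewrite (mxmax _ _ Pm P'F PP') eqxx in ne.
    by move=> /orP[/andP[]//|/eqP->].
  have := count_predUI (fun P' => (x \in P') && psubb P' P) (pred1 P) F.
  rewrite [count (predI _ _) _](_ : _ = 0)%N; last first.
    apply/eqP; rewrite -leqn0 leqNgt -has_count; apply/hasPn => P' _ /=.
    by apply/negP => /andP[/andP[_ /andP[_ /eqP]]] + /eqP.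
  have -> : count (pred1 P) F = 1%N by rewrite count_uniq_mem// mxF.
  by rewrite addn0 addn1 => <-; apply: eq_count.
have Ucase x : x \in U -> exists2 P, P \in mx & x \in P.
  move=> /set_mem[P PF Px].
  have [M MF [PM hM]] := exists_maximal subb_refl subb_trans subb_anti PF.
  exists M; last by apply/mem_set; move/asboolP : PM; exact.
  rewrite mem_filter MF andbT; apply/allP => P' P'F; apply/implyP => h.
  by apply/eqP; exact: hM.
have mxdis x P P' : P \in mx -> P' \in mx -> x \in P -> x \in P' -> P' = P.
  move=> Pm P'm /set_mem xP /set_mem xP'.
  have [SP' _] := FQ _ (mxF _ P'm); have [SP _] := FQ _ (mxF _ Pm).
  have [h|h] := grid_nested D_grid (SD SP') (SD SP) xP' xP.
    by apply/esym; exact: mxmax P'm (mxF _ Pm) h.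
  exact: mxmax Pm (mxF _ P'm) h.
(* At most one maximal cube contains [x]. *)
have sumU x (g : set (Rd R d) -> R) : \sum_(P <- mx) \1_P x * g P =
    if pselect (exists2 P, P \in mx & x \in P) is left h then g (projT1 (cid2 h)) else 0.
  case: pselect => [h|nh]; last first.
    rewrite big_seq big1// => P Pm; rewrite indicE; case: (boolP (x \in P)) => xP.
      by exfalso; apply: nh; exists P.
    by rewrite mul0r.
  case: (cid2 h) => P Pm xP /=.
  rewrite (bigD1_seq P)//= indicE xP mul1r big_seq_cond big1 ?addr0// => P' /andP[P'm ne].
  rewrite indicE; case: (boolP (x \in P')) => xP'; last by rewrite mul0r.
  by rewrite (mxdis _ _ _ Pm P'm xP xP') eqxx in ne.
have splitN x : \1_Q x * (lam ^+ cnt F x * w x) =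
    \1_(Q `\` U) x * w x +
    \sum_(P <- mx) lam * (\1_P x * (lam ^+ cnt (sub P) x * w x)).
  under eq_bigr do rewrite mulrCA.
  rewrite sumU; case: pselect => [h|nh].
    case: (cid2 h) => P Pm xP /=.
    have xU : x \in U by apply/mem_set; exists P; [exact: mxF|exact/set_mem].
    have xQ : x \in Q by apply/mem_set; apply: UQ; exact/set_mem.
    have -> : \1_(Q `\` U) x = 0 :> R.
      by rewrite indicE in_setD xU andbF.
    by rewrite (cntP P x Pm xP) exprS indicE xQ mul1r mul0r add0r -mulrA.
  have xU : x \notin U by apply/negP => /Ucase.
  rewrite !indicE in_setD xU andbT addr0.
  have -> : cnt F x = 0%N.
    apply/eqP; rewrite -leqn0 leqNgt -has_count; apply/hasPn => P PF.
    by apply: contra xU => xP; apply/mem_set; exists P => //; exact/set_mem.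
  by rewrite expr0 mul1r.
have splitU x : \1_U x * w x = \sum_(P <- mx) \1_P x * w x.
  rewrite sumU; case: pselect => [h|nh].
    case: (cid2 h) => P Pm xP /=.
    have xU : x \in U by apply/mem_set; exists P; [exact: mxF|exact/set_mem].
    by rewrite indicE xU mul1r.
  have xU : x \notin U by apply/negP => /Ucase.
  by rewrite indicE (negbTE xU) mul0r.
have mP P : P \in mx -> measurable P.
  by move=> /mxF/FQ[SP _]; apply: (grid_measurable D_grid); exact: SD.
have mind A : measurable A -> measurable_fun setT (fun x => \1_A x * w x).
  by move=> mA; apply: measurable_funM => //; exact: measurable_indic.
have subS P P' : P \in mx -> P' \in sub P -> S P' /\ P' `<` P.
  move=> Pm; rewrite mem_filter => /andP[/andP[/asboolP P'P /eqP ne] /FQ[SP' _]].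
  by split=> //; split=> // PP'; apply: ne; apply/seteqP.
have mpot P : P \in mx -> measurable_fun setT
    (fun x => \1_P x * (lam ^+ cnt (sub P) x * w x)).
  move=> Pm; apply: measurable_funM; first by apply: measurable_indic; exact: mP.
  by apply: measurable_funM => //; apply: measurable_cnt_exp => P' /(subS _ _ Pm)[].
have nuQ : nu Q = (nu (Q `\` U) + nu U)%E.
  rewrite -ge0_integralD//.
  - apply: eq_integral => x _; rewrite -EFinD -mulrDl; congr (_ * _)%:E.
    rewrite !indicE in_setD; case: (boolP (x \in U)) => xU.
      by rewrite andbF add0r; have -> : x \in Q by apply/mem_set; apply: UQ; exact/set_mem.
    by rewrite andbT addr0.
  - by move=> x _; rewrite lee_fin mulr_ge0.
  - by apply/measurable_EFinP; apply: mind; exact: measurableD.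
  - by move=> x _; rewrite lee_fin mulr_ge0.
  - by apply/measurable_EFinP; exact: mind.
have nuU : nu U = (\sum_(P <- mx) nu P)%E.
  rewrite -ge0_int_sum_seq; last 2 first.
  - by move=> P Pm; apply: mind; exact: mP.
  - by move=> P x Pm; rewrite mulr_ge0.
  by apply: eq_integral => x _; rewrite splitU.
have -> : (\int[mu]_x (\1_Q x * (lam ^+ cnt F x * w x))%:E =
    nu (Q `\` U) + \sum_(P <- mx) lam%:E *
      \int[mu]_x (\1_P x * (lam ^+ cnt (sub P) x * w x))%:E)%E.
  under eq_integral do rewrite splitN EFinD.
  rewrite ge0_integralD//.
  - rewrite (ge0_int_sum_seq mu); last 2 first.
    + by move=> P Pm; apply: measurable_funM => //; exact: mpot.
    + by move=> P x Pm; rewrite !mulr_ge0.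
    congr (_ + _)%E; rewrite big_seq [RHS]big_seq; apply: eq_bigr => P Pm.
    under eq_integral do rewrite EFinM.
    rewrite ge0_integralZl//.
    + by apply/measurable_EFinP; exact: mpot.
    + by move=> x _; rewrite lee_fin !mulr_ge0.
  - by move=> x _; rewrite lee_fin mulr_ge0.
  - by apply/measurable_EFinP; apply: mind; exact: measurableD.
  - by move=> x _; rewrite lee_fin big_seq sumr_ge0// => P _; rewrite !mulr_ge0.
  - apply/measurable_EFinP.
    have -> : (fun x => \sum_(P <- mx) lam * (\1_P x * (lam ^+ cnt (sub P) x * w x))) =
        (fun x => \1_Q x * (lam ^+ cnt F x * w x) - \1_(Q `\` U) x * w x).
      by apply/funext => x; rewrite splitN addrAC subrr add0r.
    apply: measurable_funB; last by apply: mind; exact: measurableD.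
    apply: measurable_funM; first exact: measurable_indic.
    by apply: measurable_funM => //; apply: measurable_cnt_exp => P /FQ[].
have bnd : (\sum_(P <- mx) lam%:E *
      \int[mu]_x (\1_P x * (lam ^+ cnt (sub P) x * w x))%:E <=
      (2 * lam)%:E * nu U)%E.
  rewrite nuU ge0_sume_distrr; last first.
    by move=> P _; apply: integral_ge0 => x _; rewrite lee_fin mulr_ge0.
  rewrite big_seq [leRHS]big_seq; apply: lee_sum => P Pm.
  rewrite mulrC EFinM -muleA; apply: lee_pmul => //.
    by apply: integral_ge0 => x _; rewrite lee_fin !mulr_ge0.
  have [SP PQ] := FQ _ (mxF _ Pm).
  apply: IH => //.
  - apply: (@leq_trans (size F)) => //; rewrite size_filter ltn_neqAle count_size andbT.
    rewrite -all_count; apply/negP => /allP /(_ _ (mxF _ Pm)).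
    by rewrite /psubb eqxx andbF.
  - by rewrite filter_uniq.
  - by move=> P'; exact: subS.
have decay := nu_decay SQ FQ.
have finQ := nu_fin SQ.
have nu0 A : (0 <= nu A)%E.
  by apply: integral_ge0 => x _; rewrite lee_fin mulr_ge0.
apply: le_trans (leeD (lexx _) bnd) _.
have finU : (nu U < +oo)%E.
  by apply: le_lt_trans finQ; rewrite nuQ leeDr.
have finD : (nu (Q `\` U) < +oo)%E.
  by apply: le_lt_trans finQ; rewrite nuQ leeDl.
move: decay; rewrite nuQ -/U.
rewrite -(@fineK _ (nu U)) ?ge0_fin_numE// -(@fineK _ (nu (Q `\` U))) ?ge0_fin_numE//.
rewrite -?(EFinD, EFinM) -?(EFinD, EFinM) -?(EFinD, EFinM) -?(EFinD, EFinM) -?(EFinD, EFinM) !lee_fin.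
have : 0 <= fine (nu U) by exact: fine_ge0.
have : 0 <= fine (nu (Q `\` U)) by exact: fine_ge0.
by move=> b0 a0 h; rewrite lamE; apply: potential_arith.
Qed.

End one_weight.

(** Pointwise, the cubes that contain [x] form a chain and [chain_geometric_CS]
    applies; the weights [lam ^+ cnt] are then integrated cube by cube with
    [potential_bound]. *)
Lemma packing (w : set (Rd R d) -> Rd R d -> R) (rho : R) (F : seq (set (Rd R d))) :
    rho < 1 ->
    (forall P x, 0 <= w P x) -> (forall P, measurable_fun setT (w P)) ->
    (forall P Q, S Q -> (\int[mu]_x (\1_Q x * w P x)%:E < +oo)%E) ->
    (forall P Q F', S Q -> (forall P', P' \in F' -> S P' /\ P' `<` Q) ->
      (\int[mu]_x (\1_(\bigcup_(P' in [set` F']) P') x * w P x)%:E <=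
       rho%:E * \int[mu]_x (\1_Q x * w P x)%:E)%E) ->
    uniq F -> (forall P, P \in F -> S P) ->
  (\int[mu]_x ((\sum_(P <- F) \1_P x * Num.sqrt (w P x)) ^+ 2)%:E <=
   (2 + 4 / (1 - rho))%:E * \sum_(P <- F) \int[mu]_x (\1_P x * w P x)%:E)%E.
Proof.
move=> rho1 w0 mw nu_fin nu_decay uF FS.
set lam : R := 1 + (1 - rho) / 2.
have lam1 : 1 < lam by exact: potential_rate_gt1.
pose c : R := 1 + 2 / (1 - rho).
have cE : c = lam / (lam - 1).
  rewrite /c /lam addrAC subrr add0r; field.
  by rewrite subr_eq0 eq_sym lt_eqF.
have c0 : 0 <= c by rewrite /c addr_ge0// divr_ge0// subr_ge0 ltW.
have lamX n : 0 <= lam ^+ n by rewrite exprn_ge0// ltW// (lt_trans ltr01).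
pose sub P := [seq P' <- F | psubb P' P].
have ind0 P x : 0 <= \1_P x :> R by rewrite indicE ler0n.
have mP P : P \in F -> measurable P by move=> /FS/SD; exact: grid_measurable.
have subS P P' : P' \in sub P -> S P' /\ P' `<` P.
  rewrite mem_filter => /andP[/andP[/asboolP P'P /eqP ne] /FS SP'].
  by split=> //; split=> // PP'; apply: ne; apply/seteqP.
have pw x : (\sum_(P <- F) \1_P x * Num.sqrt (w P x)) ^+ 2 <=
    \sum_(P <- F) c * (\1_P x * (lam ^+ cnt (sub P) x * w P x)).
  pose L := [seq P <- F | x \in P].
  have sumL (g : set (Rd R d) -> R) : \sum_(P <- F) \1_P x * g P = \sum_(P <- L) g P.
    rewrite big_filter [RHS]big_mkcond/=; apply: eq_bigr => P _.
    by rewrite indicE; case: (x \in P); rewrite ?mul1r ?mul0r.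
  rewrite sumL -big_distrr/= sumL cE.
  have -> : \sum_(P <- L) lam ^+ cnt (sub P) x * w P x =
      \sum_(P <- L) lam ^+ count (psubb^~ P) L * Num.sqrt (w P x) ^+ 2.
    apply: eq_bigr => P _; rewrite sqr_sqrtr//; congr (_ ^+ _ * _).
    rewrite /cnt /sub /L !count_filter; apply: eq_count => P' /=.
    by rewrite andbC.
  apply: chain_geometric_CS => //.
  - by rewrite filter_uniq.
  - move=> A B; rewrite !mem_filter => /andP[/set_mem Ax /FS/SD DA] /andP[/set_mem Bx /FS/SD DB].
    have [h|h] := grid_nested D_grid DA DB Ax Bx; apply/orP; [left|right]; exact/asboolP.
have mB P : P \in F -> measurable_fun setT
    (fun x => c * (\1_P x * (lam ^+ cnt (sub P) x * w P x))).
  move=> PF; apply: measurable_funM => //; apply: measurable_funM.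
    by apply: measurable_indic; exact: mP.
  by apply: measurable_funM => //; apply: measurable_cnt_exp => P' /subS[].
apply: (@le_trans _ _ (\int[mu]_x
    (\sum_(P <- F) c * (\1_P x * (lam ^+ cnt (sub P) x * w P x)))%:E)%E).
  apply: ge0_le_integral => //.
  - by move=> x _; rewrite lee_fin sqr_ge0.
  - apply/measurable_EFinP; apply: measurable_funX; apply: measurable_sum_seq => P PF.
    apply: measurable_funM; first by apply: measurable_indic; exact: mP.
    by apply: measurableT_comp => //; apply: continuous_measurable_fun; exact: sqrt_continuous.
  - by apply/measurable_EFinP; exact: measurable_sum_seq.
  - by move=> x _; rewrite lee_fin.
rewrite ge0_int_sum_seq//; last by move=> P x _; rewrite !mulr_ge0.
rewrite ge0_sume_distrr; last first.
  by move=> P _; apply: integral_ge0 => x _; rewrite lee_fin mulr_ge0.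
rewrite big_seq [leRHS]big_seq; apply: lee_sum => P PF.
under eq_integral do rewrite EFinM.
rewrite ge0_integralZl//; last 2 first.
- apply/measurable_EFinP; apply: measurable_funM.
    by apply: measurable_indic; exact: mP.
  by apply: measurable_funM => //; apply: measurable_cnt_exp => P' /subS[].
- by move=> x _; rewrite lee_fin !mulr_ge0.
have -> : 2 + 4 / (1 - rho) = c * 2.
  by rewrite /c; field; rewrite subr_eq0 eq_sym lt_eqF.
rewrite EFinM -muleA; apply: lee_pmul => //.
  by apply: integral_ge0 => x _; rewrite lee_fin !mulr_ge0.
apply: (@potential_bound (w P) rho (w0 P) (mw P) rho1 (nu_fin P) (nu_decay P) lam erefl).
- exact: FS.
- by rewrite filter_uniq.
- by move=> P'; exact: subS.
Qed.

End packing.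

(** * Scalar inequalities and integration lemmas *)

Lemma packing_constant_gt0 (R : realType) (M : R) : 1 <= M -> 0 < 2 + 16 * M.
Proof. lra. Qed.

Lemma sqrD_le2 (R : realType) (y z : R) : (y + z) ^+ 2 <= 2 * y ^+ 2 + 2 * z ^+ 2.
Proof. have := sqr_ge0 (y - z); lra. Qed.

(** The square of [18 * M^(3/2)]. *)
Definition upper_const {R : realType} (M : R) : R := 324 * M ^+ 3.

Lemma upper_const_ge0 (R : realType) (M : R) : 0 <= M -> 0 <= upper_const M.
Proof. by move=> M0; apply: mulr_ge0; [exact: ler0n|exact: exprn_ge0]. Qed.

(** The packing constant [2 + 16 * M] occurs once in [weight_packing] and once
    in [avg_carleson], and is at most [18 * M]: hence [324 = 18 ^ 2]. *)
Lemma upper_const_arith (R : realType) (M I X : R) : 1 <= M -> 0 <= I ->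
  X <= (2 + 16 * M) * M * I -> (2 + 16 * M) * X <= upper_const M * I.
Proof.
move=> M1 I0 h.
have h1 : (2 + 16 * M) * X <= (2 + 16 * M) * ((2 + 16 * M) * M * I).
  by rewrite ler_wpM2l//; lra.
have h2 : (2 + 16 * M) * (2 + 16 * M) <= (18 * M) * (18 * M) by apply: ler_pM; lra.
have h3 : 0 <= M * I by rewrite mulr_ge0//; lra.
have h4 := ler_wpM2r h3 h2.
by rewrite /upper_const (exprS M 2) expr2; lra.
Qed.

Lemma upper_const_sqrt (R : realType) (M : R) : 0 <= M -> upper_const M `^ 2^-1 = 18 * M `^ (3 / 2).
Proof.
move=> M0; have h18 : (324 : R) = 18 ^+ 2 by rewrite -natrX.
rewrite /upper_const h18 powRM ?exprn_ge0// -[18 ^+ 2]powR_mulrn// -powRrM.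
rewrite mulfV// powRr1//; congr (_ * _); rewrite -powR_mulrn// -powRrM//.
Qed.

Opaque upper_const.

Lemma poweR_half_le (R : realType) (X Y : \bar R) (K : R) : 0 <= K ->
    (0 <= X)%E -> (0 <= Y)%E -> (X <= K%:E * Y)%E ->
  (X `^ 2^-1 <= (K `^ 2^-1)%:E * (Y `^ 2^-1))%E.
Proof.
move=> K0 X0 Y0 XY; rewrite -poweR_EFin -poweRM//.
apply: gt0_ler_poweR => //.
- by rewrite in_itv/= X0 leey.
- by rewrite in_itv/= leey andbT; apply: mule_ge0 => //; rewrite lee_fin.
Qed.

Lemma poweR_half_sq (R : realType) (X : \bar R) : (0 <= X)%E -> ((X `^ 2^-1) `^ 2 = X)%E.
Proof. by move=> X0; rewrite -poweRrM mulVf ?pnatr_eq0// poweRe1. Qed.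

Lemma sq_poweR_half_le (R : realType) (X Y : \bar R) (K : R) : 0 <= K ->
    (0 <= X)%E -> (0 <= Y)%E -> (X `^ 2^-1 <= K%:E * Y `^ 2^-1)%E ->
  (X <= (K ^+ 2)%:E * Y)%E.
Proof.
move=> K0 X0 Y0 h; rewrite -(poweR_half_sq X0) -[in leRHS](poweR_half_sq Y0).
rewrite -powR_mulrn// -poweR_EFin -poweRM ?poweR_ge0//.
apply: gt0_ler_poweR => //.
- by rewrite in_itv/= poweR_ge0 leey.
- by rewrite in_itv/= leey andbT mule_ge0 ?poweR_ge0.
Qed.

Lemma sqrD_small (R : realType) (n t e : R) : 0 <= n -> 0 < t -> t <= 1 -> t <= e ->
  (n + t) ^+ 2 <= n ^+ 2 + (2 * n + 1) * e.
Proof. by move=> n0 t0 t1 te; rewrite expr2; nra. Qed.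

Lemma integrable_cst_fin {d} {T : measurableType d} {R : realType}
    (mu : {measure set T -> \bar R}) (E : set T) (c : R) :
  measurable E -> (mu E < +oo)%E -> mu.-integrable E (EFin \o cst c).
Proof.
move=> mE finE; apply/integrableP; split; first exact/measurable_EFinP.
rewrite /= integral_cst//; have finE' : mu E \is a fin_num by rewrite ge0_fin_numE.
by rewrite -(fineK finE') -EFinM ltry.
Qed.

Section integrable_EFin.
Context {d} {T : measurableType d} {R : realType}.
Variables (mu : {measure set T -> \bar R}) (E : set T) (mE : measurable E).
Implicit Types f g : T -> R.

Lemma integrableZ_EFin (c : R) f :
  mu.-integrable E (EFin \o f) -> mu.-integrable E (EFin \o (fun x => c * f x)).
Proof.
move=> h; rewrite (_ : _ \o _ = (fun x => c%:E * (EFin \o f) x)%E)//.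
exact: integrableZl.
Qed.

Lemma integrableD_EFin f g :
  mu.-integrable E (EFin \o f) -> mu.-integrable E (EFin \o g) ->
  mu.-integrable E (EFin \o (fun x => f x + g x)).
Proof.
move=> hf hg; rewrite (_ : _ \o _ = ((EFin \o f) \+ (EFin \o g))%E)//.
exact: integrableD.
Qed.

Lemma integrable_sum_EFin (I : eqType) (s : seq I) (F : I -> T -> R) :
  (forall i, i \in s -> mu.-integrable E (EFin \o F i)) ->
  mu.-integrable E (EFin \o (fun x => \sum_(i <- s) F i x)).
Proof.
elim: s => [|i s IH] h.
  rewrite (_ : _ \o _ = cst 0%E); first exact: integrable0.
  by apply/funext => x /=; rewrite big_nil.
rewrite (_ : _ \o _ = EFin \o (fun x => F i x + \sum_(i <- s) F i x)).
  apply: integrableD_EFin; first by apply: h; rewrite mem_head.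
  by apply: IH => j js; apply: h; rewrite in_cons js orbT.
by apply/funext => x /=; rewrite big_cons.
Qed.

Lemma Rintegral_sum (I : eqType) (s : seq I) (F : I -> T -> R) :
  (forall i, i \in s -> mu.-integrable E (EFin \o F i)) ->
  \int[mu]_(x in E) (\sum_(i <- s) F i x) = \sum_(i <- s) \int[mu]_(x in E) F i x.
Proof.
elim: s => [|i s IH] h.
  rewrite big_nil /Rintegral; under eq_integral do rewrite big_nil.
  by rewrite integral0.
have h' j : j \in s -> mu.-integrable E (EFin \o F j).
  by move=> js; apply: h; rewrite in_cons js orbT.
rewrite big_cons -IH// -RintegralD//; last exact: integrable_sum_EFin.
  by apply: eq_Rintegral => x _; rewrite big_cons.
by apply: h; rewrite mem_head.
Qed.

End integrable_EFin.

Section null_sets.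
Context {d : measure_display} {T : measurableType d} {R : realType}.
Variables (mu : {measure set T -> \bar R}) (N : set T).
Hypotheses (mN : measurable N) (N0 : mu N = 0%E).

Lemma ae_off_null (P : set T) : (forall x, ~ N x -> P x) -> {ae mu, forall x, P x}.
Proof.
move=> h; exists N; split=> // x nP; apply: contrapT => Nx; exact: nP (h _ Nx).
Qed.

Lemma Rintegral_off_null (A : set T) (f g : T -> R) : measurable A ->
    measurable_fun A f -> measurable_fun A g -> (forall x, ~ N x -> f x = g x) ->
  \int[mu]_(x in A) f x = \int[mu]_(x in A) g x.
Proof.
move=> mA mf mg fg; congr fine; apply: ae_eq_integral => //.
- exact/measurable_EFinP.
- exact/measurable_EFinP.
- by apply: ae_off_null => x Nx _ /=; rewrite fg.
Qed.

(** Both integrals are suprema over the nonnegative simple functions below. *)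
Lemma ge0_le_integral_nonmeas (f g : T -> \bar R) : (forall x, 0 <= f x)%E ->
  (forall x, f x <= g x)%E -> (\int[mu]_x f x <= \int[mu]_x g x)%E.
Proof.
move=> f0 fg; rewrite !ge0_integralTE//; last by move=> x; exact: le_trans (fg x).
apply: le_ereal_sup => _ [h /= hf <-]; exists h => // x; exact: le_trans (fg x).
Qed.

(** The function [f] may fail to be measurable on [N]. It is squeezed between
    two measurable functions equal to [g] off [N], with values [0] and [+oo]
    on [N]. *)
Lemma ge0_integral_off_null (f g : T -> R) : (forall x, 0 <= f x) ->
    (forall x, 0 <= g x) -> measurable_fun setT g -> (forall x, ~ N x -> f x = g x) ->
  (\int[mu]_x (f x)%:E = \int[mu]_x (g x)%:E)%E.
Proof.
move=> f0 g0 mg fg.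
have ae1 : {ae mu, forall x, ~ N x}.
  by exists N; split=> // x /= ; apply: contrapT.
have mgE : measurable_fun setT (EFin \o g) by exact/measurable_EFinP.
apply/eqP; rewrite eq_le; apply/andP; split.
  pose g' x : \bar R := if x \in N then +oo%E else (g x)%:E.
  have mg' : measurable_fun setT g'.
    apply: measurable_fun_ifT => //.
    by apply: (measurable_fun_bool true); rewrite setTI preimage_true// ; under eq_set do rewrite inE.
  have -> : (\int[mu]_x (g x)%:E = \int[mu]_x g' x)%E.
    apply: ge0_ae_eq_integral => //.
    - by move=> x _; rewrite lee_fin.
    - by move=> x _; rewrite /g'; case: ifP => _; rewrite ?leey// lee_fin.
    - apply: filterS ae1 => x Nx _ /=.
      by rewrite /g' memNset.
  apply: ge0_le_integral_nonmeas => x; first by rewrite lee_fin.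
  rewrite /g'; case: (boolP (x \in N)) => [_|/negP xN]; first exact: leey.
  by rewrite fg// => /mem_set.
pose g' x : R := if x \in N then 0 else g x.
have mg' : measurable_fun setT g'.
  apply: measurable_fun_ifT => //.
  by apply: (measurable_fun_bool true); rewrite setTI preimage_true//; under eq_set do rewrite inE.
have -> : (\int[mu]_x (g x)%:E = \int[mu]_x (g' x)%:E)%E.
  apply: ge0_ae_eq_integral => //.
  - exact/measurable_EFinP.
  - by move=> x _; rewrite lee_fin.
  - by move=> x _; rewrite /g'; case: ifP => _; rewrite ?lexx// lee_fin.
  - by apply: filterS ae1 => x Nx _ /=; rewrite /g' memNset.
apply: ge0_le_integral_nonmeas => x.
  by rewrite /g'; case: ifP => _; rewrite ?lexx// lee_fin.
rewrite /g'; case: (boolP (x \in N)) => [_|/negP xN]; first by rewrite lee_fin.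
by rewrite fg// => /mem_set.
Qed.

End null_sets.

(** * Complex-valued functions and series *)

Section complex_functions.
Context {R : realType} {d : nat}.

Lemma cmeasurable_norm (g : Rd R d -> R[i]) : cmeasurable g ->
  measurable_fun setT (fun x => complex.Re `|g x|).
Proof.
move=> [m1 m2]; under eq_fun do rewrite normc_def/=.
apply: measurableT_comp.
  by apply: continuous_measurable_fun; exact: sqrt_continuous.
by apply: measurable_funD; exact: measurable_funX.
Qed.

Lemma cmeasurableM (f g : Rd R d -> R[i]) : cmeasurable f -> cmeasurable g ->
  cmeasurable (fun x => f x * g x).
Proof.
move=> [f1 f2] [g1 g2]; split.
- rewrite (_ : (fun _ => _) = (fun x => complex.Re (f x) * complex.Re (g x) -
    complex.Im (f x) * complex.Im (g x))).
    by apply: measurable_funB; apply: measurable_funM.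
  by apply/funext => x; case: (f x) => a b; case: (g x) => c e.
- rewrite (_ : (fun _ => _) = (fun x => complex.Re (f x) * complex.Im (g x) +
    complex.Im (f x) * complex.Re (g x))).
    by apply: measurable_funD; apply: measurable_funM.
  by apply/funext => x; case: (f x) => a b; case: (g x) => c e.
Qed.

End complex_functions.

Section truncation.
Context {R : realType} {d : nat}.
Implicit Types (g : Rd R d -> R[i]).

(** Symbols are bounded by one only almost everywhere; truncation makes the
    bound hold everywhere and changes a symbol on a null set only. *)
Definition trunc g x : R[i] := if complex.Re `|g x| <= 1 then g x else 0.

Lemma trunc_le1 g x : complex.Re `|trunc g x| <= 1.
Proof. by rewrite /trunc; case: ifP => // _; rewrite normr0 ler01. Qed.

Lemma trunc_id g x : `|g x| <= 1 -> trunc g x = g x.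
Proof.
move=> h; rewrite /trunc.
by have := h; rewrite lecE => /andP[_ /= ->].
Qed.

Lemma trunc_measurable g : cmeasurable g -> cmeasurable (trunc g).
Proof.
move=> mg; have mn := cmeasurable_norm mg; case: mg => m1 m2.
have mb : measurable_fun setT (fun x => complex.Re `|g x| <= 1).
  by apply: measurable_fun_ler => //; exact: measurable_cst.
split.
- rewrite (_ : (fun _ => _) = (fun x => if complex.Re `|g x| <= 1 then complex.Re (g x) else 0)).
    by apply: measurable_fun_ifT.
  by apply/funext => x; rewrite /trunc; case: ifP.
- rewrite (_ : (fun _ => _) = (fun x => if complex.Re `|g x| <= 1 then complex.Im (g x) else 0)).
    by apply: measurable_fun_ifT.
  by apply/funext => x; rewrite /trunc; case: ifP.
Qed.

Lemma trunc_supp g (Q : set (Rd R d)) : (forall x, ~ Q x -> g x = 0) -> forall x,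
  complex.Re `|trunc g x| <= \1_Q x.
Proof.
move=> gQ x; rewrite indicE; case: (boolP (x \in Q)) => xQ; first exact: trunc_le1.
have -> : trunc g x = 0 by rewrite /trunc gQ ?if_same// => /mem_set; apply/negP.
by rewrite normr0 /= .
Qed.

End truncation.

Lemma cnormE (R : rcfType) (z : R[i]) : `|z| = (complex.Re `|z|)%:C.
Proof. by rewrite RRe_real// ger0_real. Qed.

Lemma cnorm_sum (R : rcfType) I (s : seq I) (P : pred I) (t : I -> R[i]) :
  complex.Re `|\sum_(i <- s | P i) t i| <= \sum_(i <- s | P i) complex.Re `|t i|.
Proof.
elim/big_rec2: _ => [|i y x _ h]; first by rewrite normr0.
have := ler_normD (t i) x; rewrite cnormE (cnormE (t i)) (cnormE x) -rmorphD/= lecR.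
by move=> /le_trans; apply; rewrite lerD2l.
Qed.

Lemma unordered_sum_single (R : realType) (T : choiceType) (t : T -> R[i]) P0 :
  (forall P, P <> P0 -> t P = 0) -> summability.sum (t : T -> R[i]^o) = t P0.
Proof.
have TF := @summability.totally_filter T.
move=> t0; apply: (@cvg_lim R[i]^o); [exact: norm_hausdorff|].
apply: cvg_near_cst; exists (finmap.seq_fset tt [:: P0]) => // F P0F.
have PF : P0 \in finmap.enum_fset F.
  have /finmap.fsubsetP := P0F; apply.
  by rewrite (finmap.seq_fsetE tt [:: P0] P0) mem_head.
rewrite /summability.partial_sum -(finmap.big_seq_fsetE _ _ xpredT t)/=.
rewrite (bigD1_seq P0)//= ?finmap.fset_uniq// big1 ?addr0// => P /eqP; exact: t0.
Qed.

Section abs_series.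
Context {R : realType} {H : completeNormedModType R[i]}.

Lemma nondecreasing_bounded_cauchy (t : nat -> R) (N : R) :
    (forall n, t n <= t n.+1) -> (forall n, t n <= N) ->
  forall e : R, 0 < e -> exists k, forall n, (k <= n)%N -> t n - t k < e.
Proof.
move=> tS tN e e0.
have hs : has_sup (range t) by split; [exists (t 0%N), 0%N|exists N => _ [n _ <-]].
have [_ [k _ <-] hk] := sup_adherent e0 hs.
exists k => n kn; have : t n <= sup (range t) by apply: ub_le_sup; [case: hs|exists n].
move=> h; rewrite ltrBlDr; apply: le_lt_trans h _.
by rewrite addrC -ltrBlDr.
Qed.

Lemma abs_series_tail (u : nat -> H) k n : (k <= n)%N ->
  rnorm (\sum_(i < n) u i - \sum_(i < k) u i) <=
  \sum_(i < n) rnorm (u i) - \sum_(i < k) rnorm (u i).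
Proof.
elim: n => [|n IH]; first by rewrite leqn0 => /eqP->; rewrite !subrr rnorm0.
rewrite leq_eqVlt => /orP[/eqP->|]; first by rewrite !subrr rnorm0.
rewrite ltnS => /IH h; rewrite !big_ord_recr/= addrAC [leRHS]addrAC.
by apply: le_trans (rnormD _ _) _; rewrite lerD2r.
Qed.

Lemma abs_series_cvg (u : nat -> H) (N : R) :
    (forall n, \sum_(i < n) rnorm (u i) <= N) ->
  exists l, hcvg (fun n => \sum_(i < n) u i) l.
Proof.
move=> uN; apply: hcomplete => e e0.
have tS n : \sum_(i < n) rnorm (u i) <= \sum_(i < n.+1) rnorm (u i).
  by rewrite big_ord_recr/= lerDl rnorm_ge0.
have e2 : 0 < e / 2 by rewrite divr_gt0.
have [k hk] := nondecreasing_bounded_cauchy tS uN e2.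
exists k => m n km kn.
have := rnormD (\sum_(i < m) u i - \sum_(i < k) u i) (\sum_(i < k) u i - \sum_(i < n) u i).
rewrite subrKA => /le_lt_trans; apply; rewrite [ltRHS](splitr e) ltrD//.
  by apply: le_lt_trans (hk _ km); exact: abs_series_tail.
by rewrite rnormB; apply: le_lt_trans (hk _ kn); exact: abs_series_tail.
Qed.

End abs_series.

Lemma ip_CS (R : realType) (H : completeNormedModType R[i]) (ip : {dot H for Num.conj})
    (ip_norm : forall u : H, ip u u = `|u| ^+ 2) u v :
  complex.Re `|ip u v| <= rnorm u * rnorm v.
Proof.
set z := ip u v; have z0 : 0 <= complex.Re `|z| by rewrite normc_def/= sqrtr_ge0.
move: z0; rewrite le0r => /orP[/eqP->|z0]; first by rewrite mulr_ge0 ?rnorm_ge0.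
have h : re_dot ip (z^*%C *: u) v = complex.Re `|z| ^+ 2.
  by rewrite /re_dot ipZl -/z mulrC -sqr_normc cnormE -rmorphXn.
have := le_trans (ler_norm _) (ler_rdot ip_norm (z^*%C *: u) v).
rewrite h rnormZ normcJ expr2 -mulrA ler_pM2l//.
Qed.

Lemma le_of_le_add_eps (R : realType) (a b k : R) : 0 <= k ->
  (forall e, 0 < e -> a <= b + k * e) -> a <= b.
Proof.
move=> k0 h; apply/ler_addgt0Pr => e e0.
apply: le_trans (h (e / (k + 1)) _) _; first by rewrite divr_gt0// ltr_wpDl.
rewrite lerD2l mulrA ler_pdivrMr ?ltr_wpDl//.
by rewrite mulrC ler_pM2l// lerDl.
Qed.

Lemma form_sub_le (R : realType) (H : completeNormedModType R[i])
    (ip : {dot H for Num.conj}) (A : H -> H) u v : rposop ip A ->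
  re_dot ip (A (u - v)) (u - v) <= 2 * re_dot ip (A u) u + 2 * re_dot ip (A v) v.
Proof.
move=> [lA _ sA pA]; have := pA (u + v).
rewrite (linB lA) (linD lA) !(rdotBl, rdotBr, rdotDl, rdotDr).
by move: (re_dot _ _ _) (re_dot _ _ _) (re_dot _ _ _) (re_dot _ _ _) => a b c e; lra.
Qed.

Lemma rposop_bound (R : realType) (H : completeNormedModType R[i])
    (ip : {dot H for Num.conj}) (ip_norm : forall u : H, ip u u = `|u| ^+ 2)
    (A : H -> H) : rposop ip A ->
  exists2 K : R, 0 < K & forall u, re_dot ip (A u) u <= K * re_dot ip u u.
Proof.
move=> [_ [C C0 hC] _ _]; exists (C + 1); first by rewrite ltr_wpDl.
move=> u; rewrite rdotii// expr2 mulrA.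
apply: le_trans (ler_norm _) _; apply: le_trans (ler_rdot ip_norm _ _) _.
rewrite ler_wpM2r ?rnorm_ge0//; apply: le_trans (hC u) _.
by rewrite ler_wpM2r ?rnorm_ge0// lerDl.
Qed.

(** * Operator weights and their averages *)

Section weighted_spaces.
Context {R : realType} {d : nat}.
Hypothesis d_gt0 : (0 < d)%N.
Variable mu : {measure set (Rd R d) -> \bar R}.
Hypothesis mu_lf : locally_finite_measure mu.
Variables (D S : set (set (Rd R d))).
Hypotheses (D_grid : dyadic_grid D) (SD : S `<=` D) (S_sparse : sparse mu D S).
Context {H : completeNormedModType R[i]}.
Variable ip : {dot H for Num.conj}.
Hypothesis ip_norm : forall u : H, ip u u = `|u| ^+ 2.
Hypothesis H_sep : separable_space (H := H).
Local Notation rdot := (re_dot ip).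

(** A pair of mutually inverse weights, positive at every point, with their
    averages [A] and [B]. The averaging identities are multiplied by [mu Q], so
    they also hold on null cubes. The two weights play symmetric roles
    ([dual_weightsC]), which halves the number of estimates. *)
Record dual_weights (W V : Rd R d -> H -> H) (A B : set (Rd R d) -> H -> H) : Prop :=
  DualWeights {
    dw_W : forall x, rposop ip (W x);
    dw_V : forall x, rposop ip (V x);
    dw_WV : forall x u, W x (V x u) = u;
    dw_VW : forall x u, V x (W x u) = u;
    dw_mW : forall u, wmeas ip (fun x => W x u);
    dw_mV : forall u, wmeas ip (fun x => V x u);
    dw_iW : forall (K : set 'rV[R]_d), compact K -> forall u v,
      mu.-integrable K (EFin \o fun x => rdot (W x u) v);
    dw_iV : forall (K : set 'rV[R]_d), compact K -> forall u v,
      mu.-integrable K (EFin \o fun x => rdot (V x u) v);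
    dw_A : forall Q, S Q -> rposop ip (A Q);
    dw_B : forall Q, S Q -> rposop ip (B Q);
    dw_avW : forall Q, S Q -> forall u v,
      fine (mu Q) * rdot (A Q u) v = \int[mu]_(x in Q) rdot (W x u) v;
    dw_avV : forall Q, S Q -> forall u v,
      fine (mu Q) * rdot (B Q u) v = \int[mu]_(x in Q) rdot (V x u) v }.

Lemma dual_weightsC W V A B : dual_weights W V A B -> dual_weights V W B A.
Proof. by case=> *; split. Qed.

(** The density of the squared norm of [f] in the weighted space. *)
Definition qform (W : Rd R d -> H -> H) (f : Rd R d -> H) x := rdot (W x (f x)) (f x).

(** The bound [|A^(1/2) B^(1/2)|^2 <= M] on the averages, written on quadratic
    forms by [sqrt_norm_formV] and [form_sqrt_norm]. *)
Definition A2_form (A B : set (Rd R d) -> H -> H) (M : R) :=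
  forall Q, S Q -> forall u, rdot (B Q (A Q u)) (A Q u) <= M * rdot (A Q u) u.

Let mS Q : S Q -> measurable Q.
Proof. by move=> /SD; exact: grid_measurable. Qed.

Let finS Q : S Q -> mu Q \is a fin_num.
Proof. by move=> /SD DQ; rewrite ge0_fin_numE// (grid_finite mu_lf D_grid). Qed.

Section weights.
Variables (W V : Rd R d -> H -> H) (A B : set (Rd R d) -> H -> H).
Hypothesis WV : dual_weights W V A B.

Lemma qform_ge0 f x : 0 <= qform W f x.
Proof. by case: (dw_W WV x) => _ _ _; apply. Qed.

Lemma qform_measurable f : wmeas ip f -> measurable_fun setT (qform W f).
Proof.
move=> mf; apply: (wmeas_rdot ip_norm) => //; apply: (wmeas_op ip_norm) => //.
- by move=> x u v; case: (dw_W WV x).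
- exact: (dw_mW WV).
Qed.

Lemma integrable_qform_cst Q e : S Q ->
  mu.-integrable Q (EFin \o qform W (fun=> e)).
Proof.
move=> SQ; have [K cK QK] := grid_sub_compact D_grid (SD SQ).
apply: (@integrableS _ _ _ mu (K : set (Rd R d)) Q _ _ (mS SQ) QK (dw_iW WV cK e e)).
exact: compact_borel.
Qed.

Lemma avg_qform Q e : S Q ->
  (\int[mu]_x (\1_Q x * qform W (fun=> e) x)%:E = (fine (mu Q) * rdot (A Q e) e)%:E)%E.
Proof.
move=> SQ; rewrite -integral_1; last exact: mS.
rewrite (dw_avW WV)// Rint_EFin//; first exact: mS.
exact: integrable_qform_cst.
Qed.

Lemma qform_young s u v x : 0 < s ->
  2 * rdot u v <= s * qform W (fun=> u) x + s^-1 * qform V (fun=> v) x.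
Proof. by move=> s0; exact: (young_form u v (dw_W WV x) (dw_WV WV x) s0). Qed.

End weights.

Section decay.
Variables (W V : Rd R d -> H -> H) (A B : set (Rd R d) -> H -> H) (M : R).
Hypothesis WV : dual_weights W V A B.
Hypothesis hM : A2_form A B M.

(** Testing Young's inequality on [u = e], [v = A e] over a large part [E] of
    [Q] bounds the mass of [Q] by the mass of [E]. *)
Lemma weight_large_part Q E (e : H) (s : R) : S Q -> measurable E -> E `<=` Q -> 0 < s ->
  2 * fine (mu E) * rdot (A Q e) e <=
  s * \int[mu]_(x in E) qform W (fun=> e) x +
  s^-1 * (M * (fine (mu Q) * rdot (A Q e) e)).
Proof.
move=> SQ mE EQ s0; have mQ := mS SQ.
have iW : mu.-integrable E (EFin \o qform W (fun=> e)).
  exact: (@integrableS _ _ _ mu Q E _ mQ mE EQ (integrable_qform_cst WV e SQ)).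
have iVQ := integrable_qform_cst (dual_weightsC WV) (A Q e) SQ.
have iV : mu.-integrable E (EFin \o qform V (fun=> A Q e)).
  exact: (@integrableS _ _ _ mu Q E _ mQ mE EQ iVQ).
have isum : mu.-integrable E (EFin \o (fun x => s * qform W (fun=> e) x +
    s^-1 * qform V (fun=> A Q e) x)).
  by apply: integrableD_EFin => //; exact: integrableZ_EFin.
have finE : mu E \is a fin_num.
  rewrite ge0_fin_numE//; apply: le_lt_trans (le_measure _ _ _ EQ) _; rewrite ?inE//.
  by rewrite -ge0_fin_numE// finS.
have icst : mu.-integrable E (EFin \o cst (2 * rdot e (A Q e))).
  by apply: integrable_cst_fin => //; rewrite -ge0_fin_numE.
have := le_Rintegral mE icst isum (fun x _ => qform_young WV e (A Q e) x s0).
rewrite Rintegral_cst// RintegralD//; last 2 first.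
- exact: integrableZ_EFin.
- exact: integrableZ_EFin.
rewrite !RintegralZl// (rdotC _ e) => h.
rewrite mulrAC; apply: le_trans h _; rewrite lerD2l ler_wpM2l ?invr_ge0 ?(ltW s0)//.
have h1 : \int[mu]_(x in E) qform V (fun=> A Q e) x <=
    \int[mu]_(x in Q) qform V (fun=> A Q e) x.
  rewrite -lee_fin !Rint_EFin//; apply: ge0_subset_integral => //.
    by case/integrableP: iVQ.
  by move=> x _; rewrite lee_fin (qform_ge0 (dual_weightsC WV)).
apply: le_trans h1 _; rewrite -(dw_avV WV)// mulrCA ler_wpM2l ?fine_ge0//.
exact: hM.
Qed.

(** [weight_large_part] with [s = 2 * M] on [E], the complement of [U] in [Q]:
    the last term is at most half of the left-hand side, so [E] keeps the fraction
    [(4 * M)^-1] of the mass of [Q]. *)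
Lemma weight_decay Q U (e : H) : 1 <= M -> S Q -> measurable U -> U `<=` Q ->
    (mu U <= (2^-1)%:E * mu Q)%E ->
  (\int[mu]_x (\1_U x * qform W (fun=> e) x)%:E <=
   (1 - (4 * M)^-1)%:E * \int[mu]_x (\1_Q x * qform W (fun=> e) x)%:E)%E.
Proof.
move=> M1 SQ mU UQ UhQ; have mQ := mS SQ.
have mE : measurable (Q `\` U) by exact: measurableD.
have EQ : Q `\` U `<=` Q by exact: subDsetl.
have iQ := integrable_qform_cst WV e SQ.
have iU : mu.-integrable U (EFin \o qform W (fun=> e)).
  exact: (@integrableS _ _ _ mu Q U _ mQ mU UQ iQ).
have iE : mu.-integrable (Q `\` U) (EFin \o qform W (fun=> e)).
  exact: (@integrableS _ _ _ mu Q _ _ mQ mE EQ iQ).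
have M0 : 0 < M by lra.
have s0 : 0 < 2 * M by lra.
have h := weight_large_part e SQ mE EQ s0.
have hQ : \int[mu]_(x in Q) qform W (fun=> e) x =
    \int[mu]_(x in Q `\` U) qform W (fun=> e) x + \int[mu]_(x in U) qform W (fun=> e) x.
  rewrite -Rintegral_setU//.
  - by congr (Rintegral _ _ _); rewrite setDKU.
  - by rewrite setDKU.
  - by apply/disj_setPS => x [[]].
have hmu : fine (mu Q) <= 2 * fine (mu (Q `\` U)).
  have finU : mu U \is a fin_num.
    rewrite ge0_fin_numE//; apply: le_lt_trans (le_measure _ _ _ UQ) _; rewrite ?inE//.
    by rewrite -ge0_fin_numE// finS.
  have finQ := finS SQ.
  rewrite measureD//; last by rewrite -ge0_fin_numE.
  rewrite setIidr// fineB//; move: UhQ.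
  rewrite -{1}(fineK finU) -{1}(fineK finQ) -EFinM lee_fin; lra.
rewrite -!integral_1// -!Rint_EFin// -EFinM lee_fin.
have a0 : 0 <= rdot (A Q e) e by case: (dw_A WV SQ) => _ _ _; apply.
move: h hQ; rewrite -(dw_avW WV SQ).
set m := fine (mu Q) in hmu *; set mE' := fine (mu _) in hmu *.
move: (\int[mu]_(x in U) _) (\int[mu]_(x in Q `\` U) _) => wU wE.
move: (rdot _ _) a0 => a a0 h hQ.
have h1 : m * a <= 2 * mE' * a by rewrite ler_wpM2r.
have h2 : (2 * M)^-1 * (M * (m * a)) = m * a / 2 by field; rewrite gt_eqF.
rewrite h2 in h.
have h3 : m * a <= 4 * M * wE by lra.
have h4 : (4 * M)^-1 * (m * a) <= wE.
  by rewrite ler_pdivrMl//; lra.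
have -> : wU = m * a - wE by rewrite hQ addrAC subrr add0r.
lra.
Qed.

(** [weight_large_part] with [E = Q] and [s = 1] gives [(1 - M) * a <= 0] for
    the mass [a] of [Q]. *)
Lemma weight_degenerate Q e : M < 1 -> S Q -> fine (mu Q) * rdot (A Q e) e = 0.
Proof.
move=> M1 SQ.
have := @weight_large_part Q Q e 1 SQ (mS SQ) (@subset_refl _ _) ltr01.
rewrite -(dw_avW WV SQ) invr1 !mul1r.
have a0 : 0 <= fine (mu Q) * rdot (A Q e) e.
  by rewrite mulr_ge0 ?fine_ge0//; case: (dw_A WV SQ) => _ _ _; apply.
rewrite -mulrA; move: (_ * _) a0 => a a0 h.
have h2 : 0 <= (1 - M) * a by rewrite mulr_ge0//; lra.
have h3 : (1 - M) * a <= 0 by lra.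
have : (1 - M) * a == 0 by rewrite eq_le h2 h3.
by rewrite mulf_eq0 subr_eq0 eq_sym (lt_eqF M1)/= => /eqP.
Qed.

(** [packing] applied to the scalar weights [(W x (e P), e P)], which decay at
    the rate [1 - (4 * M)^-1] by [weight_decay] and sparseness. *)
Lemma weight_packing (F : seq (set (Rd R d))) (e : set (Rd R d) -> H) :
    1 <= M -> uniq F -> (forall P, P \in F -> S P) ->
  (\int[mu]_x ((\sum_(P <- F) \1_P x * formnorm ip (W x) (e P)) ^+ 2)%:E <=
   ((2 + 16 * M) * \sum_(P <- F) fine (mu P) * rdot (A P (e P)) (e P))%:E)%E.
Proof.
move=> M1 uF FS.
have M0 : 0 < M by lra.
pose rho := 1 - (4 * M)^-1.
have rho1 : rho < 1 by rewrite /rho ltrBlDr ltrDl invr_gt0; lra.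
have := @packing _ _ D S D_grid SD mu (fun P => qform W (fun=> e P)) rho F rho1.
move=> /(_ (fun P x => qform_ge0 WV (fun=> e P) x)).
move=> /(_ (fun P => qform_measurable WV (wmeas_cst ip (e P)))).
have h1 P Q : S Q -> (\int[mu]_x (\1_Q x * qform W (fun=> e P) x)%:E < +oo)%E.
  by move=> SQ; rewrite (avg_qform WV)// ltry.
move=> /(_ h1).
have h2 P Q (F' : seq (set (Rd R d))) : S Q -> (forall P', P' \in F' -> S P' /\ P' `<` Q) ->
    (\int[mu]_x (\1_(\bigcup_(P' in [set` F']) P') x * qform W (fun=> e P) x)%:E <=
     rho%:E * \int[mu]_x (\1_Q x * qform W (fun=> e P) x)%:E)%E.
  move=> SQ F'Q.
  have UI : \bigcup_(P' in [set` F']) P' `<=` inner S Q.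
    by move=> x [P' /F'Q[SP' P'Q] P'x]; exists P'.
  have mU : measurable (\bigcup_(P' in [set` F']) P').
    by apply: (seq_union_measurable D_grid SD) => P' /F'Q[].
  apply: weight_decay => //.
    by move=> x /UI/inner_sub.
  apply: le_trans (inner_half d_gt0 D_grid SD S_sparse SQ).
  by apply: le_measure; rewrite ?inE//; exact: (inner_measurable D_grid SD).
move=> /(_ h2 uF FS).
have -> : 2 + 4 / (1 - rho) = 2 + 16 * M.
  by rewrite /rho opprB addrCA subrr addr0 invrK; lra.
move=> /le_trans; apply.
rewrite EFinM -sumEFin; apply: lee_pmul => //.
- by rewrite lee_fin; lra.
- by apply: sume_ge0 => P _; apply: integral_ge0 => x _;
    rewrite lee_fin mulr_ge0 ?(qform_ge0 WV)// indicE ler0n.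
rewrite big_seq [leRHS]big_seq; apply: lee_sum => P /FS SP.
by rewrite (avg_qform WV).
Qed.

End decay.

(** * Weak means and the Carleson estimate *)

Section carleson.
Variables (W V : Rd R d -> H -> H) (A B : set (Rd R d) -> H -> H).
Hypothesis WV : dual_weights W V A B.

(** Young's inequality bounds [(g x, v)] by the densities of [g] for [W] and of
    the constant [v] for [V]. *)
Lemma integrable_rdot (g : Rd R d -> H) (v : H) (K : set 'rV[R]_d) : wmeas ip g ->
    (\int[mu]_x (qform W g x)%:E < +oo)%E -> compact K ->
  mu.-integrable K (EFin \o (fun x => rdot (g x) v)).
Proof.
move=> mg fg cK; have mK := compact_borel cK.
have iq : mu.-integrable K (EFin \o qform W g).
  apply: (@integrableS _ _ _ mu setT) => //; apply: ge0_integrable => //.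
    exact: (qform_measurable WV).
  by move=> x _; exact: (qform_ge0 WV).
have := integrableZ_EFin mK 2^-1 (integrableD_EFin mK iq (dw_iV WV cK v v)).
apply: integrable_le => //; first exact: measurable_funTS.
move=> x _; rewrite ler_norml; apply/andP; split.
- have := qform_young WV (- g x) v x (@ltr01 R).
  rewrite rdotNl invr1 !mul1r /qform.
  have -> : rdot (W x (- g x)) (- g x) = rdot (W x (g x)) (g x).
    by have [lW _ _ _] := dw_W WV x; rewrite (linN lW) rdotNl rdotNr opprK.
  lra.
- have := qform_young WV (g x) v x (@ltr01 R).
  by rewrite invr1 !mul1r /qform; lra.
Qed.

Lemma integrable_rdot_cube (g : Rd R d -> H) (v : H) Q : wmeas ip g ->
    (\int[mu]_x (qform W g x)%:E < +oo)%E -> S Q ->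
  mu.-integrable Q (EFin \o (fun x => rdot (g x) v)).
Proof.
move=> mg fg SQ; have [K cK QK] := grid_sub_compact D_grid (SD SQ).
apply: (@integrableS _ _ _ mu (K : set (Rd R d)) Q _ _ (mS SQ) QK (integrable_rdot v mg fg cK)).
exact: compact_borel.
Qed.

(** The representative given by [riesz_real], as [vavgE] shows; the inverse of
    [0] being [0], it vanishes on null cubes. *)
Definition vavg (Q : set (Rd R d)) (g : Rd R d -> H) : H :=
  xget 0 [set e | forall v, rdot e v = (fine (mu Q))^-1 * \int[mu]_(x in Q) rdot (g x) v].

Lemma vavgE g Q : wmeas ip g -> (\int[mu]_x (qform W g x)%:E < +oo)%E -> S Q ->
  forall v, rdot (vavg Q g) v = (fine (mu Q))^-1 * \int[mu]_(x in Q) rdot (g x) v.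
Proof.
move=> mg fg SQ; set m := fine (mu Q).
have mQ := mS SQ.
have iQ v := integrable_rdot_cube v mg fg SQ.
have iq : mu.-integrable Q (EFin \o qform W g).
  apply: (@integrableS _ _ _ mu setT) => //; apply: ge0_integrable => //.
    exact: (qform_measurable WV).
  by move=> x _; exact: (qform_ge0 WV).
have [_ [CB CB0 hCB] _ posB] := dw_B WV SQ.
pose I0 := \int[mu]_(x in Q) qform W g x.
have I00 : 0 <= I0 by apply: Rintegral_ge0 => x _; exact: (qform_ge0 WV).
pose l v := m^-1 * \int[mu]_(x in Q) rdot (g x) v.
have m0 : 0 <= m by exact: fine_ge0.
have lZ r u : l (r%:C *: u) = r * l u.
  rewrite /l mulrCA; congr (_ * _); rewrite -RintegralZl//; last exact: iQ.
  by apply: eq_Rintegral => x _; rewrite rdotZr.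
have lD u v : l (u + v) = l u + l v.
  rewrite /l -mulrDr -RintegralD//; [congr (_ * _)|exact: iQ|exact: iQ].
  by apply: eq_Rintegral => x _; rewrite rdotDr.
have l1 v : rnorm v <= 1 -> l v <= m^-1 * (I0 + m * CB).
  move=> v1; rewrite /l ler_wpM2l ?invr_ge0//.
  have iB := integrable_qform_cst (dual_weightsC WV) v SQ.
  apply: (@le_trans _ _ (\int[mu]_(x in Q) (2^-1 * (qform W g x + qform V (fun=> v) x)))).
    apply: le_Rintegral => //; first exact: iQ.
      by apply: integrableZ_EFin => //; exact: integrableD_EFin.
    move=> x _; have := qform_young WV (g x) v x (@ltr01 R).
    by rewrite invr1 !mul1r /qform; lra.
  rewrite RintegralZl//; last exact: integrableD_EFin.
  rewrite RintegralD// -/I0 -(dw_avV WV)// -/m.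
  have h1 : rdot (B Q v) v <= CB.
    apply: le_trans (ler_norm _) _; apply: le_trans (ler_rdot ip_norm _ _) _.
    apply: (@le_trans _ _ (CB * 1 * 1)); last by rewrite !mulr1.
    apply: ler_pM; rewrite ?rnorm_ge0//.
    by apply: le_trans (hCB v) _; rewrite ler_wpM2l.
  have h2 : m * rdot (B Q v) v <= m * CB by rewrite ler_wpM2l.
  have h3 : 0 <= m * rdot (B Q v) v by rewrite mulr_ge0.
  lra.
have lC v : l v <= m^-1 * (I0 + m * CB) * rnorm v.
  have [->|vN0] := eqVneq v 0.
    have -> : l 0 = 0 by have := lZ 0 0; rewrite scaler0 mul0r.
    by rewrite rnorm0 mulr0.
  have nv : 0 < rnorm v by rewrite lt_def rnorm_eq0 vN0 rnorm_ge0.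
  have := l1 ((rnorm v)^-1%:C *: v).
  rewrite rnormZr ger0_norm ?invr_ge0 ?rnorm_ge0// mulVf ?gt_eqF// => /(_ (lexx _)).
  by rewrite lZ ler_pdivrMl// mulrC.
have C0 : 0 <= m^-1 * (I0 + m * CB) by rewrite mulr_ge0 ?invr_ge0 ?addr_ge0 ?mulr_ge0.
have [e he] := riesz_real ip_norm C0 lD lZ lC.
rewrite /vavg; case: xgetP => [e' _ he' v|/(_ e) ne v]; first exact: he'.
by exfalso; apply: ne => w; rewrite -he.
Qed.

Lemma vavg_mu g Q : wmeas ip g -> (\int[mu]_x (qform W g x)%:E < +oo)%E -> S Q ->
  forall v, fine (mu Q) * rdot (vavg Q g) v = \int[mu]_(x in Q) rdot (g x) v.
Proof.
move=> mg fg SQ v; rewrite vavgE//.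
have [m0|mN0] := eqVneq (fine (mu Q)) 0; last by rewrite mulrA divff// mul1r.
rewrite m0 mul0r /Rintegral null_set_integral//; first exact: mS.
- by apply: measurable_int; exact: (integrable_rdot_cube v mg fg SQ).
- by rewrite -(fineK (finS SQ)) m0.
Qed.

Variable M : R.
Hypothesis M1 : 1 <= M.
Hypotheses (hAB : A2_form A B M) (hBA : A2_form B A M).

Variable f : Rd R d -> H.
Hypotheses (mf : wmeas ip f) (ff : (\int[mu]_x (qform W f x)%:E < +oo)%E).
Variable phi : set (Rd R d) -> Rd R d -> R[i].
Hypothesis mphi : forall Q, S Q -> cmeasurable (phi Q).
Hypothesis phi1 : forall Q x, S Q -> complex.Re `|phi Q x| <= 1.

Lemma qformZ_le (a : R[i]) g x : complex.Re `|a| <= 1 ->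
  rdot (W x (a *: g x)) (a *: g x) <= qform W g x.
Proof.
move=> a1; rewrite (form_scale (dw_W WV x)) ler_piMl ?(qform_ge0 WV)//.
by rewrite expr_le1// normc_def/= sqrtr_ge0.
Qed.

Lemma wmeas_phi Q : S Q -> wmeas ip (fun x => phi Q x *: f x).
Proof. by move=> /mphi[m1 m2]; exact: wmeasZ. Qed.

Lemma finite_phi Q : S Q -> (\int[mu]_x (qform W (fun x => phi Q x *: f x) x)%:E < +oo)%E.
Proof.
move=> SQ; apply: le_lt_trans ff; apply: ge0_le_integral => //.
- by move=> x _; rewrite lee_fin (qform_ge0 WV).
- by apply/measurable_EFinP; apply: (qform_measurable WV); exact: wmeas_phi.
- by apply/measurable_EFinP; exact: (qform_measurable WV).
- by move=> x _; rewrite lee_fin qformZ_le// phi1.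
Qed.

Local Notation e Q := (vavg Q (fun x => phi Q x *: f x)).

(** Duality: the sum of the [w_e(Q)] is the integral of [f] against a packed
    sum for the dual weight, whose norm is controlled by the same sum. *)
Lemma avg_carleson (F : seq (set (Rd R d))) : uniq F -> (forall P, P \in F -> S P) ->
  \sum_(P <- F) fine (mu P) * rdot (A P (e P)) (e P) <=
  (2 + 16 * M) * M * fine (\int[mu]_x (qform W f x)%:E).
Proof.
have c0 : 0 <= 2 + 16 * M by rewrite ltW// packing_constant_gt0.
have s0 : 0 < (2 + 16 * M) * M.
  by rewrite mulr_gt0 ?packing_constant_gt0// (lt_le_trans ltr01).
move=> uF FS; set X := \sum_(P <- F) _.
pose a P x : R[i] := (\1_P x)%:C * (phi P x)^*%C.
pose g x := \sum_(P <- F) a P x *: A P (e P).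
have a1 P x : P \in F -> complex.Re `|a P x| <= \1_P x.
  move=> /FS SP; rewrite normrM normcJ normcR ger0_norm; last by rewrite indicE ler0n.
  rewrite normc_def -rmorphM/= ler_piMr//.
  by have := phi1 x SP; rewrite normc_def.
have ma P : P \in F -> wmeas ip (fun x => a P x *: A P (e P)).
  move=> /FS SP; have [m1 m2] := mphi SP; have mP := mS SP.
  apply: wmeasZ; last exact: wmeas_cst.
  - rewrite (_ : (fun _ => _) = (fun x => \1_P x * complex.Re (phi P x))).
      by apply: measurable_funM => //; exact: measurable_indic.
    by apply/funext => x; rewrite /a; case: (phi P x) => y z /=; simpc.
  - rewrite (_ : (fun _ => _) = (fun x => \1_P x * - complex.Im (phi P x))).
      apply: measurable_funM; first by apply: measurable_indic.
      exact: measurable_funN.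
    by apply/funext => x; rewrite /a; case: (phi P x) => y z /=; simpc.
have mg : wmeas ip g by exact: wmeas_sum.
have fgE x : rdot (f x) (g x) =
    \sum_(P <- F) \1_P x * rdot (phi P x *: f x) (A P (e P)).
  rewrite /g rdot_sumr; apply: eq_bigr => P _.
  have -> : rdot (f x) (a P x *: A P (e P)) = rdot ((\1_P x)%:C *: (phi P x *: f x)) (A P (e P)).
    rewrite rdot_adjZ scalerA /a; congr (re_dot ip (_ *: _) _).
    by case: (phi P x) => y z; simpc.
  by rewrite rdotZl.
have iP P : P \in F -> mu.-integrable setT
    (EFin \o (fun x => \1_P x * rdot (phi P x *: f x) (A P (e P)))).
  move=> /FS SP; apply: integrable_ind; first exact: mS.
  by apply: integrable_rdot_cube => //; [exact: wmeas_phi|exact: finite_phi].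
have XE : X = \int[mu]_x rdot (f x) (g x).
  transitivity (\int[mu]_x (\sum_(P <- F) \1_P x * rdot (phi P x *: f x) (A P (e P)))).
    rewrite Rintegral_sum// /X big_seq [RHS]big_seq; apply: eq_bigr => P /FS SP.
    have [_ _ sA _] := dw_A WV SP.
    rewrite sA vavg_mu//; [|exact: wmeas_phi|exact: finite_phi].
    by rewrite Rint_ind//; exact: mS.
  by apply: eq_Rintegral => x _; rewrite fgE.
have VW := dual_weightsC WV.
have pack := weight_packing VW hBA
  (fun P => A P (e P)) M1 uF FS.
have gle x : qform V g x <=
    (\sum_(P <- F) \1_P x * formnorm ip (V x) (A P (e P))) ^+ 2.
  have pV := dw_V WV x.
  rewrite /qform -(formnorm_sqr pV) ler_pXn2r ?nnegrE ?formnorm_ge0//; last first.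
    by apply: sumr_ge0 => P _; rewrite mulr_ge0 ?formnorm_ge0// indicE ler0n.
  apply: le_trans (formnorm_sum pV _ _) _.
  rewrite big_seq [leRHS]big_seq; apply: ler_sum => P PF.
  by rewrite (formnormZ pV) ler_wpM2r ?formnorm_ge0// a1.
have gI : (\int[mu]_x (qform V g x)%:E <= ((2 + 16 * M) * (M * X))%:E)%E.
  apply: le_trans (le_trans pack _).
    apply: ge0_le_integral => //.
    - by move=> x _; rewrite lee_fin (qform_ge0 VW).
    - by apply/measurable_EFinP; exact: (qform_measurable VW).
    - apply/measurable_EFinP; apply: measurable_funX; apply: measurable_sum_seq => P PF.
      apply: measurable_funM; first by apply: measurable_indic; exact: (mS (FS _ PF)).
      apply: measurableT_comp.
        by apply: continuous_measurable_fun; exact: sqrt_continuous.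
      apply: (qform_measurable VW); exact: wmeas_cst.
    - by move=> x _; rewrite lee_fin.
  rewrite lee_fin ler_wpM2l// /X mulr_sumr big_seq [leRHS]big_seq.
  apply: ler_sum => P /FS SP; rewrite mulrCA ler_wpM2l ?fine_ge0//.
  exact: hAB.
have iq : mu.-integrable setT (EFin \o qform W f).
  apply: ge0_integrable => //; first exact: (qform_measurable WV).
  by move=> x _; exact: (qform_ge0 WV).
have ig : mu.-integrable setT (EFin \o qform V g).
  apply: ge0_integrable => //; first exact: (qform_measurable VW).
    by move=> x _; exact: (qform_ge0 VW).
  by apply: le_lt_trans gI _; rewrite ltry.
have ifg : mu.-integrable setT (EFin \o (fun x => rdot (f x) (g x))).
  rewrite (_ : (fun _ => _) = (fun x => \sum_(P <- F) \1_P x *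
    rdot (phi P x *: f x) (A P (e P)))); first exact: integrable_sum_EFin.
  by apply/funext.
(* For this [s] the second term of Young's inequality is at most [X]. *)
pose s := (2 + 16 * M) * M.
have := @le_Rintegral _ _ _ mu setT (fun x => 2 * rdot (f x) (g x))
  (fun x => s * qform W f x + s^-1 * qform V g x) measurableT
  (integrableZ_EFin measurableT 2 ifg)
  (integrableD_EFin measurableT (integrableZ_EFin measurableT s iq)
     (integrableZ_EFin measurableT s^-1 ig))
  (fun x _ => qform_young WV (f x) (g x) x s0).
rewrite RintegralD//; [|exact: integrableZ_EFin|exact: integrableZ_EFin].
rewrite !RintegralZl// -XE => h.
have h1 : s^-1 * \int[mu]_x qform V g x <= X.
  rewrite ler_pdivrMl// -lee_fin Rint_EFin//; apply: le_trans gI _.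
  by rewrite lee_fin /s mulrA.
change (X <= s * \int[mu]_x qform W f x).
have := le_trans h (lerD (lexx _) h1).
by rewrite mulr_natl mulr2n lerD2r.
Qed.

End carleson.

(** * The Lerner series of a vector-valued function *)

Section lerner_series.
Variables (W V : Rd R d -> H -> H) (A B : set (Rd R d) -> H -> H).
Hypothesis WV : dual_weights W V A B.

Variable M : R.
Hypothesis M0 : 0 <= M.
Hypotheses (hAB : A2_form A B M) (hBA : A2_form B A M).

Variables psi phi : set (Rd R d) -> Rd R d -> R[i].
Hypothesis mphi : forall Q, S Q -> cmeasurable (phi Q).
Hypothesis phi1 : forall Q x, S Q -> complex.Re `|phi Q x| <= 1.
Hypothesis mpsi : forall Q, S Q -> cmeasurable (psi Q).
Hypothesis psi1 : forall Q x, S Q -> complex.Re `|psi Q x| <= \1_Q x.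

Definition in_L2 (f : Rd R d -> H) := wmeas ip f /\ (\int[mu]_x (qform W f x)%:E < +oo)%E.

Definition mean f Q := vavg Q (fun x => phi Q x *: f x).

(** [weight_packing] for the means of [phi P *: f], whose masses are summed by
    [avg_carleson]. *)
Lemma list_bound f (F : seq (set (Rd R d))) : in_L2 f ->
    uniq F -> (forall P, P \in F -> S P) ->
  (\int[mu]_x ((\sum_(P <- F) \1_P x * formnorm ip (W x) (mean f P)) ^+ 2)%:E <=
   (upper_const M)%:E * \int[mu]_x (qform W f x)%:E)%E.
Proof.
move=> [mf ff] uF FS.
have I0 : (0 <= \int[mu]_x (qform W f x)%:E)%E.
  by apply: integral_ge0 => x _; rewrite lee_fin (qform_ge0 WV).
have fin : (\int[mu]_x (qform W f x)%:E)%E \is a fin_num by rewrite ge0_fin_numE.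
have [M1|M1] := leP 1 M.
  have := weight_packing WV hAB (mean f) M1 uF FS.
  move=> /le_trans; apply; rewrite -[X in (_ <= _ * X)%E](fineK fin) -EFinM lee_fin.
  apply: upper_const_arith => //; first exact: fine_ge0.
  exact: (avg_carleson WV M1 hAB hBA mf ff mphi phi1 uF FS).
(* Here the means have zero mass, and any packing constant will do. *)
have hAB1 : A2_form A B 1.
  move=> Q SQ u; apply: le_trans (hAB SQ u) _; rewrite ler_wpM2r ?(ltW M1)//.
  by case: (dw_A WV SQ) => _ _ _; apply.
have := weight_packing WV hAB1 (mean f) (lexx _) uF FS.
move=> /le_trans; apply; rewrite big_seq big1; last first.
  move=> P /FS SP.
  exact: (weight_degenerate WV hAB (mean f P) M1 SP).
by rewrite mulr0; apply: mule_ge0 => //; rewrite lee_fin upper_const_ge0.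
Qed.

Variable q : nat -> set (Rd R d).
Hypothesis q_inj : forall i j, S (q i) -> q i = q j -> i = j.

Definition qlist n := [seq q i | i <- iota 0 n & `[< S (q i) >]].

Lemma qlistS n : qlist n.+1 = qlist n ++ (if `[< S (q n) >] then [:: q n] else [::]).
Proof.
rewrite /qlist -(addn1 n) iotaD filter_cat map_cat add0n /=.
by case: asboolP.
Qed.

Lemma qlist_sub n P : P \in qlist n -> S P.
Proof.
move=> Pq; have [i + ->] := @mapP _ _ _ _ _ Pq.
by rewrite mem_filter => /andP[/asboolP qi _].
Qed.

Lemma qlist_uniq n : uniq (qlist n).
Proof.
rewrite map_inj_in_uniq ?filter_uniq ?iota_uniq// => i j.
by rewrite mem_filter => /andP[/asboolP qi _] _; exact: q_inj.
Qed.

(** Partial sums dominating those of the series in the norm of [W x]; they do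
    not involve [psi] and increase with [n]. *)
Definition major f n x : R :=
  \sum_(P <- qlist n) \1_P x * formnorm ip (W x) (mean f P).

Lemma major_ge0 f n x : 0 <= major f n x.
Proof.
by apply: sumr_ge0 => i _; rewrite mulr_ge0 ?formnorm_ge0// indicE ler0n.
Qed.

Lemma major_nondecreasing f x : {homo (major f)^~ x : m n / (m <= n)%N >-> m <= n}.
Proof.
apply: homo_leq => [y|y z t|n]; [exact: lexx|exact: le_trans|].
rewrite /major qlistS big_cat/= lerDl sumr_ge0// => P _.
by rewrite mulr_ge0 ?formnorm_ge0// indicE ler0n.
Qed.

Lemma formnorm_measurable u : measurable_fun setT (fun x => formnorm ip (W x) u).
Proof.
apply: measurableT_comp.
  by apply: continuous_measurable_fun; exact: sqrt_continuous.
by apply: (qform_measurable WV); exact: wmeas_cst.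
Qed.

Lemma major_measurable f n : measurable_fun setT (major f n).
Proof.
apply: measurable_sum_seq => P /qlist_sub SP.
apply: measurable_funM; last exact: formnorm_measurable.
by apply: measurable_indic; exact: mS.
Qed.

Definition major_sup f x : \bar R := limn (fun n => (major f n x ^+ 2)%:E).

Lemma major_sup_ge f n x : ((major f n x ^+ 2)%:E <= major_sup f x)%E.
Proof.
have nd : nondecreasing_seq (fun n => (major f n x ^+ 2)%:E).
  move=> m k mk; rewrite lee_fin.
  by rewrite ler_pXn2r ?nnegrE ?major_ge0//; exact: major_nondecreasing.
rewrite /major_sup (cvg_lim _ (ereal_nondecreasing_cvgn nd))//.
by apply: ereal_sup_ubound; exists n.
Qed.

Lemma major_sup_measurable f : measurable_fun setT (major_sup f).
Proof.
apply: (emeasurable_fun_cvg (fun n x => (major f n x ^+ 2)%:E)).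
  move=> n; apply/measurable_EFinP; apply: measurable_funX; exact: major_measurable.
move=> x _; apply: ereal_nondecreasing_is_cvgn => m k mk; rewrite lee_fin.
by rewrite ler_pXn2r ?nnegrE ?major_ge0//; exact: major_nondecreasing.
Qed.

Lemma major_sup_bound f : in_L2 f ->
  (\int[mu]_x major_sup f x <=
   (upper_const M)%:E * \int[mu]_x (qform W f x)%:E)%E.
Proof.
move=> fL2; rewrite /major_sup monotone_convergence//.
- apply: lime_le; last first.
    apply: nearW => n; apply: list_bound => //; last exact: qlist_sub.
    exact: qlist_uniq.
  apply: ereal_nondecreasing_is_cvgn => m k mk; apply: ge0_le_integral => //.
  + by move=> x _; rewrite lee_fin sqr_ge0.
  + by apply/measurable_EFinP; apply: measurable_funX; exact: major_measurable.
  + by apply/measurable_EFinP; apply: measurable_funX; exact: major_measurable.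
  + move=> x _; rewrite lee_fin ler_pXn2r ?nnegrE ?major_ge0//.
    exact: major_nondecreasing.
- move=> n; apply/measurable_EFinP; apply: measurable_funX; exact: major_measurable.
- by move=> n x _; rewrite lee_fin sqr_ge0.
- move=> x _ m k mk; rewrite lee_fin ler_pXn2r ?nnegrE ?major_ge0//.
  exact: major_nondecreasing.
Qed.

Lemma major_bounded_ae f : in_L2 f ->
  {ae mu, forall x, exists N : R, forall n, major f n x <= N}.
Proof.
move=> fL2.
have fin : (\int[mu]_x major_sup f x < +oo)%E.
  apply: le_lt_trans (major_sup_bound fL2) _.
  apply: lte_mul_pinfty => //; last by case: fL2.
  by rewrite lee_fin upper_const_ge0.
have msup0 x : (0 <= major_sup f x)%E.
  by apply: le_trans (major_sup_ge f 0 x); rewrite lee_fin sqr_ge0.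
have int : mu.-integrable setT (major_sup f).
  apply/integrableP; split; first exact: major_sup_measurable.
  by under eq_integral do rewrite gee0_abs//.
have := integrable_ae measurableT int.
apply: filterS => x /(_ I) fx; exists (Num.sqrt (fine (major_sup f x))) => n.
rewrite -(@ler_pXn2r _ 2) ?nnegrE ?major_ge0 ?sqrtr_ge0//.
rewrite sqr_sqrtr ?fine_ge0// -lee_fin fineK//.
exact: major_sup_ge.
Qed.

Definition lterm f n x : H :=
  if `[< S (q n) >] then psi (q n) x *: mean f (q n) else 0.

Definition labs f n x : R := \sum_(i < n) rnorm (lterm f i x).

Definition lconv f : set (Rd R d) := [set x | exists N : nat, forall n, labs f n x <= N%:R].

(** The sum of the series where it converges absolutely, which is a measurable
    set of full measure ([lconv_ae]), and [0] elsewhere. *)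
Definition lop f x : H :=
  if x \in lconv f then xget 0 [set l | hcvg (fun n => \sum_(i < n) lterm f i x) l] else 0.

Lemma lop_cvg f x : lconv f x -> hcvg (fun n => \sum_(i < n) lterm f i x) (lop f x).
Proof.
move=> fx; have [N hN] := fx; have [l hl] := @abs_series_cvg R H (fun i => lterm f i x) _ hN.
rewrite /lop mem_set//; case: xgetP => [l' _ //|/(_ l)]; by case.
Qed.

(** The constant depends on [x]; it serves to pass, at each point, from
    convergence in the norm of [W x] to convergence in [H]. It comes from
    [|u|^4 = (W u, V u)^2 <= (W u, u) (V u, u)] with a bound for [V x]. *)
Lemma rnorm_le_formnorm x : exists2 C : R, 0 <= C &
  forall u, rnorm u <= C * formnorm ip (W x) u.
Proof.
have [lW [CW CW0 hCW] sW pW] := dw_W WV x; have [lV [CV CV0 hCV] sV pV] := dw_V WV x.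
exists (Num.sqrt CV) => [|u]; first exact: sqrtr_ge0.
rewrite -(@ler_pXn2r _ 2) ?nnegrE ?rnorm_ge0 ?mulr_ge0 ?sqrtr_ge0//.
rewrite exprMn sqr_sqrtr// (formnorm_sqr (dw_W WV x)).
have [->|uN0] := eqVneq u 0.
  by rewrite rnorm0 expr0n/= mulr_ge0.
have nu : 0 < rnorm u ^+ 2 by rewrite exprn_gt0// lt_def rnorm_eq0 uN0 rnorm_ge0.
rewrite -(ler_pM2r nu).
have := pos_form_CS u (V x u) lW sW pW.
rewrite sW (dw_WV WV) rdotii// => h.
rewrite -expr2; apply: le_trans h _; rewrite (mulrC CV) -mulrA ler_wpM2l//.
rewrite rdotC; apply: le_trans (ler_norm _) _.
apply: le_trans (ler_rdot ip_norm _ _) _.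
by rewrite expr2 mulrA ler_wpM2r ?rnorm_ge0.
Qed.

Lemma qlist_sum (V' : nmodType) (g : set (Rd R d) -> V') n :
  \sum_(P <- qlist n) g P = \sum_(i < n) if `[< S (q i) >] then g (q i) else 0.
Proof.
elim: n => [|n IH]; first by rewrite /qlist big_nil big_ord0.
rewrite qlistS big_cat/= IH big_ord_recr/=; congr (_ + _).
by case: asboolP => _; rewrite ?big_seq1 ?big_nil.
Qed.

Lemma labs_le_major f x : exists2 C : R, 0 <= C & forall n, labs f n x <= C * major f n x.
Proof.
have [C C0 hC] := rnorm_le_formnorm x; exists C => // n.
rewrite /labs /major qlist_sum mulr_sumr; apply: ler_sum => i _.
rewrite /lterm; case: asboolP => Si; last by rewrite rnorm0 mulr0.
rewrite rnormZ mulrCA; apply: ler_pM => //; first by rewrite normc_def/= sqrtr_ge0.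
- exact: rnorm_ge0.
- exact: psi1.
Qed.

Lemma lconv_ae f : in_L2 f -> {ae mu, forall x, lconv f x}.
Proof.
move=> /major_bounded_ae; apply: filterS => x [N hN].
have [C C0 hC] := labs_le_major f x.
exists (Num.bound `|C * N|) => n; apply: le_trans (hC n) _.
apply: le_trans (ler_wpM2l C0 (hN n)) _.
apply: le_trans (ler_norm _) _; exact: (ltW (archi_boundP (normr_ge0 _))).
Qed.

Lemma labs_measurable f n : measurable_fun setT (labs f n).
Proof.
apply: (@measurable_sum_seq _ _ _ _ _ (fun (i : 'I_n) x => rnorm (lterm f i x))) => i _.
rewrite /lterm; case: asboolP => Si; last exact: measurable_cst.
under eq_fun do rewrite rnormZ.
by apply: measurable_funM => //; apply: cmeasurable_norm; exact: mpsi.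
Qed.

Lemma lconv_measurable f : measurable (lconv f).
Proof.
have -> : lconv f = \bigcup_N \bigcap_n (labs f n @^-1` `]-oo, N%:R]).
  apply/seteqP; split=> x.
    by move=> [N hN]; exists N => // n _ /=; rewrite in_itv/=.
  by move=> [N _ hN]; exists N => n; have := hN n I; rewrite /= in_itv.
apply: bigcupT_measurable => N; apply: bigcapT_measurable => n.
rewrite -[X in measurable X]setTI; apply: labs_measurable => //.
Qed.

Lemma lterm_wmeas f n : wmeas ip (lterm f n).
Proof.
rewrite /lterm; case: asboolP => Si; last exact: wmeas_cst.
by have [m1 m2] := mpsi Si; apply: wmeasZ => //; exact: wmeas_cst.
Qed.

Lemma lop_wmeas f : wmeas ip (lop f).
Proof.
move=> v.
apply: (measurable_fun_cvg
  (h := fun n x => \1_(lconv f) x * rdot (\sum_(i < n) lterm f i x) v)).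
  move=> n; apply: measurable_funM.
    by apply: measurable_indic; exact: lconv_measurable.
  by apply: wmeas_sum => i _; exact: lterm_wmeas.
move=> x _; rewrite indicE; case: (boolP (x \in lconv f)) => fx.
  under eq_cvg do rewrite mul1r.
  by apply: (hcvg_rdot ip_norm); apply: lop_cvg; exact/set_mem.
rewrite /lop (negbTE fx) rdot0l.
under eq_cvg do rewrite mul0r.
exact: cvg_cst.
Qed.

Lemma formnorm_bounded x : exists2 C : R, 0 <= C &
  forall u, formnorm ip (W x) u <= C * rnorm u.
Proof.
have [_ [C C0 hC] _ _] := dw_W WV x; exists (Num.sqrt C) => [|u]; first exact: sqrtr_ge0.
rewrite -(@ler_pXn2r _ 2) ?nnegrE ?formnorm_ge0 ?mulr_ge0 ?sqrtr_ge0 ?rnorm_ge0//.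
rewrite (formnorm_sqr (dw_W WV x)) exprMn sqr_sqrtr//.
apply: le_trans (ler_norm _) _; apply: le_trans (ler_rdot ip_norm _ _) _.
by rewrite expr2 mulrA ler_wpM2r ?rnorm_ge0.
Qed.

(** Passage to the limit at the point [x]: the partial sums are dominated by
    [major], and the norm of [W x] is continuous. *)
Lemma lop_qform f x : ((qform W (lop f) x)%:E <= major_sup f x)%E.
Proof.
have msup0 : (0 <= major_sup f x)%E.
  by apply: le_trans (major_sup_ge f 0 x); rewrite lee_fin sqr_ge0.
have [fx|fx] := boolP (x \in lconv f); last first.
  by rewrite /qform /lop (negbTE fx) rdot0r.
have [->|fin] := eqVneq (major_sup f x) +oo%E; first exact: leey.
have {}fin : major_sup f x \is a fin_num by rewrite ge0_fin_numE// ltey.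
rewrite -(fineK fin) lee_fin /qform -(formnorm_sqr (dw_W WV x)).
rewrite -[leRHS]sqr_sqrtr ?fine_ge0// ler_pXn2r ?nnegrE ?formnorm_ge0 ?sqrtr_ge0//.
have mn n : major f n x <= Num.sqrt (fine (major_sup f x)).
  rewrite -(@ler_pXn2r _ 2) ?nnegrE ?major_ge0 ?sqrtr_ge0//.
  by rewrite sqr_sqrtr ?fine_ge0// -lee_fin fineK// major_sup_ge.
have pn n : formnorm ip (W x) (\sum_(i < n) lterm f i x) <= major f n x.
  apply: le_trans (formnorm_sum (dw_W WV x) _ _) _.
  rewrite /major qlist_sum; apply: ler_sum => i _.
  rewrite /lterm; case: asboolP => Si; last by rewrite formnorm0.
  by rewrite (formnormZ (dw_W WV x)) ler_wpM2r ?formnorm_ge0// psi1.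
have [C C0 hC] := formnorm_bounded x.
apply/ler_addgt0Pr => e e0.
have C1 : 0 < C + 1 by rewrite ltr_wpDl.
have [N hN] := lop_cvg (set_mem fx) (divr_gt0 e0 C1).
have := hN N (leqnn _); rewrite rnormB ltr_pdivlMr// => hl.
rewrite -(subrKC (\sum_(i < N) lterm f i x) (lop f x)).
apply: le_trans (formnormD (dw_W WV x) _ _) _.
apply: lerD; first exact: le_trans (pn N) (mn N).
apply: le_trans (hC _) _; apply: le_trans (ltW hl).
by rewrite mulrC ler_wpM2l ?rnorm_ge0// lerDl.
Qed.

Lemma lop_bound f : in_L2 f ->
  (\int[mu]_x (qform W (lop f) x)%:E <=
   (upper_const M)%:E * \int[mu]_x (qform W f x)%:E)%E.
Proof.
move=> fL2; apply: le_trans (major_sup_bound fL2).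
apply: ge0_le_integral => //.
- by move=> x _; rewrite lee_fin (qform_ge0 WV).
- by apply/measurable_EFinP; apply: (qform_measurable WV); exact: lop_wmeas.
- exact: major_sup_measurable.
- by move=> x _; exact: lop_qform.
Qed.

Lemma in_L2_lin (a : R[i]) f g : in_L2 f -> in_L2 g -> in_L2 (fun x => a *: f x + g x).
Proof.
move=> [mf ff] [mg fg].
have mh : wmeas ip (fun x => a *: f x + g x).
  by apply: wmeasD => //; apply: wmeasZ => //; exact: measurable_cst.
split=> //.
pose k : R := 2 * complex.Re `|a| ^+ 2.
have k0 : 0 <= k by rewrite mulr_ge0 ?sqr_ge0.
have mq h : wmeas ip h -> measurable_fun setT (EFin \o qform W h).
  by move=> mh'; apply/measurable_EFinP; exact: (qform_measurable WV).
have q0 h x : (0 <= (qform W h x)%:E)%E by rewrite lee_fin (qform_ge0 WV).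
apply: (@le_lt_trans _ _ (\int[mu]_x (k%:E * (qform W f x)%:E + 2%:E * (qform W g x)%:E))%E).
  apply: ge0_le_integral => //.
  - exact: mq.
  - by apply: emeasurable_funD; apply: measurable_funeM; exact: mq.
  - move=> x _; rewrite -!EFinM -EFinD lee_fin /qform.
    have pW := dw_W WV x.
    rewrite -!(formnorm_sqr pW) /k -mulrA -exprMn -(formnormZ pW).
    apply: (@le_trans _ _ ((formnorm ip (W x) (a *: f x) + formnorm ip (W x) (g x)) ^+ 2)).
      by rewrite ler_pXn2r ?nnegrE ?addr_ge0 ?formnorm_ge0// formnormD.
    exact: sqrD_le2.
rewrite ge0_integralD//.
- rewrite !ge0_integralZl//; try exact: mq.
  by apply: lte_add_pinfty; apply: lte_mul_pinfty => //; rewrite lee_fin.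
- by move=> x _; rewrite mule_ge0.
- by apply: measurable_funeM; exact: mq.
- by move=> x _; rewrite mule_ge0.
- by apply: measurable_funeM; exact: mq.
Qed.

Lemma in_L2_phi f Q : in_L2 f -> S Q -> in_L2 (fun x => phi Q x *: f x).
Proof.
by move=> [mf ff] SQ; split; [exact: (wmeas_phi mf mphi SQ)|
  exact: (finite_phi WV mf ff mphi phi1)].
Qed.

Lemma mean_lin (a : R[i]) f g Q : in_L2 f -> in_L2 g -> S Q ->
  mean (fun x => a *: f x + g x) Q = a *: mean f Q + mean g Q.
Proof.
move=> fL2 gL2 SQ; apply: (rdot_inj ip_norm) => v.
have [m1 f1] := in_L2_phi fL2 SQ; have [m2 f2] := in_L2_phi gL2 SQ.
have [m3 f3] := in_L2_phi (in_L2_lin a fL2 gL2) SQ.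
have ma : wmeas ip (fun _ : Rd R d => a^*%C *: v) by exact: wmeas_cst.
rewrite rdotDl.
have -> : rdot (a *: mean f Q) v = rdot (mean f Q) (a^*%C *: v).
  by rewrite rdot_adjZ conjcK.
rewrite !(vavgE WV)// -mulrDr; congr (_ * _).
have mQ := mS SQ.
rewrite -RintegralD//; last 2 first.
- exact: (integrable_rdot_cube WV).
- exact: (integrable_rdot_cube WV).
apply: eq_Rintegral => x _.
by rewrite rdot_adjZ conjcK -rdotDl scalerDr !scalerA (mulrC a).
Qed.

Lemma lop_lin (a : R[i]) f g : in_L2 f -> in_L2 g ->
  {ae mu, forall x, lop (fun y => a *: f y + g y) x = a *: lop f x + lop g x}.
Proof.
move=> fL2 gL2.
have := lconv_ae (in_L2_lin a fL2 gL2); apply: filterS3 (lconv_ae fL2) (lconv_ae gL2).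
move=> x cf cg ch; apply: (hcvg_uniq ip_norm (lop_cvg ch)).
have := hcvgD (hcvgZ a (lop_cvg cf)) (lop_cvg cg).
rewrite [X in hcvg X _ -> _](_ : _ = (fun n => \sum_(i < n)
    lterm (fun y => a *: f y + g y) i x))//.
apply/funext => n; rewrite scaler_sumr -big_split; apply: eq_bigr => i _ /=.
rewrite /lterm; case: asboolP => Si; last by rewrite scaler0 addr0.
by rewrite mean_lin// scalerDr !scalerA (mulrC a).
Qed.

End lerner_series.

(** * Approximation by sums of simple tensors *)

Section tensor_sums.
Implicit Types (f : Rd R d -> R[i]) (g : Rd R d -> H) (G : set (Rd R d)).

Definition tensor_sum g := exists n (f : 'I_n -> Rd R d -> R[i]) (e : 'I_n -> H),
  (forall i, Linf0 mu (f i)) /\ g = fun x => \sum_(i < n) f i x *: e i.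

Lemma cmeasurable_indic G : measurable G ->
  cmeasurable (fun x : Rd R d => (\1_G x)%:C : R[i]).
Proof. by move=> mG; split=> /=; [apply: measurable_indic|apply: measurable_cst]. Qed.

Lemma cnorm_indic G (x : Rd R d) : `|(\1_G x)%:C : R[i]| <= 1.
Proof.
rewrite normcR ger0_norm ?indicE ?ler0n//; have -> : 1 = 1%:C :> R[i] by [].
by rewrite lecR; case: (x \in G).
Qed.

Lemma Linf0_indic G (K : set 'rV[R]_d) : measurable G -> compact K -> G `<=` K ->
  Linf0 mu (fun x => (\1_G x)%:C).
Proof.
move=> mG cK GK; split; first exact: cmeasurable_indic.
- by exists 1; apply: filterE => x; exact: cnorm_indic.
- exists K; split=> // x nK; rewrite indicE memNset//; by move=> /GK.
Qed.

Lemma Linf0_restrict G f : measurable G -> Linf0 mu f ->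
  Linf0 mu (fun x => (\1_G x)%:C * f x).
Proof.
move=> mG [mf [M hM] [K [cK fK]]]; split.
- by apply: cmeasurableM => //; exact: cmeasurable_indic.
- exists M; apply: filterS hM => x fM; rewrite normrM; apply: le_trans fM.
  by rewrite ler_piMl// cnorm_indic.
- by exists K; split=> // x /fK->; rewrite mulr0.
Qed.

Lemma tensor_sum1 f (u : H) : Linf0 mu f -> tensor_sum (fun x => f x *: u).
Proof.
move=> Lf; exists 1%N, (fun=> f), (fun=> u); split=> //.
by apply/funext => x; rewrite big_ord1.
Qed.

Lemma tensor_sum0 : tensor_sum (fun=> 0).
Proof.
exists 0%N, (fun=> fun=> 0), (fun=> 0); split; first by case.
by apply/funext => x; rewrite big_ord0.
Qed.

Lemma tensor_sumD g h : tensor_sum g -> tensor_sum h -> tensor_sum (fun x => g x + h x).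
Proof.
move=> [n [f [e [Lf ->]]]] [m [f' [e' [Lf' ->]]]].
exists (n + m)%N, (fun i : 'I_(n + m) => match fintype.split i with inl j => f j | inr j => f' j end),
  (fun i : 'I_(n + m) => match fintype.split i with inl j => e j | inr j => e' j end); split.
  by move=> i; case: (fintype.split i).
apply/funext => x; rewrite big_split_ord/=; congr (_ + _); apply: eq_bigr => i _.
  by case: splitP => [j /= /val_inj->|j /= ij]//; have := ltn_ord i; rewrite ij ltnNge leq_addr.
case: splitP => [j /= ji|j /= /addnI/val_inj->]//.
by have := ltn_ord j; rewrite -ji ltnNge leq_addr.
Qed.

Lemma tensor_sum_restrict G g : measurable G -> tensor_sum g ->
  tensor_sum (fun x => (\1_G x)%:C *: g x).
Proof.
move=> mG [n [f [e [Lf ->]]]].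
exists n, (fun i x => (\1_G x)%:C * f i x), e; split.
  by move=> i; exact: Linf0_restrict.
by apply/funext => x; rewrite scaler_sumr; apply: eq_bigr => i _; rewrite scalerA.
Qed.

Lemma tensor_sum_if G g h : measurable G -> tensor_sum g -> tensor_sum h ->
  tensor_sum (fun x => if x \in G then g x else h x).
Proof.
move=> mG tg th; have := tensor_sumD (tensor_sum_restrict mG tg)
  (tensor_sum_restrict (measurableC mG) th).
congr tensor_sum; apply/funext => x; rewrite !indicE in_setC.
by case: (x \in G); rewrite /= scale1r scale0r ?addr0 ?add0r.
Qed.

End tensor_sums.

Section greedy.
Variables (W V : Rd R d -> H -> H) (A B : set (Rd R d) -> H -> H).
Hypothesis WV : dual_weights W V A B.
Variables (Q : set (Rd R d)) (SQ : S Q) (v : H).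

(** Up to the constant [(V x v, v)], the opposite of the squared distance from
    [u] to [V x v] in the norm of [W x]: see [gain_residual]. *)
Definition gain (u : H) x := 2 * rdot u v - rdot (W x u) u.

Lemma gain_residual u x :
  rdot (W x (u - V x v)) (u - V x v) = rdot (V x v) v - gain u x.
Proof.
have [lW _ sW _] := dw_W WV x.
rewrite (linB lW) (dw_WV WV) !rdotBl !rdotBr (sW u (V x v)) (dw_WV WV) /gain.
rewrite (rdotC ip v u) (rdotC ip v (V x v)).
by ring.
Qed.

Lemma gain_le u x : gain u x <= rdot (V x v) v.
Proof. by rewrite -subr_ge0 -gain_residual; case: (dw_W WV x). Qed.

Lemma gain_measurable g : wmeas ip g -> measurable_fun setT (fun x => gain (g x) x).
Proof.
move=> mg; apply: measurable_funB.
  by apply: measurable_funM => //; exact: mg.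
exact: (qform_measurable WV).
Qed.

Variable z : nat -> H.
Hypothesis z_dense : forall u (e : R), 0 < e -> exists k, rnorm (u - z k) < e.

(** At each point of [Q], the vector of largest gain among [0] and the first [k]
    terms of [z]. *)
Fixpoint greedy k : Rd R d -> H :=
  if k is k.+1 then
    fun x => if x \in [set x | Q x /\ gain (greedy k x) x < gain (z k) x]
      then z k else greedy k x
  else fun=> 0.

Lemma greedy_supp k x : ~ Q x -> greedy k x = 0.
Proof. by move=> nQ; elim: k => //= k IH; rewrite memNset// => -[]. Qed.

Lemma gain0 x : gain 0 x = 0.
Proof. by rewrite /gain rdot0l rdot0r mulr0 subr0. Qed.

Lemma gain_greedy_homo x : {homo (fun k => gain (greedy k x) x) : i j / (i <= j)%N >-> i <= j}.
Proof.
apply: homo_leq; [by []|exact: le_trans|move=> k /=].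
by case: ifP => // /set_mem[_ /ltW].
Qed.

Lemma gain_greedy_ge0 k x : 0 <= gain (greedy k x) x.
Proof. by rewrite -(gain0 x); exact: (gain_greedy_homo x (leq0n k)). Qed.

Lemma gain_greedy_max j k x : Q x -> (j < k)%N -> gain (z j) x <= gain (greedy k x) x.
Proof.
move=> Qx jk; apply: le_trans (gain_greedy_homo x jk) => /=.
case: ifPn => // /negP h; rewrite leNgt; apply/negP => h2; apply: h.
by rewrite inE.
Qed.

Lemma greedy_residual_cvg x (e : R) : Q x -> 0 < e ->
  exists n, forall k, (n <= k)%N -> rdot (V x v) v - gain (greedy k x) x < e.
Proof.
move=> Qx e0; have [lW [C C0 bW] _ _] := dw_W WV x.
have C1 : 0 < C + 1 by rewrite ltr_wpDl.
pose t := Num.min 1 (e / (C + 1)).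
have t0 : 0 < t by rewrite lt_min ltr01 divr_gt0.
have [j hj] := z_dense (V x v) t0; exists j.+1 => k jk.
apply: (@le_lt_trans _ _ (rdot (V x v) v - gain (z j) x)).
  by rewrite lerD2l lerN2; exact: gain_greedy_max.
rewrite -gain_residual; set y := z j - V x v.
have yt : rnorm y < t by rewrite rnormB.
have y0 := rnorm_ge0 y.
apply: (@le_lt_trans _ _ (C * rnorm y * rnorm y)).
  apply: le_trans (ler_norm _) _; apply: le_trans (ler_rdot ip_norm _ _) _.
  by rewrite ler_wpM2r.
have y1 : rnorm y <= 1 by apply: le_trans (ltW yt) _; rewrite ge_min lexx.
have ye : rnorm y < e / (C + 1) by apply: lt_le_trans yt _; rewrite ge_min lexx orbT.
apply: (@le_lt_trans _ _ ((C + 1) * rnorm y)).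
  apply: (@le_trans _ _ (C * rnorm y)); first by rewrite ler_piMr// mulr_ge0.
  by rewrite ler_wpM2r// lerDl.
by rewrite mulrC -ltr_pdivlMr.
Qed.

Lemma tensor_sum_wmeas g : tensor_sum g -> wmeas ip g.
Proof.
move=> [n [f [e [Lf ->]]]]; apply: (wmeas_sum) => i _.
by have [[m1 m2] _ _] := Lf i; apply: wmeasZ => //; exact: wmeas_cst.
Qed.

Lemma greedy_tensor k : tensor_sum (greedy k).
Proof.
have mQ := mS SQ.
have [K cK QK] := grid_sub_compact D_grid (SD SQ).
elim: k => [|k IH]; first exact: tensor_sum0.
set G := [set x | Q x /\ gain (greedy k x) x < gain (z k) x].
have mG : measurable G.
  apply: measurableI => //.
  have m1 := gain_measurable (tensor_sum_wmeas IH).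
  have m2 := gain_measurable (wmeas_cst ip (z k)).
  have := measurable_fun_ltr m1 m2 => /(_ measurableT [set true] I).
  by rewrite setTI.
have GQ : G `<=` Q by move=> x [].
have := tensor_sum_if mG (tensor_sum1 (z k) (Linf0_indic mG cK (subset_trans GQ QK))) IH.
congr tensor_sum; apply/funext => x /=; rewrite -/G indicE.
by case: (x \in G); rewrite ?scale1r.
Qed.

(** The function [V v] is in general not a finite sum of simple tensors, but the greedy
    choices among the terms of a dense sequence are. They converge to it at
    every point, and the squared error decreases from [(V v, v)], which is
    integrable on [Q]: dominated convergence applies. *)
Lemma tensor_approximation (e : R) : 0 < e -> exists g, [/\ tensor_sum g,
  forall x, ~ Q x -> g x = 0,
  forall x, rdot (W x (g x - V x v)) (g x - V x v) <= rdot (V x v) v &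
  \int[mu]_(x in Q) rdot (W x (g x - V x v)) (g x - V x v) <= e].
Proof.
move=> e0; have mQ := mS SQ.
pose r k x := rdot (V x v) v - gain (greedy k x) x.
have mV : measurable_fun setT (fun x => rdot (V x v) v) by exact: (dw_mV WV v v).
have mr k : measurable_fun Q (EFin \o r k).
  apply/measurable_EFinP; apply: measurable_funTS; apply: measurable_funB => //.
  exact: gain_measurable (tensor_sum_wmeas (greedy_tensor k)).
have iV : mu.-integrable Q (fun x => (rdot (V x v) v)%:E).
  exact: (integrable_qform_cst (dual_weightsC WV) v SQ).
have r0 k x : 0 <= r k x by rewrite subr_ge0 gain_le.
have cv x : Q x -> (EFin \o r k) x @[k --> \oo] --> (cst 0 x : \bar R).
  move=> Qx; apply: cvg_EFin; first by apply: filterE.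
  apply/(@cvgrPdist_lt R R^o) => t t0; have [n hn] := greedy_residual_cvg Qx t0.
  exists n => // k /= nk; rewrite sub0r normrN ger0_norm ?r0//; exact: hn.
have dom k x : Q x -> (`|(EFin \o r k) x| <= (rdot (V x v) v)%:E)%E.
  by move=> Qx; rewrite /= lee_fin ger0_norm// lerBlDr lerDl gain_greedy_ge0.
have fV x : Q x -> (rdot (V x v) v)%:E \is a fin_num by [].
have := dominated_cvg mQ mr cv fV iV dom.
rewrite integral0 => /fine_cvgP[_ /(@cvgrPdist_lt R R^o)/(_ e e0)[n _ hn]].
exists (greedy n); split; [exact: greedy_tensor|exact: greedy_supp| |].
  by move=> x; rewrite gain_residual lerBlDr lerDl gain_greedy_ge0.
have := hn n (leqnn n); rewrite /= sub0r normrN => /ltW; apply: le_trans.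
apply: le_trans (ler_norm _); rewrite le_eqVlt; apply/orP; left; apply/eqP.
by apply: eq_Rintegral => x _; rewrite gain_residual.
Qed.

End greedy.

(** * Means of approximating tensors *)

Section mean_limit.
Variables (W V : Rd R d -> H -> H) (A B : set (Rd R d) -> H -> H).
Hypothesis WV : dual_weights W V A B.
Hypothesis tensor_L2 : forall g, tensor_sum g -> in_L2 W g.
Variables (Q : set (Rd R d)) (SQ : S Q) (v : H).
Local Notation m := (fine (mu Q)).

Let mQ : measurable Q. Proof. exact: mS. Qed.
Let m0 : 0 <= m. Proof. exact: fine_ge0. Qed.

(** Young's inequality under the integral, for the difference [g - V v]. *)
Lemma mean_error g e : tensor_sum g ->
    mu.-integrable Q (EFin \o (fun x => rdot (W x (g x - V x v)) (g x - V x v))) ->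
    \int[mu]_(x in Q) rdot (W x (g x - V x v)) (g x - V x v) <= e ->
  forall s w, 0 < s -> 2 * (m * rdot (vavg Q g - B Q v) w) <=
    s * e + s^-1 * (m * rdot (B Q w) w).
Proof.
move=> tg ig ge s w s0; have [mg fg] := tensor_L2 tg.
have iV u : mu.-integrable Q (EFin \o (fun x => rdot (V x u) w)).
  have [K cK QK] := grid_sub_compact D_grid (SD SQ).
  by apply: (@integrableS _ _ _ mu (K : set (Rd R d)) Q _ (compact_borel cK) mQ QK);
    exact: (dw_iV WV).
have igw := integrable_rdot_cube WV w mg fg SQ.
rewrite rdotBl mulrBr (vavg_mu WV mg fg SQ).
rewrite !(dw_avV WV SQ) -RintegralB//; last exact: iV.
have iB : mu.-integrable Q (EFin \o (fun x => rdot (g x) w - rdot (V x v) w)).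
  have -> : EFin \o (fun x => rdot (g x) w - rdot (V x v) w) =
      EFin \o (fun x => rdot (g x) w + (-1) * rdot (V x v) w).
    by apply/funext => x /=; rewrite mulN1r.
  by apply: integrableD_EFin => //; apply: integrableZ_EFin => //; exact: iV.
rewrite -RintegralZl//.
apply: (@le_trans _ _ (\int[mu]_(x in Q) (s * rdot (W x (g x - V x v)) (g x - V x v) +
    s^-1 * rdot (V x w) w))).
  apply: le_Rintegral => //.
  - exact: integrableZ_EFin.
  - apply: integrableD_EFin => //; first exact: integrableZ_EFin.
    by apply: integrableZ_EFin => //; exact: iV.
  - by move=> x _; rewrite -rdotBl; exact: (young_form _ _ (dw_W WV x) (dw_WV WV x) s0).
rewrite RintegralD//; last 2 first.
- exact: integrableZ_EFin.
- by apply: integrableZ_EFin => //; exact: iV.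
rewrite !RintegralZl//; last exact: iV.
by rewrite lerD2r ler_wpM2l// ltW.
Qed.

(** The bound is tested on tensors [g] close to [V v]. Their means are close to
    [B Q v] in the norm of [H], by [mean_error] with [w] the error itself, and
    their squared norms are at most [2 * (m * (B Q v, v))] up to the error. The
    inequality [form_sub_le], used for the form and for the norm, accounts for
    the factor [4]. *)
Lemma mean_form_bound G (c : R) : 0 <= c -> measurable G -> G `<=` Q ->
    (forall g, tensor_sum g -> (forall x, ~ Q x -> g x = 0) ->
      \int[mu]_(x in G) rdot (W x (vavg Q g)) (vavg Q g) <=
      c * \int[mu]_(x in Q) rdot (W x (g x)) (g x)) ->
  \int[mu]_(x in G) rdot (W x (B Q v)) (B Q v) <= 4 * c * (m * rdot (B Q v) v).
Proof.
move=> c0 mG GQ test.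
have [Ka Ka0 hKa] := rposop_bound ip_norm (dw_A WV SQ).
have [Kb Kb0 hKb] := rposop_bound ip_norm (dw_B WV SQ).
have [z hz] := dense_sequence H_sep.
apply: (@le_of_le_add_eps _ _ _ (4 * c + 2 * (Ka * Kb))).
  by rewrite addr_ge0// mulr_ge0// mulr_ge0// ltW.
move=> e e0.
have [g [tg gQ gV ge]] := tensor_approximation WV SQ v hz e0.
have [mg fg] := tensor_L2 tg.
have iVv : mu.-integrable Q (EFin \o (fun x => rdot (V x v) v)).
  exact: (integrable_qform_cst (dual_weightsC WV) v SQ).
have posW x u : 0 <= rdot (W x u) u by case: (dw_W WV x).
have ig : mu.-integrable Q (EFin \o (fun x => rdot (W x (g x - V x v)) (g x - V x v))).
  apply: integrable_le iVv => //.
    apply: measurable_funTS.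
    apply: (qform_measurable WV (f := fun x => g x - V x v)).
    by apply: wmeasD => //; apply: wmeasN; exact: (dw_mV WV).
  by move=> x _; rewrite ger0_norm.
set p := vavg Q g; set y := p - B Q v.
have hy : m * rdot y y <= Kb * e.
  have := mean_error tg ig ge y Kb0; rewrite -/p -/y.
  have h2 : Kb^-1 * (m * rdot (B Q y) y) <= m * rdot y y.
    by rewrite ler_pdivrMl// mulrCA ler_wpM2l.
  move: h2; move: (Kb * e) (Kb^-1 * _) (m * rdot y y) => a1 a2 a3; lra.
have iQ u : mu.-integrable Q (EFin \o (fun x => rdot (W x u) u)).
  exact: (integrable_qform_cst WV u SQ).
have iG u : mu.-integrable G (EFin \o (fun x => rdot (W x u) u)).
  exact: (@integrableS _ _ _ mu Q G _ mQ mG GQ).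
have h1 : \int[mu]_(x in G) rdot (W x (B Q v)) (B Q v) <=
    2 * \int[mu]_(x in G) rdot (W x p) p + 2 * \int[mu]_(x in G) rdot (W x y) y.
  have iG2 u : mu.-integrable G (EFin \o (fun x => 2 * rdot (W x u) u)).
    by apply: integrableZ_EFin => //; exact: iG.
  rewrite -RintegralZl//; last exact: iG.
  rewrite -RintegralZl//; last exact: iG.
  rewrite -RintegralD//; [|exact: iG2|exact: iG2].
  apply: le_Rintegral => //; first exact: iG.
    by apply: integrableD_EFin => //; exact: iG2.
  move=> x _; have := form_sub_le p y (dw_W WV x).
  by rewrite /y opprB addrCA subrr addr0.
have h2 : \int[mu]_(x in G) rdot (W x y) y <= Ka * (m * rdot y y).
  apply: (@le_trans _ _ (\int[mu]_(x in Q) rdot (W x y) y)).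
    rewrite -lee_fin !Rint_EFin//; [|exact: iQ|exact: iG].
    apply: ge0_subset_integral => //; first by have /integrableP[] := iQ y.
    by move=> x _; rewrite lee_fin.
  by rewrite -(dw_avW WV SQ) mulrCA ler_wpM2l.
have h3 : \int[mu]_(x in Q) rdot (W x (g x)) (g x) <= 2 * e + 2 * (m * rdot (B Q v) v).
  apply: (@le_trans _ _ (\int[mu]_(x in Q) (2 * rdot (W x (g x - V x v)) (g x - V x v) +
     2 * rdot (V x v) v))).
    have i2 : mu.-integrable Q (EFin \o (fun x =>
        2 * rdot (W x (g x - V x v)) (g x - V x v) + 2 * rdot (V x v) v)).
      by apply: integrableD_EFin => //; exact: integrableZ_EFin.
    have pw x : rdot (W x (g x)) (g x) <=
        2 * rdot (W x (g x - V x v)) (g x - V x v) + 2 * rdot (V x v) v.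
      have := form_sub_le (g x - V x v) (- V x v) (dw_W WV x).
      rewrite opprK subrK; have [lW _ _ _] := dw_W WV x.
      by rewrite (linN lW) rdotNl rdotNr opprK (dw_WV WV) (rdotC ip v).
    apply: le_Rintegral => //.
    apply: integrable_le i2 => //.
      apply: measurable_funTS; exact: (qform_measurable WV mg).
    by move=> x _; rewrite ger0_norm.
  rewrite RintegralD//; [|exact: integrableZ_EFin|exact: integrableZ_EFin].
  by rewrite !RintegralZl// -(dw_avV WV SQ) lerD2r ler_wpM2l.
have h4 := le_trans (test g tg gQ) (ler_wpM2l c0 h3).
have h5 : Ka * (m * rdot y y) <= Ka * (Kb * e) by rewrite ler_wpM2l// ltW.
apply: le_trans h1 _.
have := le_trans h2 h5; move: h4; rewrite -/p.
move: (\int[mu]_(x in G) _) (\int[mu]_(x in G) _) (m * rdot (B Q v) v) => a1 a2 a3 h4 h6.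
clear -h4 h6; rewrite mulrA in h6.
have -> : 4 * c * a3 + (4 * c + 2 * (Ka * Kb)) * e =
  2 * (c * (2 * e + 2 * a3)) + 2 * (Ka * Kb * e) by ring.
by rewrite lerD// ler_wpM2l.
Qed.

End mean_limit.

(** * Repairing an operator weight on a null set *)

Lemma wmeas_loc (f : Rd R d -> H) : weakly_loc_integrable mu ip f -> wmeas ip f.
Proof.
move=> hf v; apply: compact_measurable_fun => K cK.
by have [/integrableP[/measurable_EFinP h _] _] := hf v K cK.
Qed.

Lemma rposop_id : rposop ip (fun u : H => u).
Proof.
split=> //; first by exists 1 => // u; rewrite mul1r.
exact: rdotii_ge0.
Qed.

Lemma averageE Q (g : Rd R d -> H) v :
  average mu Q (fun x => ip (g x) v) =
  ((fine (mu Q))^-1 * \int[mu]_(x in Q) rdot (g x) v) +i*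
  ((fine (mu Q))^-1 * \int[mu]_(x in Q) rdot (g x) ('i%C *: v)).
Proof.
rewrite /average /cintegral.
have -> : \int[mu]_(x in Q) complex.Im (ip (g x) v) =
    \int[mu]_(x in Q) rdot (g x) ('i%C *: v).
  by apply: eq_Rintegral => x _; rewrite Im_ip.
by simpc.
Qed.

Section average_operator.
Variables (U : Rd R d -> H -> H).
Hypothesis lU : forall x, linear (U x).
Hypothesis U_loc : weakly_loc_integrable_op mu ip D U.
Variable Q : set (Rd R d).
Hypothesis DQ : D Q.
Local Notation m := (fine (mu Q)).

Let mQ : measurable Q. Proof. exact: grid_measurable DQ. Qed.

Lemma op_integrable u v : mu.-integrable Q (EFin \o (fun x => rdot (U x u) v)).
Proof.
have [K cK QK] := grid_sub_compact D_grid DQ.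
have [h _] := (U_loc.1) u v K cK.
apply: (@integrableS _ _ _ mu (K : set (Rd R d)) Q _ _ mQ QK h).
exact: compact_borel.
Qed.

(** Riesz representation; the bound on the form is part of the definition of an
    operator weight. *)
Lemma opaverage_exists : exists A, bounded_op A /\
  forall u v, ip (A u) v = average mu Q (fun x => ip (U x u) v).
Proof.
have [C hC] := U_loc.2 Q DQ.
pose L u v := m^-1 * \int[mu]_(x in Q) rdot (U x u) v.
have m0 : 0 <= m^-1 by rewrite invr_ge0 fine_ge0.
have LC u v : L u v <= m^-1 * `|C| * rnorm u * rnorm v.
  rewrite /L -!mulrA ler_wpM2l//.
  have := hC u v; rewrite !rnormE -!rmorphM/= -mulrA => h.
  apply: (@le_trans _ _ (C * (rnorm u * rnorm v))); last first.
    by rewrite ler_wpM2r ?mulr_ge0 ?rnorm_ge0// ler_norm.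
  rewrite -lecR; apply: le_trans h.
  apply: le_trans (normc_ge_Re _); rewrite lecR /=; exact: ler_norm.
have LDr u v w : L u (v + w) = L u v + L u w.
  rewrite /L -mulrDr -RintegralD//; [|exact: op_integrable|exact: op_integrable].
  by congr (_ * _); apply: eq_Rintegral => x _; rewrite rdotDr.
have LZr r u v : L u (r%:C *: v) = r * L u v.
  rewrite /L mulrCA; congr (_ * _); rewrite -RintegralZl//; last exact: op_integrable.
  by apply: eq_Rintegral => x _; rewrite rdotZr.
have [A hA] : {A : H -> H & forall u v, L u v = rdot (A u) v}.
  apply: (@choice _ _ (fun u e => forall v, L u v = rdot e v)) => u.
  apply: (@riesz_real _ _ _ ip_norm (L u) (m^-1 * `|C| * rnorm u)) => //.
  by rewrite !mulr_ge0 ?rnorm_ge0.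
exists A; split.
  apply/bounded_opP; split.
    move=> a u v; apply: (rdot_inj ip_norm) => w.
    rewrite rdotDl -hA -[a in RHS]conjcK -rdot_adjZ -!hA /L -mulrDr; congr (_ * _).
    rewrite -RintegralD//; [|exact: op_integrable|exact: op_integrable].
    by apply: eq_Rintegral => x _; rewrite lU rdotDl rdot_adjZ conjcK.
  exists (m^-1 * `|C|) => [|u]; first by rewrite mulr_ge0.
  apply: (rnorm_le_rdot ip_norm) => [|v]; first by rewrite !mulr_ge0 ?rnorm_ge0.
  by rewrite -hA LC.
by move=> u v; rewrite averageE ipE -!hA.
Qed.

Lemma opaverageP : bounded_op (opaverage mu ip U Q) /\
  forall u v, rdot (opaverage mu ip U Q u) v =
    m^-1 * \int[mu]_(x in Q) rdot (U x u) v.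
Proof.
have [A hA] := opaverage_exists.
have [b h] : [set A | bounded_op A /\
    forall u v, ip (A u) v = average mu Q (fun x => ip (U x u) v)] (opaverage mu ip U Q).
  by apply: xgetPex; exists A.
by split=> // u v; rewrite /re_dot h averageE.
Qed.

End average_operator.

Section operator_weight.
Variables (W : Rd R d -> H -> H).
Hypothesis W_weight : operator_weight mu ip D W.

Lemma bad_set : exists N, [/\ measurable N, mu N = 0%E &
  forall x, ~ N x -> rposop ip (W x) /\ invertible_op (W x)].
Proof.
have [_ [N [mN N0 hN]] _ _ _] := W_weight.
exists N; split=> // x nNx.
have : ~ ~ (positive_op ip (W x) /\ invertible_op (W x)).
  by move=> h; apply/nNx/hN.
by move=> /contrapT[/positive_opP].
Qed.

Variable N : set (Rd R d).
Hypotheses (mN : measurable N) (N0 : mu N = 0%E).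
Hypothesis hN : forall x, ~ N x -> rposop ip (W x) /\ invertible_op (W x).

(** Off a null set [N] the weight is positive and invertible; the identity
    replaces it on [N], and the repaired weight and the repaired inverse are
    mutually inverse at every point. *)
Definition repaired (U : Rd R d -> H -> H) x u := if x \in N then u else U x u.

Let V x := opinv (W x).

Lemma repaired_off U x : ~ N x -> repaired U x = U x.
Proof. by move=> nN; apply/funext => u; rewrite /repaired memNset. Qed.

Lemma repaired_on U x : N x -> repaired U x = id.
Proof. by move=> Nx; apply/funext => u; rewrite /repaired mem_set. Qed.

Lemma repaired_wmeas U u : (forall u v, loc_integrable mu (fun x => ip (U x u) v)) ->
  wmeas ip (fun x => repaired U x u).
Proof.
move=> hU v.
have mU : measurable_fun setT (fun x => rdot (U x u) v).
  by apply: (wmeas_loc (f := fun x => U x u)) => w; exact: hU.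
rewrite (_ : (fun _ => _) = (fun x => \1_N x * rdot u v + (1 - \1_N x) * rdot (U x u) v)).
  have mI : measurable_fun setT (\1_N : Rd R d -> R) by apply: measurable_indic.
  apply: measurable_funD; apply: measurable_funM => //.
  exact: measurable_funB.
apply/funext => x; rewrite /repaired indicE.
by case: (x \in N); rewrite ?mul1r ?subrr ?mul0r ?subr0 ?addr0 ?add0r ?mul1r.
Qed.

Lemma repaired_integrable U (K : set 'rV[R]_d) u v :
    (forall u v, loc_integrable mu (fun x => ip (U x u) v)) -> compact K ->
  mu.-integrable K (EFin \o (fun x => rdot (repaired U x u) v)).
Proof.
move=> hU cK; have mK := compact_borel cK.
have [iU _] := hU u v K cK.
have := integrableD_EFin mK (integrable_cst_fin `|rdot u v| mK (compact_measure_lty mu_lf cK))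
  (integrable_norm iU).
have mr := repaired_wmeas u hU v.
apply: integrable_le => //; first exact: measurable_funTS.
move=> x _ /=; rewrite /repaired /re_dot; case: (x \in N).
  by rewrite lerDl.
by rewrite lerDr.
Qed.

Lemma repaired_integral U Q u v : D Q ->
    (forall u v, loc_integrable mu (fun x => ip (U x u) v)) ->
  \int[mu]_(x in Q) rdot (repaired U x u) v = \int[mu]_(x in Q) rdot (U x u) v.
Proof.
move=> DQ hU; apply: (Rintegral_off_null mN N0).
- exact: grid_measurable DQ.
- by apply: measurable_funTS; exact: (repaired_wmeas u hU v).
- by apply: measurable_funTS; apply: (wmeas_loc (f := fun x => U x u)) => w; exact: hU.
- by move=> x /repaired_off->.
Qed.

Lemma repaired_rposop x : rposop ip (repaired W x) /\ rposop ip (repaired V x).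
Proof.
have [Nx|nNx] := pselect (N x).
  by rewrite !repaired_on//; split; exact: rposop_id.
by rewrite !repaired_off//; have [pW iW] := hN nNx; have [pV _ _] := opinvP pW iW.
Qed.

Lemma average_rposop U Q : D Q -> (forall x, linear (U x)) ->
    weakly_loc_integrable_op mu ip D U -> (forall x, rposop ip (repaired U x)) ->
  rposop ip (opaverage mu ip U Q).
Proof.
move=> DQ lU hU pU.
have [/bounded_opP[lA bA] hA] := opaverageP lU hU DQ.
have {}hA u v : rdot (opaverage mu ip U Q u) v =
    (fine (mu Q))^-1 * \int[mu]_(x in Q) rdot (repaired U x u) v.
  by rewrite hA repaired_integral//; case: hU.
split=> //.
- move=> u v; rewrite [RHS]rdotC !hA; congr (_ * _); apply: eq_Rintegral => x _.
  by have [_ _ sU _] := pU x; rewrite sU rdotC.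
- move=> u; rewrite hA; apply: mulr_ge0; first by rewrite invr_ge0 fine_ge0.
  by apply: Rintegral_ge0 => x _; case: (pU x) => _ _ _; apply.
Qed.

Lemma average_integral U Q u v : D Q -> (forall x, linear (U x)) ->
    weakly_loc_integrable_op mu ip D U ->
  fine (mu Q) * rdot (opaverage mu ip U Q u) v = \int[mu]_(x in Q) rdot (repaired U x u) v.
Proof.
move=> DQ lU hU; have [_ ->] := opaverageP lU hU DQ.
rewrite repaired_integral//; last by case: hU.
have finQ : mu Q \is a fin_num by rewrite ge0_fin_numE// (grid_finite mu_lf D_grid).
have [m0|mN0] := eqVneq (fine (mu Q)) 0; last by rewrite mulrA divff// mul1r.
rewrite m0 mul0r /Rintegral null_set_integral//.
- exact: grid_measurable DQ.
- by apply: measurable_int; exact: (op_integrable hU DQ).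
- by rewrite -(fineK finQ) m0.
Qed.

(** Changing the weight on a null set does not change its averages. *)
Lemma weight_dual :
  dual_weights (repaired W) (repaired V)
    (opaverage mu ip W) (opaverage mu ip (fun x => opinv (W x))).
Proof.
have [bW _ _ lW lV] := W_weight.
have linW x : linear (W x) by case: (bW x).
have linV x : linear (opinv (W x)) by case: (opinv_bounded (W x)).
split.
- by move=> x; have [] := repaired_rposop x.
- by move=> x; have [] := repaired_rposop x.
- move=> x u; have [Nx|nNx] := pselect (N x); first by rewrite !repaired_on.
  by rewrite !repaired_off//; have [pW iW] := hN nNx; have [_ h _] := opinvP pW iW; exact: h.
- move=> x u; have [Nx|nNx] := pselect (N x); first by rewrite !repaired_on.
  by rewrite !repaired_off//; have [pW iW] := hN nNx; have [_ _ h] := opinvP pW iW; exact: h.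
- by move=> u; apply: repaired_wmeas; case: lW.
- by move=> u; apply: repaired_wmeas; case: lV.
- by move=> K cK u v; apply: repaired_integrable => //; case: lW.
- by move=> K cK u v; apply: repaired_integrable => //; case: lV.
- move=> Q /SD DQ; apply: average_rposop => // x; by case: (repaired_rposop x).
- move=> Q /SD DQ; apply: average_rposop => // x; by case: (repaired_rposop x).
- by move=> Q /SD DQ u v; rewrite average_integral.
- by move=> Q /SD DQ u v; rewrite average_integral.
Qed.

Let WV := weight_dual.
Local Notation W' := (repaired W).
Local Notation A := (opaverage mu ip W).
Local Notation B := (opaverage mu ip (fun x => opinv (W x))).

(** On [N] the square root of [W x] is arbitrary and need not depend measurably
    on [x], hence [ge0_integral_off_null]. *)
Lemma sqnormL2E (f : Rd R d -> H) : wmeas ip f ->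
  sqnormL2 mu ip W f = (\int[mu]_x (qform (repaired W) f x)%:E)%E.
Proof.
move=> mf; apply: (ge0_integral_off_null mN N0).
- by move=> x; rewrite sqr_ge0.
- by move=> x; exact: (qform_ge0 WV).
- exact: (qform_measurable WV).
move=> x nNx; have [pW _] := hN nNx; have [pS SS] := opsqrtP ip_norm pW.
rewrite /qform repaired_off// -(rdotii ip_norm) -SS.
by have [_ _ sS _] := pS; rewrite [RHS]sS.
Qed.

Lemma L2E (f : Rd R d -> H) : L2 mu ip W f <-> in_L2 (repaired W) f.
Proof.
split=> [[hf ff]|[mf ff]].
  by have mf := wmeas_loc hf; split=> //; rewrite -sqnormL2E.
split; last by rewrite sqnormL2E.
move=> v K cK; split.
  exact: (integrable_rdot WV v mf ff cK).
rewrite (_ : (fun _ => _) = EFin \o (fun x => rdot (f x) ('i%C *: v))).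
  exact: (integrable_rdot WV _ mf ff cK).
by apply/funext => x /=; rewrite Im_ip.
Qed.

(** * Unordered sums along an enumeration *)

Section unordered_sums.
Local Notation T := (Rd R d).
Variable q : nat -> set T.
Hypothesis q_inj : forall i j, S (q i) -> q i = q j -> i = j.
Hypothesis q_surj : forall P, S P -> exists i, q i = P.

Lemma mem_qlist n i : (i < n)%N -> S (q i) -> q i \in qlist q n.
Proof.
move=> ni Sq; apply: map_f; rewrite mem_filter mem_iota add0n ni andbT leq0n andbT.
exact/asboolP.
Qed.

Lemma qlist_sub_le k n P : (k <= n)%N -> P \in qlist q k -> P \in qlist q n.
Proof.
elim: n => [|n IH]; first by rewrite leqn0 => /eqP->.
rewrite leq_eqVlt => /orP[/eqP->//|]; rewrite ltnS => /IH h /h.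
by rewrite qlistS mem_cat => ->.
Qed.

Lemma qlist_cover (A : seq (set T)) k : exists2 n, (k <= n)%N &
  forall P, P \in A -> S P -> P \in qlist q n.
Proof.
elim: A => [|P A [n kn hn]]; first by exists k.
have [SP|nSP] := pselect (S P); last first.
  exists n => // P'; rewrite in_cons => /orP[/eqP->//|]; exact: hn.
have [i qi] := q_surj SP.
exists (maxn n i.+1); first by rewrite (leq_trans kn)// leq_maxl.
move=> P'; rewrite in_cons => /orP[/eqP-> _|P'A SP'].
  by rewrite -qi mem_qlist// ?qi// leq_maxr.
by apply: (@qlist_sub_le n); [rewrite leq_maxl|exact: hn].
Qed.

Lemma qlist_cat k n : (k <= n)%N -> exists r, qlist q n = qlist q k ++ r.
Proof.
elim: n => [|n IH]; first by rewrite leqn0 => /eqP->; exists [::]; rewrite cats0.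
rewrite leq_eqVlt => /orP[/eqP->|]; first by exists [::]; rewrite cats0.
by rewrite ltnS => /IH[r hr]; rewrite qlistS hr -catA; eexists.
Qed.

(** An absolutely convergent series is summed in any order: finite sets that
    contain enough terms of the enumeration differ from its partial sums by a
    tail of the absolute series. *)
Lemma unordered_sum (t : set T -> R[i]) (c : R[i]) (K : R) :
    (forall P, ~ S P -> t P = 0) ->
    (forall n, \sum_(P <- qlist q n) complex.Re `|t P| <= K) ->
    (forall e : R, 0 < e -> exists k, forall n, (k <= n)%N ->
       complex.Re `|\sum_(P <- qlist q n) t P - c| < e) ->
  summability.sum (t : set T -> R[i]^o) = c.
Proof.
have TF := @summability.totally_filter (set T).
move=> tS tK tc; apply: (@cvg_lim R[i]^o); [exact: norm_hausdorff|].
apply/(@cvgrPdist_lt R[i] R[i]^o) => e e0; have [r r0 er] := ltc0_real e0.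
have r2 : 0 < r / 2 by rewrite divr_gt0.
have [k1 hk1] := tc _ r2.
pose TT n := \sum_(P <- qlist q n) complex.Re `|t P|.
have n0 P : 0 <= complex.Re `|t P| by rewrite normc_def/= sqrtr_ge0.
have tS' n : TT n <= TT n.+1.
  by rewrite /TT qlistS big_cat/= lerDl; apply: sumr_ge0 => P _; exact: n0.
have [k2 hk2] := nondecreasing_bounded_cauchy tS' tK r2.
pose k := maxn k1 k2.
have k1k : (k1 <= k)%N by exact: leq_maxl.
have k2k : (k2 <= k)%N by exact: leq_maxr.
exists (finmap.seq_fset tt (qlist q k)) => // A kA0.
pose EA := finmap.enum_fset A.
have kA P : P \in qlist q k -> P \in EA.
  move=> Pk; have /finmap.fsubsetP := kA0; apply.
  by rewrite (finmap.seq_fsetE tt (qlist q k) P).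
have [n kn hn] := qlist_cover EA k.
have -> : summability.partial_sum (t : set T -> R[i]^o) A =
    \sum_(P <- qlist q n | P \in EA) t P.
  rewrite /summability.partial_sum -(finmap.big_seq_fsetE _ _ xpredT t)/=.
  rewrite (bigID (fun P => `[< S P >]))/= [X in _ + X]big1 ?addr0; last first.
    by move=> P /asboolP; exact: tS.
  rewrite -big_filter -[RHS]big_filter; apply: perm_big; apply: uniq_perm.
  - by apply: filter_uniq; exact: finmap.fset_uniq.
  - by apply: filter_uniq; exact: qlist_uniq.
  move=> P; rewrite !mem_filter; apply/andP/andP => -[h1 h2]; split=> //.
    by apply: hn => //; exact/asboolP.
  by apply/asboolP; exact: (qlist_sub h2).
rewrite er.
have sn : \sum_(P <- qlist q n) t P =
    \sum_(P <- qlist q n | P \in EA) t P + \sum_(P <- qlist q n | P \notin EA) t P.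
  by rewrite (bigID (fun P => P \in EA)).
have tail : complex.Re `|\sum_(P <- qlist q n | P \notin EA) t P| < r / 2.
  apply: le_lt_trans (cnorm_sum _ _ _) _.
  apply: le_lt_trans (hk2 n (leq_trans k2k kn)).
  have [l hl] := qlist_cat kn.
  apply: (@le_trans _ _ (TT n - TT k)).
    rewrite /TT hl !big_cat/= [X in _ <= X - _]addrC addrK.
    rewrite big_seq_cond big1 ?add0r; last by move=> P /andP[/kA ->].
    by rewrite big_mkcond; apply: ler_sum => P _; case: ifP => // _; exact: n0.
  by rewrite lerB//; apply: (homo_leq (@lexx _ _) le_trans tS').
have := hk1 n (leq_trans k1k kn); rewrite sn => h.
set z := \sum_(P <- _ | _) _ in h *; set w := \sum_(P <- _ | _) _ in h tail.
have : `|c - z| <= `|z + w - c| + `|w|.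
  have -> : c - z = w - (z + w - c).
    by rewrite opprB addrCA opprD; congr (_ + _); rewrite addrCA subrr addr0.
  by rewrite [leRHS]addrC ler_normB.
rewrite [in leRHS]cnormE [X in _ <= _ + X]cnormE -rmorphD => /le_lt_trans; apply.
by rewrite ltcR [ltRHS](splitr r) ltrD.
Qed.

End unordered_sums.

(** * The Lerner series on simple tensors *)

(** [f] is bounded and lives on a compact set, where [(W x e, e)] is
    integrable. *)
Lemma tensor_in_L2 f (e : H) : Linf0 mu f -> in_L2 W' (fun x => f x *: e).
Proof.
move=> [mf [M hM] [K [cK fK]]]; have [m1 m2] := mf.
have mfe : wmeas ip (fun x => f x *: e) by apply: wmeasZ => //; exact: wmeas_cst.
split=> //.
have mK := compact_borel cK.
have iK := dw_iW WV cK e e.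
have iK' : (\int[mu]_x (\1_(K : set (Rd R d)) x * rdot (W' x e) e)%:E < +oo)%E.
  rewrite -integral_1//.
  have finI := integrable_fin_num mK iK.
  by move: finI; rewrite ge0_fin_numE//; apply: integral_ge0 => x _;
    rewrite lee_fin (qform_ge0 WV (fun=> e)).
pose C : R := M ^+ 2.
have C0 : 0 <= C by exact: sqr_ge0.
have q0 x : 0 <= rdot (W' x e) e by exact: (qform_ge0 WV (fun=> e)).
have mq : measurable_fun setT (fun x => \1_(K : set (Rd R d)) x * rdot (W' x e) e).
  apply: measurable_funM; first by apply: measurable_indic.
  exact: (qform_measurable WV (wmeas_cst ip e)).
apply: (@le_lt_trans _ _ (\int[mu]_x (C%:E * (\1_(K : set (Rd R d)) x * rdot (W' x e) e)%:E))%E).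
  apply: ae_ge0_le_integral => //.
  - by move=> x _; rewrite lee_fin (qform_ge0 WV).
  - by apply/measurable_EFinP; exact: (qform_measurable WV).
  - move=> x _; rewrite -EFinM lee_fin; apply: mulr_ge0 => //.
    by apply: mulr_ge0 => //; rewrite indicE ler0n.
  - by apply: measurable_funeM; exact/measurable_EFinP.
  apply: filterS hM => x fM _; rewrite -EFinM lee_fin /qform (form_scale (dw_W WV x)).
  rewrite mulrA ler_wpM2r// indicE; case: (boolP (x \in (K : set (Rd R d)))) => xK.
    rewrite mulr1 /C; move: fM; rewrite cnormE lecR => fM.
    have n0 : 0 <= complex.Re `|f x| by rewrite normc_def/= sqrtr_ge0.
    by rewrite ler_pXn2r ?nnegrE// (le_trans n0).
  have -> : f x = 0 by apply: fK => /mem_set; exact/negP.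
  by rewrite normr0 /= expr0n/= mulr0.
rewrite ge0_integralZl//; last 2 first.
- exact/measurable_EFinP.
- by move=> x _; rewrite lee_fin; apply: mulr_ge0 => //; rewrite indicE ler0n.
by apply: lte_mul_pinfty.
Qed.

Section clean_symbols.
Variables psi phi : set (Rd R d) -> Rd R d -> R[i].
Hypothesis mphi : forall Q, S Q -> cmeasurable (phi Q).
Hypothesis phi1 : forall Q x, S Q -> complex.Re `|phi Q x| <= 1.

Lemma rdot_i u : rdot u ('i%C *: u) = 0.
Proof. by rewrite -Im_ip ip_norm rnormE -rmorphXn/=. Qed.

(** The scalar integrals are read off the weak mean by testing against [e] and
    ['i *: e], so the integrability of [phi Q y * f y] follows from that of the
    vector function. *)
Lemma mean_tensor f (e : H) Q : S Q -> cmeasurable f ->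
    in_L2 W' (fun x => f x *: e) ->
  mean phi (fun x => f x *: e) Q = average mu Q (fun y => phi Q y * f y) *: e.
Proof.
move=> SQ mf fL2; have DQ := SD SQ.
have mQ : measurable Q by exact: grid_measurable DQ.
have gL2 := in_L2_phi WV mphi phi1 fL2 SQ.
have [mg fg] := gL2.
have iQ v := integrable_rdot_cube WV v mg fg SQ.
pose h x := phi Q x * f x.
have hE x v : rdot (phi Q x *: (f x *: e)) v =
    complex.Re (h x) * rdot e v - complex.Im (h x) * rdot e ('i%C *: v).
  by rewrite scalerA rdotZC.
apply: (rdot_inj ip_norm) => v.
rewrite /mean (vavgE WV mg fg SQ).
have [e0|eN0] := eqVneq e 0.
  rewrite e0 scaler0 rdot0l /Rintegral.
  under eq_integral do rewrite scaler0 scaler0 rdot0l.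
  by rewrite integral0 mulr0.
have ne : rdot e e != 0 by rewrite rdotii// sqrf_eq0 rnorm_eq0.
have iRe : mu.-integrable Q (EFin \o (fun x => complex.Re (h x))).
  have := integrableZ_EFin mQ (rdot e e)^-1 (iQ e).
  rewrite (_ : (fun x => _ * _) = (fun x => complex.Re (h x)))//.
  by apply/funext => x; rewrite hE rdot_i mulr0 subr0 mulrC mulfK.
have iIm : mu.-integrable Q (EFin \o (fun x => complex.Im (h x))).
  have := integrableZ_EFin mQ (rdot e e)^-1 (iQ ('i%C *: e)).
  rewrite (_ : (fun x => _ * _) = (fun x => complex.Im (h x)))//.
  apply/funext => x; rewrite hE rdot_i mulr0 sub0r scalerA.
  have -> : 'i%C * 'i%C = (-1)%:C :> R[i] by simpc.
  by rewrite (rdotZr _ (-1)) mulN1r !mulrN opprK mulrC mulfK.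
have -> : \int[mu]_(x in Q) rdot (phi Q x *: (f x *: e)) v =
    rdot e v * \int[mu]_(x in Q) complex.Re (h x) -
    rdot e ('i%C *: v) * \int[mu]_(x in Q) complex.Im (h x).
  rewrite -!RintegralZl// -RintegralB//; [|exact: integrableZ_EFin|exact: integrableZ_EFin].
  by apply: eq_Rintegral => x _; rewrite hE mulrC [X in _ - X]mulrC.
rewrite rdotZC /average /cintegral /h.
move: (\int[mu]_(x in Q) _) (\int[mu]_(x in Q) _) (fine _)^-1 => a b m.
by simpc; rewrite /=; ring.
Qed.

End clean_symbols.

Lemma average_trunc f phi Q : S Q -> cmeasurable f -> cmeasurable phi ->
    {ae mu, forall x, `|phi x| <= 1} ->
  average mu Q (fun y => trunc phi y * f y) = average mu Q (fun y => phi y * f y).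
Proof.
move=> SQ mf mphi ae1; have mQ := mS SQ.
have [a1 a2] := cmeasurableM (trunc_measurable mphi) mf.
have [b1 b2] := cmeasurableM mphi mf.
rewrite /average /cintegral; congr (_ * (_ +i* _)); congr fine; apply: ae_eq_integral => //.
- by apply/measurable_EFinP; exact: measurable_funTS.
- by apply/measurable_EFinP; exact: measurable_funTS.
- by apply: filterS ae1 => x h _; rewrite trunc_id.
- by apply/measurable_EFinP; exact: measurable_funTS.
- by apply/measurable_EFinP; exact: measurable_funTS.
- by apply: filterS ae1 => x h _; rewrite trunc_id.
Qed.

Section admissible_symbols.
Variable M : R.
Hypothesis M0 : 0 <= M.
Hypotheses (hAB : A2_form A B M) (hBA : A2_form B A M).

Variables psi phi : set (Rd R d) -> Rd R d -> R[i].
Hypotheses (apsi : admissible mu S psi) (aphi : admissible mu S phi).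
Variable q : nat -> set (Rd R d).
Hypothesis q_inj : forall i j, S (q i) -> q i = q j -> i = j.
Hypothesis q_surj : forall P, S P -> exists i, q i = P.

Let psi' Q := trunc (psi Q).
Let phi' Q := trunc (phi Q).

Let mphi' Q : S Q -> cmeasurable (phi' Q).
Proof. by move=> /aphi[h _ _]; exact: trunc_measurable. Qed.
Let phi1' Q x : S Q -> complex.Re `|phi' Q x| <= 1.
Proof. by move=> _; exact: trunc_le1. Qed.
Let psi1' Q x : S Q -> complex.Re `|psi' Q x| <= \1_Q x.
Proof. by move=> /apsi[_ h _]; exact: trunc_supp. Qed.

Definition sparse_op := lop (fun Q => trunc (psi Q)) (fun Q => trunc (phi Q)) q.

Let conv_ae f : in_L2 W' f -> {ae mu, forall x, lconv psi' phi' q f x}.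
Proof.
exact: (lconv_ae WV M0 hAB hBA mphi' phi1' psi1' q_inj).
Qed.

(** At almost every point the vector series converges absolutely and, when
    [e != 0], dividing by [|e|] transfers this to the scalar series; the
    unordered sum is then the limit along the enumeration [q]. *)
Lemma lerner_tensor f (e : H) : Linf0 mu f ->
  {ae mu, forall x, sparse_op (fun y => f y *: e) x = lerner mu S psi phi f x *: e}.
Proof.
move=> Lf; have fL2 := tensor_in_L2 e Lf; have [mf _ _] := Lf.
have aepsi : {ae mu, forall x, forall n, S (q n) -> `|psi (q n) x| <= 1}.
  apply: ae_foralln => n; have [Sq|nSq] := pselect (S (q n)).
    by have [_ _ h] := apsi Sq; apply: filterS h.
  by apply: filterE.
apply: filterS2 (conv_ae fL2) aepsi => x cx px.
pose t P : R[i] := if P \in S then psi P x * average mu P (fun y => phi P y * f y) else 0.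
have lt n : lterm psi' phi' q (fun y => f y *: e) n x = t (q n) *: e.
  rewrite /lterm /t; case: asboolP => Sq; last by rewrite memNset// scale0r.
  rewrite mem_set// (mean_tensor mphi' phi1' Sq mf fL2).
  have [mp _ hp] := aphi Sq.
  by rewrite average_trunc// /psi' trunc_id ?px// scalerA.
have hl := lop_cvg cx; rewrite -/sparse_op -/(sparse_op _) in hl.
set l := sparse_op _ x in hl *.
have [e0|eN0] := eqVneq e 0.
  rewrite e0 scaler0; apply: (hcvg_uniq ip_norm hl) => r r0; exists 0%N => n _.
  rewrite big1 ?subr0 ?rnorm0// => i _; by rewrite lt e0 scaler0.
have ne : 0 < rnorm e by rewrite lt_def rnorm_eq0 eN0 rnorm_ge0.
have iee : ip e e != 0 by rewrite ip_norm sqrf_eq0 normr_eq0.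
(* The coordinate of the vector sum along [e]. *)
pose c := ip l e / ip e e.
have sumE n : \sum_(P <- qlist q n) t P = \sum_(i < n) t (q i).
  rewrite qlist_sum; apply: eq_bigr => i _; case: asboolP => // nS.
  by rewrite /t memNset.
have diff n : complex.Re `|\sum_(P <- qlist q n) t P - c| * rnorm e <=
    rnorm (\sum_(i < n) lterm psi' phi' q (fun y => f y *: e) i x - l).
  rewrite sumE; under [in leRHS]eq_bigr do rewrite lt.
  rewrite -scaler_suml; set s := \sum_(i < n) _.
  have h : (s - c) * ip e e = ip (s *: e - l) e.
    by rewrite mulrBl /c divfK// ipDl ipZl -[- l]scaleN1r ipZl mulN1r.
  have h2 : complex.Re `|s - c| * rnorm e ^+ 2 = complex.Re `|ip (s *: e - l) e|.
    rewrite -h normrM ip_norm; have -> : `| `|e| ^+ 2 | = (rnorm e ^+ 2)%:C.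
      by rewrite rnormE -rmorphXn/= normcR ger0_norm ?sqr_ge0.
    by rewrite [`|s - c|]cnormE -rmorphM.
  rewrite -(ler_pM2r ne) -mulrA -expr2 h2.
  exact: ip_CS.
rewrite /lerner (_ : summability.sum _ = c).
  apply: (hcvg_uniq ip_norm hl) => r r0; have [k hk] := hl r r0; exists k => n kn.
  have sE : \sum_(i < n) lterm psi' phi' q (fun y => f y *: e) i x =
      (\sum_(P <- qlist q n) t P) *: e.
    by rewrite sumE scaler_suml; apply: eq_bigr => i _; rewrite lt.
  by rewrite sE -scalerBl rnormZ; apply: le_lt_trans (diff n) (hk n kn).
have [K hK] := cx.
apply: (unordered_sum q_inj q_surj (K := K%:R / rnorm e)).
- by move=> P nP; rewrite memNset.
- move=> n; rewrite ler_pdivlMr// mulr_suml qlist_sum.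
  apply: le_trans (hK n); apply: ler_sum => i _; rewrite lt rnormZ.
  by case: asboolP => // _; rewrite mulr_ge0 ?rnorm_ge0// normc_def/= sqrtr_ge0.
move=> r r0; have [k hk] := hl _ (mulr_gt0 r0 ne); exists k => n kn.
by rewrite -(ltr_pM2r ne); apply: le_lt_trans (diff n) (hk n kn).
Qed.

End admissible_symbols.

(** * The upper bound *)

Lemma sqnormL2_ge0 f : (0 <= sqnormL2 mu ip W f)%E.
Proof. by apply: integral_ge0 => x _; rewrite lee_fin sqr_ge0. Qed.

Section form_bound.
Variable M : R.
Hypothesis M0 : 0 <= M.
Hypotheses (hAB : A2_form A B M) (hBA : A2_form B A M).

(** The series [lop] is bounded by [lop_bound], linear almost everywhere by
    [lop_lin], and extends the tensor product by induction on the number of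
    simple tensors. *)
Lemma lerner_extension psi phi : admissible mu S psi -> admissible mu S phi ->
  exists E, [/\ boundedL2 mu ip W E, extends_tensor mu (lerner mu S psi phi) E &
    (opnormL2 mu ip W E <= ((upper_const M) `^ 2^-1)%:E)%E].
Proof.
move=> apsi aphi.
have [Dc _ _ _] := D_grid.
have Sc : countable S by apply: sub_countable Dc; exact: subset_card_le.
have S0 : ~ S set0 by move=> /SD /(grid_neq0 D_grid)[].
have [q [_ q_inj q_surj]] := countable_enum Sc S0.
have K0 := upper_const_ge0 M0.
pose psi' Q := trunc (psi Q); pose phi' Q := trunc (phi Q).
have mphi Q : S Q -> cmeasurable (phi' Q).
  by move=> /aphi[h _ _]; exact: trunc_measurable.
have mpsi Q : S Q -> cmeasurable (psi' Q).
  by move=> /apsi[h _ _]; exact: trunc_measurable.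
have phi1 Q x : S Q -> complex.Re `|phi' Q x| <= 1 by move=> _; exact: trunc_le1.
have psi1 Q x : S Q -> complex.Re `|psi' Q x| <= \1_Q x.
  by move=> /apsi[_ h _]; exact: trunc_supp.
pose E := sparse_op psi phi q.
have mE f : wmeas ip (E f) by exact: (lop_wmeas phi' mpsi q f).
have bE f : in_L2 (repaired W) f ->
    (sqnormL2 mu ip W (E f) <= (upper_const M)%:E * sqnormL2 mu ip W f)%E.
  move=> fL2; rewrite (sqnormL2E (mE f)).
  rewrite (sqnormL2E fL2.1).
  exact: (lop_bound WV M0 hAB hBA
    mphi phi1 mpsi psi1 q_inj fL2).
have nE f : L2 mu ip W f ->
    (normL2 mu ip W (E f) <= ((upper_const M) `^ 2^-1)%:E * normL2 mu ip W f)%E.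
  by move=> /L2E fL2; apply: poweR_half_le; rewrite ?sqnormL2_ge0//; exact: bE.
have linE a f g : in_L2 (repaired W) f -> in_L2 (repaired W) g ->
    {ae mu, forall x, E (fun y => a *: f y + g y) x = a *: E f x + E g x}.
  exact: (lop_lin WV M0 hAB hBA
    mphi phi1 psi1 q_inj a).
exists E; split.
- split.
  + move=> f fL2; apply/L2E; split; first exact: mE.
    rewrite -(sqnormL2E (mE f)).
    apply: le_lt_trans (bE f _) _; first exact/L2E.
    by apply: lte_mul_pinfty => //; case: fL2.
  + by move=> a f g /L2E fL2 /L2E gL2; exact: linE.
  + by exists (upper_const M `^ 2^-1).
- have zL2 : in_L2 (repaired W) (fun=> 0).
    split; first exact: wmeas_cst.
    rewrite (_ : (fun _ => _) = fun=> 0%E) ?integral0//.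
    by apply/funext => x; rewrite /qform rdot0r.
  suff h n (f : 'I_n -> Rd R d -> R[i]) (e : 'I_n -> H) : (forall i, Linf0 mu (f i)) ->
      in_L2 (repaired W) (fun y => \sum_(i < n) f i y *: e i) /\
      {ae mu, forall x, E (fun y => \sum_(i < n) f i y *: e i) x =
        \sum_(i < n) lerner mu S psi phi (f i) x *: e i}.
    by move=> n f e /(h n f e)[].
  elim: n => [|n IH] in f e *.
    move=> _; have -> : (fun y => \sum_(i < 0) f i y *: e i) = fun=> 0.
      by apply/funext => y; rewrite big_ord0.
    split=> //; have := linE (-1) _ _ zL2 zL2.
    have -> : (fun y : Rd R d => -1 *: (0 : H) + 0) = fun=> 0.
      by apply/funext => y; rewrite scaler0 addr0.
    by apply: filterS => x ->; rewrite big_ord0 scaleN1r addNr.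
  move=> hf; have [IH1 IH2] := IH (fun i => f (widen_ord (leqnSn n) i))
    (fun i => e (widen_ord (leqnSn n) i)) (fun i => hf _).
  have tL2 := tensor_in_L2 (e ord_max) (hf ord_max).
  have -> : (fun y => \sum_(i < n.+1) f i y *: e i) = (fun y => 1 *: (f ord_max y *: e ord_max) +
      \sum_(i < n) f (widen_ord (leqnSn n) i) y *: e (widen_ord (leqnSn n) i)).
    by apply/funext => y; rewrite big_ord_recr/= addrC scale1r.
  split; first exact: (in_L2_lin WV).
  have h2 := lerner_tensor M0
    hAB hBA apsi aphi q_inj q_surj (e ord_max) (hf ord_max).
  have h1 := linE 1 _ _ tL2 IH1.
  apply: filterS3 h1 IH2 h2 => x -> -> e2.
  by rewrite scale1r big_ord_recr/= addrC /E e2.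
- apply: ge_ereal_sup => _ [f /= [fL2 f1] <-].
  apply: le_trans (nE f fL2) _; rewrite -[leRHS]mule1 lee_wpmul2l//.
  by rewrite lee_fin powR_ge0.
Qed.

End form_bound.

Local Notation A2 := (A2_char mu ip S W).

Lemma averages_rposop Q : S Q -> rposop ip (A Q) /\ rposop ip (B Q).
Proof.
move=> SQ; by split; [exact: (dw_A WV)|exact: (dw_B WV)].
Qed.

Lemma A2_char_ge0 : (0 <= A2)%E.
Proof. by apply: ereal_sup_ubound; left. Qed.

Lemma sqrt_comp_linear Q : S Q -> linear (opsqrt ip (A Q) \o opsqrt ip (B Q)).
Proof.
move=> /averages_rposop[pA pB] a u v /=.
have [[lX _ _ _] _] := opsqrtP ip_norm pB; have [[lY _ _ _] _] := opsqrtP ip_norm pA.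
by rewrite lX lY.
Qed.

Lemma A2_class_form : A2_class mu ip S W ->
  A2_form A B (fine A2) /\ A2_form B A (fine A2).
Proof.
rewrite /A2_class => fA; have M0 : 0 <= fine A2 by rewrite fine_ge0 ?A2_char_ge0.
have A2E : A2 = (fine A2)%:E by rewrite fineK// ge0_fin_numE ?A2_char_ge0.
have h Q : S Q -> forall u, rnorm (opsqrt ip (A Q) (opsqrt ip (B Q) u)) ^+ 2 <=
    fine A2 * rnorm u ^+ 2.
  move=> SQ; apply/(opnorm_sq_le (sqrt_comp_linear SQ) M0); rewrite -A2E.
  by apply: ereal_sup_ubound; right; exists Q.
split=> Q SQ u; have [pA pB] := averages_rposop SQ.
- exact: (sqrt_norm_formV ip_norm M0 pA pB (h Q SQ)).
- exact: (sqrt_norm_form ip_norm pA pB (h Q SQ)).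
Qed.

(** Converse direction of the translation between forms and square roots, used
    for the lower bounds. *)
Lemma form_A2_char_le M : 0 <= M -> A2_form B A M -> (A2 <= M%:E)%E.
Proof.
move=> M0 h; apply: ge_ereal_sup => x [->|[Q SQ <-]]; first by rewrite lee_fin.
have [pA pB] := averages_rposop SQ.
by apply/(opnorm_sq_le (sqrt_comp_linear SQ) M0)/(form_sqrt_norm ip_norm M0 pA pB)/h.
Qed.

Lemma lerner_bounded psi phi : A2_class mu ip S W ->
    admissible mu S psi -> admissible mu S phi ->
  tensor_bounded mu ip W (lerner mu S psi phi) /\
  (tensor_norm mu ip W (lerner mu S psi phi) <= 18%:E * A2 `^ (3 / 2))%E.
Proof.
move=> fA apsi aphi; have [hAB hBA] := A2_class_form fA.
have M0 : 0 <= fine A2 by rewrite fine_ge0 ?A2_char_ge0.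
have A2E : A2 = (fine A2)%:E by rewrite fineK// ge0_fin_numE ?A2_char_ge0.
have [E [bE eE nE]] := lerner_extension M0 hAB hBA apsi aphi.
split; first by exists E.
apply: (@le_trans _ _ (opnormL2 mu ip W E)); first by apply: ereal_inf_lbound; exists E.
by apply: le_trans nE _; rewrite upper_const_sqrt// A2E poweR_EFin EFinM.
Qed.

(** * Lerner operators with indicator symbols *)

Definition indic_symbol (G : set (Rd R d) -> set (Rd R d)) Q (x : Rd R d) : R[i] :=
  (\1_(G Q) x)%:C.

Lemma indic_symbol_admissible G :
    (forall Q, S Q -> measurable (G Q) /\ G Q `<=` Q) ->
  admissible mu S (indic_symbol G).
Proof.
move=> hG Q SQ; have [mG GQ] := hG Q SQ; split.
- exact: cmeasurable_indic.
- by move=> x nQ; rewrite /indic_symbol indicE memNset// => /GQ.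
- by apply: filterE => x; exact: cnorm_indic.
Qed.

Lemma average0 Q : average mu Q (fun=> 0) = 0.
Proof.
rewrite /average /cintegral /= (_ : Rintegral mu Q (fun=> 0) = 0); last first.
  by rewrite /Rintegral integral0.
by simpc.
Qed.

Lemma lerner_single (G1 G2 : set (Rd R d) -> set (Rd R d)) f Q0 x : S Q0 ->
    (forall Q, S Q -> Q <> Q0 -> ~ G1 Q x \/ (forall y, G2 Q y -> f y = 0)) ->
  lerner mu S (indic_symbol G1) (indic_symbol G2) f x =
  indic_symbol G1 Q0 x * average mu Q0 (fun y => indic_symbol G2 Q0 y * f y).
Proof.
move=> SQ0 loc; rewrite /lerner (@unordered_sum_single _ _ _ Q0); first by rewrite mem_set.
move=> Q QQ0; case: ifPn => // /set_mem SQ.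
case: (loc Q SQ QQ0) => [nG|f0].
  by rewrite /indic_symbol indicE memNset// mul0r.
rewrite (_ : (fun y => _) = fun=> 0) ?average0 ?mulr0//.
apply/funext => y; rewrite /indic_symbol indicE; case: (boolP (y \in (G2 Q : set (Rd R d)))) => [/set_mem/f0->|_].
  by rewrite mulr0.
by rewrite mul0r.
Qed.

Lemma tensor_sum_in_L2 g : tensor_sum g -> in_L2 W' g.
Proof.
move=> [n [f [e [Lf ->]]]]; elim: n f e Lf => [|n IH] f e Lf.
  split; first by move=> v; under eq_fun do rewrite big_ord0 rdot0l; exact: measurable_cst.
  rewrite (_ : (fun _ => _) = fun=> 0%E) ?integral0//.
  by apply/funext => x; rewrite /qform big_ord0 rdot0r.
have -> : (fun y => \sum_(i < n.+1) f i y *: e i) = (fun y => 1 *: (f ord_max y *: e ord_max) +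
    \sum_(i < n) f (widen_ord (leqnSn n) i) y *: e (widen_ord (leqnSn n) i)).
  by apply/funext => y; rewrite big_ord_recr/= addrC scale1r.
apply: (in_L2_lin WV).
  exact: tensor_in_L2.
exact: (IH _ _ (fun i => Lf _)).
Qed.

Lemma mean_tensor_sum phi n (f : 'I_n -> Rd R d -> R[i]) (e : 'I_n -> H) Q : S Q ->
    (forall Q, S Q -> cmeasurable (phi Q)) ->
    (forall Q x, S Q -> complex.Re `|phi Q x| <= 1) ->
    (forall i, Linf0 mu (f i)) ->
  mean phi (fun x => \sum_(i < n) f i x *: e i) Q =
  \sum_(i < n) average mu Q (fun y => phi Q y * f i y) *: e i.
Proof.
move=> SQ mphi phi1 Lf; have mQ := mS SQ.
have L2i i := tensor_in_L2 (e i) (Lf i).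
have L2s : in_L2 W' (fun x => \sum_(i < n) f i x *: e i).
  by apply: tensor_sum_in_L2; exists n, f, e.
have [mg fg] := in_L2_phi WV mphi phi1 L2s SQ.
apply: (rdot_inj ip_norm) => v; rewrite /mean (vavgE WV mg fg SQ).
rewrite rdot_suml.
have -> : \int[mu]_(x in Q) rdot (phi Q x *: (\sum_(i < n) f i x *: e i)) v =
    \int[mu]_(x in Q) \sum_(i < n) rdot (phi Q x *: (f i x *: e i)) v.
  by apply: eq_Rintegral => x _; rewrite scaler_sumr rdot_suml.
rewrite Rintegral_sum//; last first.
  move=> i _; have [mi fi] := in_L2_phi WV mphi phi1 (L2i i) SQ.
  exact: (integrable_rdot_cube WV v mi fi SQ).
rewrite mulr_sumr; apply: eq_bigr => i _; have [mf _ _] := Lf i.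
rewrite -(mean_tensor mphi phi1 SQ mf (L2i i)).
have [mi fi] := in_L2_phi WV mphi phi1 (L2i i) SQ.
by rewrite /mean (vavgE WV mi fi SQ).
Qed.

(** At a point of [X] only the term of [Q0] is nonzero, so the Lerner operator
    takes there the constant value [u], and its norm on [X] is at most its
    norm on the whole space. *)
Lemma tensor_test (G1 G2 : set (Rd R d) -> set (Rd R d)) E (c : R) n (f : 'I_n -> Rd R d -> R[i]) (e : 'I_n -> H) Q0 X :
    (forall Q, S Q -> measurable (G2 Q)) ->
    extends_tensor mu (lerner mu S (indic_symbol G1) (indic_symbol G2)) E ->
    (forall f, L2 mu ip W f -> L2 mu ip W (E f)) ->
    (forall f, L2 mu ip W f -> (sqnormL2 mu ip W (E f) <= c%:E * sqnormL2 mu ip W f)%E) ->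
    S Q0 -> measurable X -> X `<=` G1 Q0 -> (forall i, Linf0 mu (f i)) ->
    (forall x Q i, X x -> S Q -> Q <> Q0 ->
      ~ G1 Q x \/ (forall y, G2 Q y -> f i y = 0)) ->
  forall g u, g = (fun x => \sum_(i < n) f i x *: e i) ->
    u = vavg Q0 (fun x => indic_symbol G2 Q0 x *: g x) ->
  (\int[mu]_(x in X) (rdot (W' x u) u)%:E <= c%:E * \int[mu]_x (qform W' g x)%:E)%E.
Proof.
move=> mG2 tE LE bE SQ0 mX XG Lf loc g u gE ->.
set v := vavg _ _.
have gL2 : in_L2 W' g by rewrite gE; apply: tensor_sum_in_L2; exists n, f, e.
have gL := (L2E g).2 gL2; have [mEg fEg] := (L2E _).1 (LE g gL).
have qm h (mh : wmeas ip h) := qform_measurable WV mh.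
have uE : v = \sum_(i < n) average mu Q0 (fun y => indic_symbol G2 Q0 y * f i y) *: e i.
  rewrite /v gE; apply: mean_tensor_sum => // [Q SQ|Q x SQ].
    by apply: cmeasurable_indic; exact: mG2.
  have := cnorm_indic (G2 Q) x; rewrite cnormE; have -> : 1 = 1%:C :> R[i] by [].
  by rewrite lecR.
have ae : {ae mu, forall x, X x -> E g x = v}.
  apply: filterS (tE n f e Lf) => x; rewrite -gE => -> Xx; rewrite uE; apply: eq_bigr => i _.
  rewrite (lerner_single SQ0); last by move=> Q SQ QQ0; exact: loc.
  by rewrite {1}/indic_symbol indicE mem_set ?mul1r//; exact: XG.
apply: (@le_trans _ _ (sqnormL2 mu ip W (E g))); last first.
  apply: le_trans (bE g gL) _.
  by rewrite (sqnormL2E gL2.1).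
rewrite (sqnormL2E mEg).
have -> : (\int[mu]_(x in X) (rdot (W' x v) v)%:E =
    \int[mu]_(x in X) (qform W' (E g) x)%:E)%E.
  apply: ae_eq_integral => //.
  - apply/measurable_EFinP; apply: measurable_funTS; exact: (qm _ (wmeas_cst ip v)).
  - apply/measurable_EFinP; apply: measurable_funTS; exact: qm.
  - by apply: filterS ae => x h Xx; rewrite /qform h.
apply: ge0_subset_integral => //.
- by apply/measurable_EFinP; exact: qm.
- by move=> x _; rewrite lee_fin (qform_ge0 WV).
Qed.

(** * Consequences of the boundedness of test operators *)

Local Notation sqnorm := (sqnormL2 mu ip W).
Let sq0 f : (0 <= sqnorm f)%E. Proof. exact: sqnormL2_ge0. Qed.

Lemma boundedL2_sq E : boundedL2 mu ip W E -> exists2 c : R, 0 <= c &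
  forall f, L2 mu ip W f -> (sqnorm (E f) <= c%:E * sqnorm f)%E.
Proof.
move=> [_ _ [M hM]]; exists (Num.max 0 M ^+ 2); first exact: sqr_ge0.
move=> f Lf; apply: sq_poweR_half_le => //; first by rewrite le_max lexx.
apply: le_trans (hM f Lf) _; apply: lee_wpmul2r; first exact: poweR_ge0.
by rewrite lee_fin le_max lexx orbT.
Qed.

Lemma sqnormL2Z (a : R[i]) f : wmeas ip f ->
  wmeas ip (fun x => a *: f x) /\
  (sqnorm (fun x => a *: f x) = (complex.Re `|a| ^+ 2)%:E * sqnorm f)%E.
Proof.
move=> mf; have ma : wmeas ip (fun x => a *: f x).
  by apply: wmeasZ => //; exact: measurable_cst.
split=> //; rewrite !sqnormL2E// -ge0_integralZl//.
- by apply: eq_integral => x _; rewrite /qform (form_scale (dw_W WV x)) EFinM.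
- by apply/measurable_EFinP; exact: (qform_measurable WV).
- by move=> x _; rewrite lee_fin (qform_ge0 WV).
- by rewrite lee_fin sqr_ge0.
Qed.

Lemma sqnormL2_ae f g : wmeas ip f -> wmeas ip g -> {ae mu, forall x, f x = g x} ->
  sqnorm f = sqnorm g.
Proof.
move=> mf mg fg; rewrite !sqnormL2E//; apply: ae_eq_integral => //.
- by apply/measurable_EFinP; exact: (qform_measurable WV).
- by apply/measurable_EFinP; exact: (qform_measurable WV).
- by apply: filterS fg => x e _; rewrite /qform e.
Qed.

(** An operator linear almost everywhere is homogeneous: apply linearity to
    [f = (t - 1) h + h], where [t] is the norm of [f] and [h = f / t]. When
    [t = 0] the crude bound contained in [boundedL2] suffices. *)
Lemma opnormL2_sq E (K : R) : 0 <= K -> boundedL2 mu ip W E ->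
    (opnormL2 mu ip W E <= K%:E)%E ->
  forall f, L2 mu ip W f -> (sqnorm (E f) <= (K ^+ 2)%:E * sqnorm f)%E.
Proof.
move=> K0 bE nE f Lf; have [LE lin _] := bE.
have [c c0 hc] := boundedL2_sq bE; have [mf _] := (L2E f).1 Lf.
have yE : sqnorm f = (fine (sqnorm f))%:E by rewrite fineK// ge0_fin_numE//; case: Lf.
have := fine_ge0 (sq0 f); rewrite le0r => /orP[/eqP y0|y0].
  by have := hc f Lf; rewrite yE y0 !mule0.
set y := fine _ in yE y0; set t := Num.sqrt y.
have t0 : 0 < t by rewrite sqrtr_gt0.
pose h x := (t^-1)%:C *: f x.
have ht : complex.Re `|(t^-1)%:C| = t^-1 by rewrite normcR ger0_norm// invr_ge0 ltW.
have [mh sh] := sqnormL2Z (t^-1)%:C mf.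
have sh1 : sqnorm h = 1%E.
  rewrite sh ht yE -EFinM exprVn sqr_sqrtr ?(ltW y0)// mulVf// gt_eqF//.
have Lh : L2 mu ip W h.
  by apply/L2E; split=> //; rewrite -sqnormL2E// sh1 ltry.
have nh : (sqnorm (E h) <= (K ^+ 2)%:E)%E.
  rewrite -[leRHS]mule1 -sh1; apply: sq_poweR_half_le => //.
  rewrite sh1 poweR1r mule1; apply: le_trans nE.
  by apply: ereal_sup_ubound; exists h => //; split=> //; rewrite /normL2 sh1 poweR1r.
have fE : f = fun x => (t - 1)%:C *: h x + h x.
  apply/funext => x; rewrite -[X in _ + X]scale1r -scalerDl /h scalerA.
  have -> : (t - 1)%:C + 1 = t%:C :> R[i] by simpc; rewrite subrK.
  by rewrite -rmorphM divff ?gt_eqF// scale1r.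
have [mEh _] := (L2E _).1 (LE h Lh); have [mEf _] := (L2E _).1 (LE f Lf).
have [mtE stE] := sqnormL2Z t%:C mEh.
have -> : sqnorm (E f) = sqnorm (fun x => t%:C *: E h x).
  apply: sqnormL2_ae => //; have := lin (t - 1)%:C h h Lh Lh; rewrite -fE.
  apply: filterS => x ->.
  rewrite -[X in _ + X]scale1r -scalerDl; congr (_ *: _).
  by simpc; rewrite subrK.
rewrite stE yE muleC; apply: lee_pmul => //; first by rewrite lee_fin sqr_ge0.
by rewrite lee_fin normcR ger0_norm ?(ltW t0)// sqr_sqrtr// ltW.
Qed.

(** [tensor_test] combined with [mean_form_bound]: testing on tensors supported
    in [Q0] reaches the vectors [B Q0 v]. *)
Lemma tensor_test_form (G1 G2 : set (Rd R d) -> set (Rd R d)) E (c : R) Q0 X v :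
    0 <= c -> (forall Q, S Q -> measurable (G2 Q)) -> G2 Q0 = Q0 ->
    extends_tensor mu (lerner mu S (indic_symbol G1) (indic_symbol G2)) E ->
    (forall f, L2 mu ip W f -> L2 mu ip W (E f)) ->
    (forall f, L2 mu ip W f -> (sqnorm (E f) <= c%:E * sqnorm f)%E) ->
    S Q0 -> measurable X -> X `<=` G1 Q0 -> X `<=` Q0 ->
    (forall x Q, X x -> S Q -> Q <> Q0 -> ~ G1 Q x) ->
  \int[mu]_(x in X) rdot (W' x (B Q0 v)) (B Q0 v) <=
  4 * c * (fine (mu Q0) * rdot (B Q0 v) v).
Proof.
move=> c0 mG2 GQ0 tE LE bE SQ0 mX XG XQ loc.
have mQ := mS SQ0.
have tL2 := tensor_sum_in_L2.
apply: (mean_form_bound WV tL2 SQ0) => // g tg gQ.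
have [n [f [e [Lf gE]]]] := tg; have [mg fg] := tL2 g tg.
have uE : vavg Q0 g = vavg Q0 (fun x => indic_symbol G2 Q0 x *: g x).
  congr vavg; apply/funext => x; rewrite /indic_symbol GQ0 indicE.
  have [Qx|nQ] := pselect (Q0 x); first by rewrite mem_set// scale1r.
  by rewrite gQ// scaler0.
have := tensor_test mG2 tE LE bE SQ0 mX XG Lf
  (fun x Q i Xx SQ QQ0 => or_introl (loc x Q Xx SQ QQ0)) gE uE.
have qg0 x : ~ Q0 x -> qform W' g x = 0 by move=> nQ; rewrite /qform gQ// rdot0r.
have pos x : 0 <= qform W' g x by exact: (qform_ge0 WV).
have -> : (\int[mu]_x (qform W' g x)%:E = \int[mu]_(x in Q0) (qform W' g x)%:E)%E.
  rewrite [RHS]integral_mkcond; apply: eq_integral => x _; rewrite patchE.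
  by case: ifPn => // /negP nQ; rewrite qg0// => /mem_set.
have mq : measurable_fun setT (qform W' g) by exact: (qform_measurable WV).
have iq : mu.-integrable Q0 (EFin \o qform W' g).
  apply: ge0_integrable => //; first exact: measurable_funTS.
  apply: le_lt_trans fg; apply: ge0_subset_integral => //; first exact/measurable_EFinP.
  by move=> x _; rewrite lee_fin.
have iu u : mu.-integrable X (EFin \o (fun x => rdot (W' x u) u)).
  apply: (@integrableS _ _ _ mu Q0 X _ mQ mX XQ).
  exact: (integrable_qform_cst WV u SQ0).
by rewrite -Rint_EFin; [rewrite -Rint_EFin//|exact: mX|exact: iu].
Qed.

Lemma degenerate_cube U Q u v : (forall x, linear (U x)) ->
    weakly_loc_integrable_op mu ip D U -> S Q -> fine (mu Q) = 0 ->
  rdot (opaverage mu ip U Q u) v = 0.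
Proof.
move=> lU hU SQ m0; have [_ ->] := opaverageP lU hU (SD SQ).
by rewrite m0 invr0 mul0r.
Qed.

(** A form bound times [mu Q] suffices: averages over null cubes vanish. *)
Lemma A2_form_cancel Q v (M : R) : S Q ->
    fine (mu Q) * rdot (A Q (B Q v)) (B Q v) <= M * (fine (mu Q) * rdot (B Q v) v) ->
  rdot (A Q (B Q v)) (B Q v) <= M * rdot (B Q v) v.
Proof.
have [bW _ _ lW lV] := W_weight.
have linW x : linear (W x) by case: (bW x).
have linV x : linear (opinv (W x)) by case: (opinv_bounded (W x)).
move=> SQ; have [m0|mN0] := eqVneq (fine (mu Q)) 0.
  by rewrite !degenerate_cube// mulr0.
have mp : 0 < fine (mu Q) by rewrite lt_def mN0 fine_ge0.
by rewrite mulrCA ler_pM2l.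
Qed.

(** The Lerner operator with the only symbol [1_Q0] is the averaging operator
    over [Q0]. *)
Lemma single_cube_form E (c : R) Q0 : 0 <= c -> S Q0 ->
    let G := fun Q => if `[< Q = Q0 >] then Q0 else set0 in
    extends_tensor mu (lerner mu S (indic_symbol G) (indic_symbol G)) E ->
    (forall f, L2 mu ip W f -> L2 mu ip W (E f)) ->
    (forall f, L2 mu ip W f -> (sqnorm (E f) <= c%:E * sqnorm f)%E) ->
  forall v, fine (mu Q0) * rdot (A Q0 (B Q0 v)) (B Q0 v) <=
    4 * c * (fine (mu Q0) * rdot (B Q0 v) v).
Proof.
move=> c0 SQ0 G tE LE bE v.
have mQ := mS SQ0.
have GQ0 : G Q0 = Q0 by rewrite /G asboolT.
have mG Q : S Q -> measurable (G Q).
  by rewrite /G; case: asboolP.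
rewrite (dw_avW WV SQ0); apply: (tensor_test_form v c0 mG GQ0 tE LE bE SQ0 mQ) => //.
  by rewrite GQ0.
by move=> x Q _ _ /asboolPn/negPf QQ0; rewrite /G QQ0.
Qed.

(** The part of [Q] left by the smaller cubes of [S]: these parts are pairwise
    disjoint, and sparseness leaves at least half of [Q]. *)
Definition own Q := Q `\` inner S Q.

Lemma own_disjoint P Q x : S P -> S Q -> own P x -> own Q x -> P = Q.
Proof.
move=> SP SQ [Px nP] [Qx nQ]; apply: contrapT => PQ.
case: (grid_nested D_grid (SD SP) (SD SQ) Px Qx) => [h|h].
  by apply: nQ; exists P => //; split=> //; split=> // h2; apply/PQ/seteqP.
by apply: nP; exists Q => //; split=> //; split=> // h2; apply/PQ/seteqP.
Qed.

Lemma own_measurable Q : S Q -> measurable (own Q).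
Proof.
move=> SQ; apply: measurableD; first by apply: (grid_measurable D_grid); exact: SD.
exact: (inner_measurable D_grid SD).
Qed.

Lemma own_half Q : S Q -> fine (mu Q) <= 2 * fine (mu (own Q)).
Proof.
move=> SQ; have mQ := mS SQ.
have mI := inner_measurable D_grid SD Q.
have IQ := @inner_sub _ _ S Q.
have fQ := grid_finite mu_lf D_grid (SD SQ).
have finQ : mu Q \is a fin_num by rewrite ge0_fin_numE.
have fin P : measurable P -> P `<=` Q -> mu P \is a fin_num.
  move=> mP PQ; rewrite ge0_fin_numE//; apply: le_lt_trans fQ.
  by apply: le_measure; rewrite ?inE.
have finI := fin _ mI IQ.
have finO := fin _ (own_measurable SQ) (@subDsetl _ _ _).
have e : mu Q = (mu (inner S Q) + mu (own Q))%E.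
  rewrite -measureU//; first by rewrite setDUK.
    exact: own_measurable.
  by rewrite setDIK.
have h : fine (mu (inner S Q)) <= 2^-1 * fine (mu Q).
  by rewrite -lee_fin EFinM !fineK//; exact: (inner_half d_gt0 D_grid SD S_sparse SQ).
have {e} : fine (mu Q) = fine (mu (inner S Q)) + fine (mu (own Q)) by rewrite e fineD.
by move: h; move: (fine _) (fine _) (fine _) => a b c; lra.
Qed.

(** With [psi = 1_(own Q)] and [phi = 1_Q] the terms of the operator have
    disjoint supports, so on [own Q0] one sees the average over [Q0] alone. *)
Lemma own_average_form E (c : R) Q0 : 0 <= c -> S Q0 ->
    extends_tensor mu (lerner mu S (indic_symbol own) (indic_symbol id)) E ->
    (forall f, L2 mu ip W f -> L2 mu ip W (E f)) ->
    (forall f, L2 mu ip W f -> (sqnorm (E f) <= c%:E * sqnorm f)%E) ->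
  forall v, \int[mu]_(x in own Q0) rdot (W' x (B Q0 v)) (B Q0 v) <=
    4 * c * (fine (mu Q0) * rdot (B Q0 v) v).
Proof.
move=> c0 SQ0 tE LE bE v.
apply: (tensor_test_form v c0 _ _ tE LE bE SQ0 (own_measurable SQ0)) => //.
- exact: subDsetl.
- by move=> x Q ox SQ QQ0 oQ; apply: QQ0; exact: own_disjoint oQ ox.
Qed.

(** With [psi = 1_Q] and [phi = 1_(own Q)], a function supported in [own Q0] has
    a single nonzero average; for [1_(own Q0) e] it is [e] times the ratio of
    the measures of [own Q0] and [Q0], which is at least one half. *)
Lemma own_mass_form E (c : R) Q0 : 0 <= c -> S Q0 -> fine (mu Q0) != 0 ->
    extends_tensor mu (lerner mu S (indic_symbol id) (indic_symbol own)) E ->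
    (forall f, L2 mu ip W f -> L2 mu ip W (E f)) ->
    (forall f, L2 mu ip W f -> (sqnorm (E f) <= c%:E * sqnorm f)%E) ->
  forall e, \int[mu]_(x in Q0) rdot (W' x e) e <=
    4 * c * \int[mu]_(x in own Q0) rdot (W' x e) e.
Proof.
move=> c0 SQ0 mQ0 tE LE bE e.
have mQ := mS SQ0.
have mO := own_measurable SQ0.
have [K cK QK] := grid_sub_compact D_grid (SD SQ0).
have OQ : own Q0 `<=` Q0 by exact: subDsetl.
pose f (i : 'I_1) (x : Rd R d) : R[i] := (\1_(own Q0) x)%:C.
have Lf i : Linf0 mu (f i) by exact: (Linf0_indic mO cK (subset_trans OQ QK)).
pose g x := (\1_(own Q0) x)%:C *: e.
have gE : g = fun x => \sum_(i < 1) f i x *: (fun=> e) i.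
  by apply/funext => x; rewrite big_ord1.
have tg : tensor_sum g by exists 1%N, f, (fun=> e).
have ggE : (fun x => indic_symbol own Q0 x *: g x) = g.
  apply/funext => x; rewrite /g /indic_symbol indicE; case: (x \in own Q0).
    by rewrite !scale1r.
  by rewrite !scale0r.
have loc (x : Rd R d) Q (i : 'I_1) : Q0 x -> S Q -> Q <> Q0 ->
    ~ (id Q : set (Rd R d)) x \/ (forall y, own Q y -> f i y = 0).
  move=> _ SQ QQ0; right => y oy; rewrite /f indicE memNset// => oy'.
  by apply: QQ0; exact: own_disjoint oy oy'.
have := tensor_test own_measurable tE LE bE SQ0 mQ (@subset_refl _ Q0) Lf loc gE (erefl _).
rewrite ggE; set m := fine (mu Q0) in mQ0; pose mo := fine (mu (own Q0)).
have [mg fg] := tensor_sum_in_L2 tg.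
have uE : vavg Q0 g = (m^-1 * mo)%:C *: e.
  apply: (rdot_inj ip_norm) => w; rewrite (vavgE WV mg fg SQ0).
  rewrite rdotZl -mulrA; congr (_ * _).
  rewrite (_ : Rintegral mu Q0 _ = \int[mu]_(x in Q0) (rdot e w * \1_(own Q0) x)); last first.
    by apply: eq_Rintegral => x _; rewrite /g rdotZl mulrC.
  rewrite RintegralZl//; last first.
    apply: ge0_integrable => //.
    rewrite integral_indic// setIidl//; apply: le_lt_trans (grid_finite mu_lf D_grid (SD SQ0)).
    by apply: le_measure; rewrite ?inE.
  by rewrite mulrC /Rintegral integral_indic// setIidl.
rewrite uE.
have lhs : (\int[mu]_(x in Q0) (rdot (W' x ((m^-1 * mo)%:C *: e)) ((m^-1 * mo)%:C *: e))%:E =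
    ((m^-1 * mo) ^+ 2 * \int[mu]_(x in Q0) rdot (W' x e) e)%:E)%E.
  rewrite EFinM Rint_EFin//; last exact: (integrable_qform_cst WV e SQ0).
  rewrite -ge0_integralZl//; last 3 first.
  - apply/measurable_EFinP; apply: measurable_funTS.
    exact: (qform_measurable WV (wmeas_cst ip e)).
  - by move=> x _; rewrite lee_fin; exact: (qform_ge0 WV (fun=> e)).
  - by rewrite lee_fin sqr_ge0.
  apply: eq_integral => x _; rewrite (form_scale (dw_W WV x)) normcR -EFinM.
  by rewrite real_normK ?num_real.
have rhs : (\int[mu]_x (qform W' g x)%:E =
    (\int[mu]_(x in own Q0) rdot (W' x e) e)%:E)%E.
  rewrite Rint_EFin//; last first.
    apply: (@integrableS _ _ _ mu Q0 (own Q0) _ mQ mO OQ).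
    exact: (integrable_qform_cst WV e SQ0).
  rewrite [RHS]integral_mkcond; apply: eq_integral => x _; rewrite patchE /qform /g indicE.
  case: ifPn => _; first by rewrite scale1r.
  by rewrite scale0r rdot0r.
rewrite lhs rhs -EFinM lee_fin.
have h1 : 1 <= 2 * (m^-1 * mo).
  have mp : 0 < m by rewrite lt_def mQ0 fine_ge0.
  by rewrite mulrCA ler_pdivlMl// mulr1; exact: own_half.
have I0 : 0 <= \int[mu]_(x in Q0) rdot (W' x e) e.
  by apply: Rintegral_ge0 => x _; exact: (qform_ge0 WV (fun=> e)).
move: (m^-1 * mo) h1 => t h1.
move: I0; move: (\int[mu]_(x in Q0) _) (\int[mu]_(x in own Q0) _) => a b a0 h.
have h2 : 1 <= 4 * t ^+ 2.
  have -> : 4 * t ^+ 2 = (2 * t) ^+ 2 by ring.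
  by rewrite expr_ge1// (le_trans ler01 h1).
apply: (@le_trans _ _ (4 * (t ^+ 2 * a))); first by rewrite mulrA ler_peMl.
by rewrite -mulrA ler_wpM2l.
Qed.

(** * The two-sided estimate *)

(** Testing single cubes would give for each cube a bound of its own. Two Lerner
    operators see all cubes at once: with [e = B Q v], [own_mass_form] compares
    the mass of [Q] with that of [own Q], and [own_average_form] bounds the
    latter. *)
Lemma bounded_A2_class :
    (forall psi phi, admissible mu S psi -> admissible mu S phi ->
      tensor_bounded mu ip W (lerner mu S psi phi)) ->
  A2_class mu ip S W.
Proof.
move=> bnd.
have aid : admissible mu S (indic_symbol id).
  by apply: indic_symbol_admissible => Q SQ; split=> //; exact: mS.
have aown : admissible mu S (indic_symbol own).
  apply: indic_symbol_admissible => Q SQ; split; last exact: subDsetl.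
  exact: own_measurable.
have [E1 [bE1 tE1]] := bnd _ _ aown aid; have [E2 [bE2 tE2]] := bnd _ _ aid aown.
have [c1 c10 h1] := boundedL2_sq bE1; have [c2 c20 h2] := boundedL2_sq bE2.
have [LE1 _ _] := bE1; have [LE2 _ _] := bE2.
pose M := 4 * c2 * (4 * c1).
have M0 : 0 <= M by rewrite !mulr_ge0.
apply: (@le_lt_trans _ _ M%:E); last exact: ltry.
apply: (form_A2_char_le M0) => Q SQ v.
apply: (A2_form_cancel SQ).
have [m0|mN0] := eqVneq (fine (mu Q)) 0; first by rewrite m0 !mul0r mulr0.
rewrite (dw_avW WV SQ).
have := own_mass_form c20 SQ mN0 tE2 LE2 h2 (B Q v).
move=> /le_trans; apply; rewrite /M -[leRHS]mulrA ler_wpM2l ?mulr_ge0//.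
exact: (own_average_form c10 SQ tE1 LE1 h1).
Qed.

(** The averaging operators over single cubes are Lerner operators. *)
Lemma A2_char_tensor_norm (n : R) : 0 <= n ->
    (forall psi phi, admissible mu S psi -> admissible mu S phi ->
      (tensor_norm mu ip W (lerner mu S psi phi) <= n%:E)%E) ->
  (A2 <= (4 * n ^+ 2)%:E)%E.
Proof.
move=> n0 bnd; apply: form_A2_char_le.
  by rewrite mulr_ge0 ?sqr_ge0.
move=> Q0 SQ0 v; apply: (A2_form_cancel SQ0).
pose G := fun Q => if `[< Q = Q0 >] then Q0 else set0.
have mQ := mS SQ0.
have aG : admissible mu S (indic_symbol G).
  apply: indic_symbol_admissible => Q SQ; rewrite /G; case: asboolP => [->|_]; split=> //.
have [_ pB] := averages_rposop SQ0.
have b0 : 0 <= fine (mu Q0) * rdot (B Q0 v) v.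
  by rewrite mulr_ge0 ?fine_ge0//; case: pB.
set b := fine (mu Q0) * rdot (B Q0 v) v in b0 *.
apply: (@le_of_le_add_eps _ _ _ (4 * (2 * n + 1) * b)).
  by apply: mulr_ge0 => //; apply: mulr_ge0 => //; rewrite addr_ge0// mulr_ge0.
(* The infimum defining the norm may not be attained, whence the margin [t]. *)
move=> e e0; pose t := Num.min 1 e.
have t0 : 0 < t by rewrite lt_min ltr01.
have : (tensor_norm mu ip W (lerner mu S (indic_symbol G) (indic_symbol G)) < (n + t)%:E)%E.
  by apply: le_lt_trans (bnd _ _ aG aG) _; rewrite lte_fin ltrDl.
move=> /ereal_inf_lt[_ [E [bE tE] <-]] /ltW nE.
have nt0 : 0 <= n + t by rewrite addr_ge0// ltW.
have sE := opnormL2_sq nt0 bE nE.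
have [LE _ _] := bE.
have h := single_cube_form (sqr_ge0 (n + t)) SQ0 tE LE sE v.
apply: le_trans h _; rewrite -/b.
have t1 : t <= 1 by rewrite ge_min lexx.
have te : t <= e by rewrite ge_min lexx orbT.
have h : (n + t) ^+ 2 <= n ^+ 2 + (2 * n + 1) * e.
  exact: sqrD_small.
apply: (@le_trans _ _ (4 * (n ^+ 2 + (2 * n + 1) * e) * b)).
  by rewrite ler_wpM2r// ler_wpM2l.
by rewrite le_eqVlt; apply/orP; left; apply/eqP; ring.
Qed.

Lemma tensor_norm_ge0 T : (0 <= tensor_norm mu ip W T)%E.
Proof.
apply: le_ereal_inf_tmp => _ [E [bE _] <-].
have zE f : (0 <= normL2 mu ip W f)%E by exact: poweR_ge0.
have z : sqnormL2 mu ip W (fun=> 0) = 0%E.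
  have mz : wmeas ip (fun _ : Rd R d => 0 : H) by exact: wmeas_cst.
  rewrite (sqnormL2E mz) (_ : (fun _ => _) = fun=> 0%E) ?integral0//.
  by apply/funext => x; rewrite /qform rdot0r.
apply: le_trans (zE (E (fun=> 0))) _; apply: ereal_sup_ubound; exists (fun=> 0) => //.
split; last by rewrite /normL2 z poweR0r ?lee_fin ?invr_eq0 ?pnatr_eq0.
apply/L2E; split; first exact: wmeas_cst.
by rewrite -(sqnormL2E (wmeas_cst ip 0)) z ltry.
Qed.

End operator_weight.

End weighted_spaces.

Theorem theorem2p1 (R : realType) :
  exists C : R, 0 < C /\
  forall (d : nat) (d_gt0 : (0 < d)%N)
    (mu : {measure set (Rd R d) -> \bar R})
    (mu_lf : locally_finite_measure mu)
    (D : set (set (Rd R d))) (D_grid : dyadic_grid D)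
    (S : set (set (Rd R d))) (S_sub : S `<=` D) (S_sparse : sparse mu D S)
    (H : completeNormedModType R[i]) (ip : {dot H for Num.conj})
    (ip_norm : forall u : H, ip u u = `|u| ^+ 2)
    (H_sep : separable_space (H := H))
    (W : Rd R d -> H -> H) (W_weight : operator_weight mu ip D W),
  ((forall psi phi, admissible mu S psi -> admissible mu S phi ->
      tensor_bounded mu ip W (lerner mu S psi phi))
    <-> A2_class mu ip S W) /\
  (let N := ereal_sup [set tensor_norm mu ip W (lerner mu S p.1 p.2)
              | p in [set p | admissible mu S p.1 /\ admissible mu S p.2]] in
   ((C^-1)%:E * A2_char mu ip S W `^ (1 / 2) <= N)%E /\
   (N <= C%:E * A2_char mu ip S W `^ (3 / 2))%E).
Proof.
(* The upper constant is [18] and the lower one is [1 / 2]. *)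
exists 18; split=> // d d_gt0 mu mu_lf D D_grid S SD S_sparse H ip ip_norm H_sep W W_weight.
have [Z [mZ Z0 hZ]] := bad_set W_weight.
have A20 := A2_char_ge0 mu S ip W.
have upper psi phi := @lerner_bounded R d d_gt0 mu mu_lf D S D_grid SD S_sparse H ip ip_norm
  H_sep W W_weight Z mZ Z0 hZ psi phi.
split.
  split; last by move=> hA psi phi apsi aphi; have [] := upper psi phi hA apsi aphi.
  exact: (bounded_A2_class d_gt0 mu_lf D_grid SD S_sparse ip_norm H_sep W_weight mZ Z0 hZ).
move=> N; split.
- have [NE|Nlt] := eqVneq N +oo%E; first by rewrite NE leey.
  have bnd psi phi : admissible mu S psi -> admissible mu S phi ->
      (tensor_norm mu ip W (lerner mu S psi phi) <= N)%E.
    by move=> apsi aphi; apply: ereal_sup_ubound; exists (psi, phi).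
  have z0 : admissible mu S (indic_symbol (fun=> set0)).
    by apply: indic_symbol_admissible => Q SQ; split=> //; exact: sub0set.
  have N0 : (0 <= N)%E.
    apply: le_trans (bnd _ _ z0 z0).
    exact: (tensor_norm_ge0 mu_lf D_grid SD ip_norm H_sep W_weight mZ Z0 hZ).
  have NE : N = (fine N)%:E by rewrite fineK// ge0_fin_numE// lt_neqAle Nlt leey.
  have n0 : 0 <= fine N by exact: fine_ge0.
  rewrite NE in bnd *; move: (fine N) n0 bnd => n n0 bnd.
  have := A2_char_tensor_norm mu_lf D_grid SD ip_norm H_sep W_weight mZ Z0 hZ n0 bnd.
  have K0 : 0 <= 4 * n ^+ 2 by rewrite mulr_ge0 ?sqr_ge0.
  rewrite -[(4 * _)%:E]mule1 => /(poweR_half_le K0 A20 lee01).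
  have h4 : (4 * n ^+ 2) `^ 2^-1 = 2 * n.
    have -> : 4 * n ^+ 2 = (2 * n) ^+ 2 by ring.
    by rewrite -powR_mulrn ?mulr_ge0// -powRrM mulfV// powRr1// mulr_ge0.
  rewrite poweR1r mule1 h4 mul1r => h.
  apply: (@le_trans _ _ ((18^-1)%:E * (2 * n)%:E)%E).
    by apply: lee_wpmul2l => //; rewrite lee_fin invr_ge0.
  by rewrite -EFinM lee_fin mulrA ler_piMl// ler_pdivrMl// mulr1 ler_nat.
- have [->|Alt] := eqVneq (A2_char mu ip S W) +oo%E.
    by rewrite poweRyr ?mulf_neq0 ?invr_eq0 ?pnatr_eq0// gt0_muley ?leey// lte_fin.
  apply: ge_ereal_sup => _ [[psi phi] /= [apsi aphi] <-].
  have hA : A2_class mu ip S W by rewrite /A2_class lt_neqAle Alt leey.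
  by have [] := upper psi phi hA apsi aphi.
Qed.
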